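(* Let $n,m\ge 1$ and let $\Omega=A\times B\subset\mathbb{R}^n\times\mathbb{R}^m$, where $A$ is a convex polytope in $\mathbb{R}^n$ and $B$ is a bounded, measurable set in $\mathbb{R}^m$. If $\Omega$ is a spectral set, then $A$ is centrally symmetric and all the facets of $A$ are centrally symmetric.
   Context: A bounded, measurable set $\Omega\subset\mathbb{R}^d$ of positive Lebesgue measure is called spectral if there exists a countable set $\Lambda\subset\mathbb{R}^d$ (called a spectrum for $\Omega$) such that the system of exponential functions $E(\Lambda)=\{e_\lambda\}_{\lambda\in\Lambda}$, $e_\lambda(x)=e^{2\pi i\langle\lambda,x\rangle}$, is orthogonal and complete in $L^2(\Omega)$, i.e. is an orthogonal basis of $L^2(\Omega)$. (In particular, a spectral set has positive measure by definition.) A convex polytope in $\mathbb{R}^n$ is a compact set which is the convex hull of finitely many points. A facet of a convex polytope in $\mathbb{R}^n$ is an $(n-1)$-dimensional face of it. A convex polytope $P$ (in particular a facet) is called centrally symmetric if $-P$ is a translate of $P$. *)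

(* Defs.v *)
From HB Require Import structures.
From mathcomp Require Import all_boot all_order all_algebra.
From mathcomp Require Import all_classical all_reals all_analysis.
From mathcomp.real_closed Require Import complex.

Set Implicit Arguments.
Unset Strict Implicit.
Unset Printing Implicit Defensive.

Import Order.TTheory GRing.Theory Num.Theory.
Import numFieldNormedType.Exports.

Local Open Scope classical_set_scope.
Local Open Scope ring_scope.
Local Open Scope complex_scope.

(* Lebesgue measure on 'rV[R]_n is the completion (Caratheodory extension) of
   the n-fold product of the one-dimensional Lebesgue measure, which lives on
   the sigma-algebra generated by the coordinates, i.e. the Borel sets. *)

Definition borel_rV_display : measure_display.
Proof. exact: default_measure_display. Qed.

Section borel_rV.
Context (R : realType) (n : nat).

Let coord (i : 'I_n) (x : 'rV[R]_n) : measurableTypeR R := x ord0 i.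

Let borel0 : g_sigma_preimage coord set0.
Proof. exact: sigma_algebra0. Qed.

Let borelC A : g_sigma_preimage coord A -> g_sigma_preimage coord (~` A).
Proof. exact: sigma_algebraC. Qed.

Let borel_bigcup (F : (set _)^nat) :
  (forall i, g_sigma_preimage coord (F i)) ->
  g_sigma_preimage coord (\bigcup_i F i).
Proof. exact: sigma_algebra_bigcup. Qed.

HB.instance Definition _ := @isMeasurable.Build borel_rV_display
  'rV[R]_n (g_sigma_preimage coord) borel0 borelC borel_bigcup.

Lemma measurable_coord_rV (i : 'I_n) :
  measurable_fun [set: 'rV[R]_n]
    ((fun x => x ord0 i) : 'rV[R]_n -> measurableTypeR R).
Proof.
move=> _ Y mY; rewrite setTI; apply: sub_sigma_algebra => /=.
rewrite -bigcup_seq/=; exists i => /=; first by rewrite mem_index_enum.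
by exists Y => //; rewrite setTI.
Qed.

Lemma measurable_fun_rVP d (T : measurableType d) (f : T -> 'rV[R]_n) :
  (forall i, measurable_fun [set: T]
     ((fun t => f t ord0 i) : T -> measurableTypeR R)) ->
  measurable_fun [set: T] f.
Proof.
move=> mf _ Y mY; rewrite setTI.
have : (image_set_system setT f measurable) Y.
  move: Y mY; apply: smallest_sub.
    by apply: sigma_algebra_image; exact: sigma_algebra_measurable.
  rewrite -bigcup_seq => A [i _ [B mB <-]].
  rewrite /image_set_system /= !setTI.
  by have := mf i measurableT _ mB; rewrite setTI.
by rewrite /image_set_system/= setTI.
Qed.

End borel_rV.

Definition cons_rV (R : realType) (n : nat) (p : measurableTypeR R * 'rV[R]_n) :
  'rV[R]_n.+1 := row_mx (p.1%:M : 'rV[R]_1) p.2.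

Section lebesgue_step.
Context (R : realType) (n : nat).

Lemma cons_rV0 (p : measurableTypeR R * 'rV[R]_n) : cons_rV p ord0 ord0 = p.1.
Proof.
have -> : ord0 = lshift n (ord0 : 'I_1) :> 'I_n.+1 by exact/val_inj.
by rewrite [LHS]row_mxEl mxE eqxx mulr1n.
Qed.

Lemma cons_rVS (p : measurableTypeR R * 'rV[R]_n) (i : 'I_n) :
  cons_rV p ord0 (lift ord0 i) = p.2 ord0 i.
Proof.
have -> : lift ord0 i = rshift 1 i :> 'I_n.+1 by exact/val_inj.
by rewrite [LHS]row_mxEr.
Qed.

Lemma cons_rV_split (x : 'rV[R]_n.+1) :
  cons_rV (x ord0 ord0, \row_i x ord0 (lift ord0 i)) = x.
Proof.
apply/rowP => i; case: (unliftP ord0 i) => [j ->|->]; last by rewrite cons_rV0.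
by rewrite cons_rVS mxE.
Qed.

Lemma measurable_cons_rV :
  measurable_fun [set: measurableTypeR R * 'rV[R]_n] (@cons_rV R n).
Proof.
apply: measurable_fun_rVP => i; case: (unliftP ord0 i) => [j ->|->].
  under eq_fun do rewrite cons_rVS.
  exact: (measurableT_comp (measurable_coord_rV j) measurable_snd).
under eq_fun do rewrite cons_rV0.
exact: measurable_fst.
Qed.

Lemma measurable_uncons_rV : measurable_fun [set: 'rV[R]_n.+1]
  ((fun x => (x ord0 ord0, \row_i x ord0 (lift ord0 i))) :
    'rV[R]_n.+1 -> measurableTypeR R * 'rV[R]_n).
Proof.
apply: measurable_fun_pair; first exact: measurable_coord_rV.
apply: measurable_fun_rVP => i; under eq_fun do rewrite mxE.
exact: measurable_coord_rV.
Qed.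

Variable mu : {sigma_finite_measure set 'rV[R]_n -> \bar R}.

Definition lebesgue_step : set 'rV[R]_n.+1 -> \bar R :=
  pushforward (lebesgue_measure \x mu)%E (@cons_rV R n).

Let mpreim A : measurable A -> measurable (@cons_rV R n @^-1` A).
Proof.
by move=> mA; rewrite -[X in measurable X]setTI; exact: measurable_cons_rV.
Qed.

Let step0 : lebesgue_step set0 = 0%E.
Proof. by rewrite /lebesgue_step /pushforward preimage_set0 measure0. Qed.

Let step_ge0 A : (0 <= lebesgue_step A)%E.
Proof. by rewrite /lebesgue_step /pushforward measure_ge0. Qed.

Let step_sigma_additive : semi_sigma_additive lebesgue_step.
Proof.
move=> F mF tF mUF; rewrite /lebesgue_step /pushforward preimage_bigcup.
apply: measure_semi_sigma_additive.
- by move=> k; exact: mpreim.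
- apply/trivIsetP => /= i j _ _ ij; rewrite -preimage_setI.
  by move/trivIsetP : tF => /(_ _ _ _ _ ij) ->//; rewrite preimage_set0.
- by rewrite -preimage_bigcup; exact: mpreim.
Qed.

HB.instance Definition _ := isMeasure.Build _ _ _ lebesgue_step
  step0 step_ge0 step_sigma_additive.

Let step_sigma_finite : sigma_finite setT lebesgue_step.
Proof.
have /sigma_finiteP[F [TF ndF Foo]] := sigma_finiteT (@lebesgue_measure R).
have /sigma_finiteP[G [TG ndG Goo]] := sigma_finiteT mu.
pose unc (x : 'rV[R]_n.+1) : measurableTypeR R * 'rV[R]_n :=
  (x ord0 ord0, \row_i x ord0 (lift ord0 i)).
have consK : cancel (@cons_rV R n) unc.
  move=> [a v]; rewrite /unc cons_rV0; congr pair.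
  by apply/rowP => i; rewrite mxE cons_rVS.
exists (fun k => unc @^-1` (F k `*` G k)).
  rewrite -preimage_bigcup [X in _ @^-1` X](_ : _ = setT) ?preimage_setT//.
  apply/seteqP; split=> // -[x y] _.
  have [k _ Fkx] : (\bigcup_k F k) x by rewrite -TF.
  have [l _ Gly] : (\bigcup_k G k) y by rewrite -TG.
  exists (maxn k l) => //; split.
    by move: x Fkx; exact/subsetPset/ndF/leq_maxl.
  by move: y Gly; exact/subsetPset/ndG/leq_maxr.
move=> k; have [mFk Fk] := Foo k; have [mGk Gk] := Goo k; split.
  rewrite -[X in measurable X]setTI; apply: measurable_uncons_rV => //.
  exact: measurableX.
rewrite /lebesgue_step /pushforward -comp_preimage.
rewrite (_ : unc \o _ = id); last by apply/funext => p; exact: consK.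
by rewrite preimage_id product_measure1E// lte_mul_pinfty// ge0_fin_numE.
Qed.

HB.instance Definition _ :=
  Measure_isSigmaFinite.Build _ _ _ lebesgue_step step_sigma_finite.

End lebesgue_step.

Fixpoint borel_lebesgue (R : realType) (n : nat) :
    {sigma_finite_measure set 'rV[R]_n -> \bar R} :=
  if n is n'.+1 return {sigma_finite_measure set 'rV[R]_n -> \bar R}
  then lebesgue_step (borel_lebesgue R n')
  else \d_(0 : 'rV[R]_0).

Lemma measurable_rV_prod (R : realType) (n : nat)
    (A : 'I_n -> set (measurableTypeR R)) :
  (forall i, measurable (A i)) ->
  measurable [set x : 'rV[R]_n | forall i, A i (x ord0 i)].
Proof.
move=> mA; rewrite [X in measurable X](_ : _ = \big[setI/setT]_(i < n)
    ((fun x : 'rV[R]_n => x ord0 i) @^-1` A i)).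
  apply: bigsetI_measurable => i _; rewrite -[X in measurable X]setTI.
  exact: (measurable_coord_rV i measurableT (mA _)).
rewrite -bigcap_seq; apply/seteqP; split=> x /= xA i.
  by move=> _; exact: xA.
by apply: (xA i); rewrite /= mem_index_enum.
Qed.

Lemma borel_lebesgue_prod (R : realType) (n : nat)
    (A : 'I_n -> set (measurableTypeR R)) :
  (forall i, measurable (A i)) ->
  borel_lebesgue R n [set x | forall i, A i (x ord0 i)] =
  (\prod_(i < n) lebesgue_measure (A i))%E.
Proof.
elim: n A => [|n IH] A mA.
  rewrite big_ord0 /= diracE mem_set//=.
  by case.
have mB := measurable_rV_prod (fun i => mA (lift ord0 i)).
rewrite big_ord_recl -(IH (fun i => A (lift ord0 i)))// -product_measure1E//=.
rewrite /lebesgue_step /pushforward; congr product_measure1.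
apply/seteqP; split=> -[a v] /=.
  move=> H; split; first by have := H ord0; rewrite cons_rV0.
  by move=> i; have := H (lift ord0 i); rewrite cons_rVS.
move=> [Aa Av] i; case: (unliftP ord0 i) => [j ->|->]; last by rewrite cons_rV0.
by rewrite cons_rVS; exact: Av.
Qed.

Notation lebesgue_type R n := (caratheodory_type ((borel_lebesgue R n)^*)%mu).

Definition lebesgue_rV (R : realType) (n : nat) :
    {measure set (lebesgue_type R n) -> \bar R} :=
  @completed_measure_extension _ _ _ (borel_lebesgue R n).
Arguments lebesgue_rV : clear implicits.

Definition lebesgue_measurable (R : realType) (n : nat) (A : set 'rV[R]_n) :=
  measurable (A : set (lebesgue_type R n)).

Lemma lebesgue_rV_prod (R : realType) (n : nat)
    (A : 'I_n -> set (measurableTypeR R)) :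
  (forall i, measurable (A i)) ->
  lebesgue_rV R n [set x | forall i, A i (x ord0 i)] =
  (\prod_(i < n) lebesgue_measure (A i))%E.
Proof.
move=> mA; rewrite -borel_lebesgue_prod//; apply: measurable_mu_extE.
exact: measurable_rV_prod.
Qed.

Section L2.
Context (R : realType) (n : nat).
Implicit Types (Omega : set 'rV[R]_n) (f g : 'rV[R]_n -> R[i]).

Definition L2_norm Omega f : \bar R :=
  'N[lebesgue_rV R n]_2%:E[(fun x => (Normc.normc (f x))%:E) \_ Omega].

Definition in_L2 Omega f : Prop :=
  [/\ measurable_fun (Omega : set (lebesgue_type R n))
        (fun x => complex.Re (f x)),
      measurable_fun (Omega : set (lebesgue_type R n))
        (fun x => complex.Im (f x)) &
      (L2_norm Omega f < +oo)%E].

Definition L2_inner Omega f g : R[i] :=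
  let h x := f x * (g x)^* in
  (\int[lebesgue_rV R n]_(x in Omega) complex.Re (h x)) +i*
  (\int[lebesgue_rV R n]_(x in Omega) complex.Im (h x)).

Definition dot (u v : 'rV[R]_n) : R := \sum_(i < n) u ord0 i * v ord0 i.

Definition exponential (lambda x : 'rV[R]_n) : R[i] :=
  cos (2 * pi * dot lambda x) +i* sin (2 * pi * dot lambda x).

Definition orthogonal_exponentials Omega (Lambda : set 'rV[R]_n) : Prop :=
  forall lambda mu, Lambda lambda -> Lambda mu -> lambda != mu ->
    L2_inner Omega (exponential lambda) (exponential mu) = 0.

(* Completeness: finite linear combinations are dense in L^2(Omega). *)
Definition complete_exponentials Omega (Lambda : set 'rV[R]_n) : Prop :=
  forall f, in_L2 Omega f -> forall eps : R, 0 < eps ->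
    exists (s : seq 'rV[R]_n) (c : 'rV[R]_n -> R[i]),
      {subset s <= Lambda} /\
      (L2_norm Omega
         (fun x => f x - \sum_(lambda <- s) c lambda * exponential lambda x)%R
       < eps%:E)%E.

Definition spectrum Omega (Lambda : set 'rV[R]_n) : Prop :=
  [/\ countable Lambda,
      orthogonal_exponentials Omega Lambda &
      complete_exponentials Omega Lambda].

Definition spectral Omega : Prop :=
  [/\ bounded_set Omega, lebesgue_measurable Omega,
      (0 < lebesgue_rV R n Omega)%E & exists Lambda, spectrum Omega Lambda].

End L2.

Section polytopes.
Context (R : realType) (n : nat).
Implicit Types (P F : set 'rV[R]_n).

Definition convex_hull (S : set 'rV[R]_n) : set 'rV[R]_n :=
  smallest (@convex_set R 'rV[R]_n) S.

Definition convex_polytope P : Prop :=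
  compact P /\ exists s : seq 'rV[R]_n, P = convex_hull [set` s].

(* Intersections with supporting hyperplanes; u = 0 gives the improper faces. *)
Definition face P F : Prop :=
  exists (u : 'rV[R]_n) (c : R),
    (forall x, P x -> dot u x <= c) /\ F = P `&` [set x | dot u x = c].

(* V is the direction of the affine hull of F. *)
Definition affine_dim F (d : nat) : Prop :=
  F !=set0 /\ exists V : {vspace 'rV[R]_n},
    [/\ forall x y, F x -> F y -> x - y \in V,
        forall W : {vspace 'rV[R]_n},
          (forall x y, F x -> F y -> x - y \in W) -> (V <= W)%VS &
        \dim V = d].

Definition facet P F : Prop :=
  face P F /\ exists2 d : nat, affine_dim F d & d.+1 = n.

Definition centrally_symmetric P : Prop :=
  exists v : 'rV[R]_n, [set - x | x in P] = [set v + x | x in P].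

End polytopes.

(* R^n x R^m is identified with R^(n + m) by concatenation of coordinates. *)
Definition rV_setX (R : realType) (n m : nat) (A : set 'rV[R]_n)
    (B : set 'rV[R]_m) : set 'rV[R]_(n + m) :=
  [set row_mx a b | a in A & b in B].

(* Main.v *)
(* Let Lambda be a spectrum of A x B and psi a tent function supported in a box
   inside A.  By completeness, the energy of [e_c psi] is mostly carried by the
   frequencies whose component in R^n lies within a fixed radius r of c.  Capture
   frequencies near each of many separated centres c_j and colour them by their
   phases at finitely many given points.  The difference of two frequencies is a
   zero of the transform of 1_A or of 1_B; if it were always the latter for
   frequencies of one colour captured near different centres, these frequencies,
   each shifted by its centre, would still be orthogonal on A x B, and Bessel's
   inequality would bound the total energy per colour independently of the
   number of centres.  Hence the transform of 1_A vanishes at some xi within 2r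
   of a difference c_k - c_j, with prescribed phases almost equal to 1.

   Far out along a coordinate direction the transform of 1_A is asymptotically
   the contribution of the top and bottom slices of A, so these zeros force
   opposite slices to have the same area.  Then the caps of A in the directions
   v and -v have the same volume up to o(s), where s is their height.  The
   polytopes {<v, x> <= (1 - t) h(v) + t h(-v)} therefore have a volume with
   vanishing slope at t = 0, and it is log-concave in t by Brunn-Minkowski, so
   the one for t = 1/2, which contains (A - A) / 2, has at most the volume of A.
   This is the equality case of Brunn-Minkowski and makes A symmetric.

   For a facet F of A, the asymptotics is applied twice, with a first coordinate
   of xi much larger than the second.  As A is symmetric, its bottom facet is a
   reflected copy of F, and the four contributions show that opposite slices
   of F have the same area; the argument above applies to F. *)
Require Import Defs.
From HB Require Import structures.
From mathcomp Require Import all_boot all_order all_algebra.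
From mathcomp Require Import all_classical all_reals all_analysis.
From mathcomp Require Import measurable_realfun ring lra.
Set Implicit Arguments.
Unset Strict Implicit.
Unset Printing Implicit Defensive.
Import Order.TTheory GRing.Theory Num.Theory.
Import numFieldNormedType.Exports.
Local Open Scope classical_set_scope.
Local Open Scope ring_scope.

(** * Lebesgue integration of bounded functions of bounded support *)

Section nice.
Context (R : realType).
Local Notation leb := (@lebesgue_measure R).
Local Notation bl n := (borel_lebesgue R n).

(** A zero of the transform alone says little: the boundary terms carry unknown phases, and the
    other coordinates of the zero are merely bounded. The prescribed phases cure both defects.
    Points on the extreme slices align the boundary phases; short multiples of the remaining basis
    vectors force the remaining coordinates, bounded because the centres vary only in the first one
    or two coordinates, to be almost 0. Each term is then close to the area of its slice. The tent
    is Lipschitz, so its energy at distance [r] from the centre is O(1/r^2), with a constant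
    independent of centre and spectrum; this is why one radius serves all centres. In the equality
    case the two bodies are compared only through their volumes beyond hyperplanes: for every [l]
    the distribution of [<l, x>] on the polytope is symmetric, and twice the barycentre is a centre
    common to all [l]. All integrals are real: a complex transform becomes a sine integral with a
    free phase. Brunn-Minkowski is used in its multiplicative midpoint form, where no exponent
    depends on the dimension. *)

Definition nice1 (f : R -> R) :=
  measurable_fun setT (f : measurableTypeR R -> R) /\
  exists r c : R, forall t, `|f t| <= c /\ (f t != 0 -> `|t| <= r).

(** Borel, bounded, of bounded support: a class stable under sums, products with bounded Borel
    functions, invertible linear substitutions and partial integration. Integrability then never
    needs a separate argument and integrals are plain real numbers. *)
Definition nice n (f : 'rV[R]_n -> R) :=
  measurable_fun setT f /\
  exists r c : R, forall x, `|f x| <= c /\ (f x != 0 -> forall i, `|x ord0 i| <= r).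

Definition I1 (f : R -> R) := \int[leb]_t f t.
Definition In n (f : 'rV[R]_n -> R) := \int[bl n]_x f x.

Lemma nice1_int f : nice1 f -> leb.-integrable setT (EFin \o f).
Proof.
move=> [mf [r [c H]]].
apply/integrableP; split; first exact/measurable_EFinP.
apply: (@le_lt_trans _ _ (\int[leb]_x (c * \1_(`[-r, r]%classic) x)%:E)%E).
  apply: ge0_le_integral => //.
  - by apply: measurableT_comp => //; exact/measurable_EFinP.
  - apply/measurable_EFinP; apply: measurable_funM => //.
  - move=> x _ /=; rewrite lee_fin indicE.
    have [h1 h2] := H x.
    case: (boolP (x \in _)) => hx; first by rewrite mulr1.
    have [->|/h2 hr] := eqVneq (f x) 0; first by rewrite normr0 mulr0.
    exfalso; move/negP: hx; apply; rewrite inE /= in_itv /=.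
    by move: hr; rewrite ler_norml.
have c0 : 0 <= c by have [h1 _] := H 0; exact: le_trans h1.
under eq_integral do rewrite EFinM.
rewrite ge0_integralZl //; last by apply/measurable_EFinP.
rewrite integral_indic //= setIT lebesgue_measure_itv /=.
by case: ifP => _; rewrite ?mule0 ?ltry // -EFinB -EFinM ltry.
Qed.

Definition box n (r : R) : set 'rV[R]_n :=
  [set x | forall i, `[-r, r]%classic (x ord0 i)].

Lemma measurable_box n r : measurable (@box n r).
Proof. by apply: (measurable_rV_prod (A := fun=> `[-r, r]%classic)). Qed.

Lemma box_lty n r : (bl n (@box n r) < +oo)%E.
Proof.
rewrite /box (borel_lebesgue_prod (A := fun=> `[-r, r]%classic)) //.
set J := `[-r, r]%classic.
suff [] : (\prod_(i < n) leb J < +oo /\ 0 <= \prod_(i < n) leb J)%E by [].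
apply: (big_ind (fun x : \bar R => (x < +oo)%E /\ (0 <= x)%E)); first by rewrite ltry lee01.
- move=> x y [x1 x2] [y1 y2]; split; last exact: mule_ge0.
  by apply: lte_mul_pinfty => //; rewrite ge0_fin_numE.
- move=> i _; split => //.
  by rewrite /J lebesgue_measure_itv /=; case: ifP => // _; rewrite -EFinB ltry.
Qed.

Lemma nice_int n (f : 'rV[R]_n -> R) : nice f -> (bl n).-integrable setT (EFin \o f).
Proof.
move=> [mf [r [c H]]].
apply/integrableP; split; first exact/measurable_EFinP.
apply: (@le_lt_trans _ _ (\int[bl n]_x (c * \1_(@box n r) x)%:E)%E).
  apply: ge0_le_integral => //.
  - by apply: measurableT_comp => //; exact/measurable_EFinP.
  - apply/measurable_EFinP; apply: measurable_funM => //.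
    by apply: measurable_indic; exact: measurable_box.
  - move=> x _ /=; rewrite lee_fin indicE.
    have [h1 h2] := H x.
    case: (boolP (x \in _)) => hx; first by rewrite mulr1.
    have [->|/h2 hr] := eqVneq (f x) 0; first by rewrite normr0 mulr0.
    exfalso; move/negP: hx; apply; rewrite inE /= => i /=; rewrite in_itv /=.
    by move: (hr i); rewrite ler_norml.
have c0 : 0 <= c by have [h1 _] := H 0; exact: le_trans h1.
under eq_integral do rewrite EFinM.
have mi : measurable_fun setT (EFin \o (\1_(@box n r) : 'rV[R]_n -> R)).
  by apply/measurable_EFinP; apply: measurable_indic; exact: measurable_box.
rewrite ge0_integralZl //.
rewrite integral_indic //= ?setIT; last exact: measurable_box.
by apply: lte_mul_pinfty => //; exact: box_lty.
Qed.

(** [borel_lebesgue] is a pushforward of a product measure along [cons_rV], so Fubini costs one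
    change of variables. Partial integrals stay in the class: they vanish outside the same box and
    are at most the bound of [f] times the measure of a section of the box. *)
Lemma nice_cons n (f : 'rV[R]_n.+1 -> R) : nice f ->
  [/\ forall y, nice1 (fun t => f (cons_rV (t, y))),
      forall t, nice (fun y => f (cons_rV (t, y))),
      nice (fun y => I1 (fun t => f (cons_rV (t, y)))),
      nice1 (fun t => In (fun y => f (cons_rV (t, y)))) &
      In f = In (fun y => I1 (fun t => f (cons_rV (t, y)))) /\
      In f = I1 (fun t => In (fun y => f (cons_rV (t, y))))].
Proof.
move=> nf; have [mf [r [c H]]] := nf.
have mfc : measurable_fun setT (fun p => f (@cons_rV R n p)).
  by apply: measurableT_comp => //; exact: measurable_cons_rV.
have n1 : forall y, nice1 (fun t => f (cons_rV (t, y))).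
  move=> y; split.
    exact: (measurableT_comp mfc (pair2_measurable y)).
  exists r, c => t; have [h1 h2] := H (cons_rV (t, y)); split => // /h2 h.
  by have := h ord0; rewrite cons_rV0.
have n2 : forall t, nice (fun y => f (cons_rV (t, y))).
  move=> t; split.
    exact: (measurableT_comp mfc (pair1_measurable t)).
  exists r, c => y; have [h1 h2] := H (cons_rV (t, y)); split => // /h2 h i.
  by have := h (lift ord0 i); rewrite cons_rVS.
have fi : (leb \x bl n)%E.-integrable setT (fun p => (f (@cons_rV R n p))%:E).
  apply/integrableP; split; first exact/measurable_EFinP.
  have /integrableP[_] := nice_int nf.
  rewrite [X in (X < _)%E](_ : _ = \int[(leb \x bl n)%E]_x `|(f (@cons_rV R n x))%:E|)%E //.
  rewrite /= ge0_integral_pushforward //=; last first.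
    by apply/measurable_EFinP; exact: measurableT_comp.
  exact: measurable_cons_rV.
have InE : (\int[bl n.+1]_x (f x)%:E = \int[(leb \x bl n)%E]_p (f (@cons_rV R n p))%:E)%E.
  rewrite /= integral_pushforward //=.
  exact: measurable_cons_rV.
  exact/measurable_EFinP.
have c0 : 0 <= c by have [h1 _] := H 0; exact: le_trans h1.
have e1 : forall y, (\int[leb]_t (f (cons_rV (t, y)))%:E)%E = (I1 (fun t => f (cons_rV (t, y))))%:E.
  by move=> y; rewrite /I1 /Rintegral fineK //; apply: integrable_fin_num => //; exact: nice1_int.
have e2 : forall t, (\int[bl n]_y (f (cons_rV (t, y)))%:E)%E = (In (fun y => f (cons_rV (t, y))))%:E.
  by move=> t; rewrite /In /Rintegral fineK //; apply: integrable_fin_num => //; exact: nice_int.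
have m1 : measurable_fun setT (fun y => I1 (fun t => f (cons_rV (t, y)))).
  apply/measurable_EFinP => /=.
  have := measurable_fubini_G fi; rewrite /fubini_G.
  by under eq_fun do rewrite e1.
have m2 : measurable_fun setT (fun t : measurableTypeR R => In (fun y => f (cons_rV (t, y)))).
  apply/measurable_EFinP => /=.
  have := measurable_fubini_F fi; rewrite /fubini_F.
  by under eq_fun do rewrite e2.
split => //.
- split => //; exists r, (c * fine (leb (`[-r, r]%classic : set R))) => y; split.
    rewrite /I1; apply: (le_trans (le_normr_Rintegral _ _)) => //; first exact: nice1_int.
    rewrite -Rintegral_cst // [leRHS]Rintegral_mkcond; apply: le_Rintegral => //.
    + have [ma _] := n1 y.
      rewrite -[X in _.-integrable _ X]/(abse \o (EFin \o (fun t => f (cons_rV (t, y))))).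
      by apply: integrable_abse; exact: nice1_int.
    + apply: nice1_int; split.
        by apply/(measurable_restrictT _ _).1 => //.
      exists r, c => t; rewrite patchE; case: ifPn => [|_].
        by rewrite inE /= in_itv /= => h; rewrite ger0_norm //; split => // _; rewrite ler_norml.
      by rewrite normr0 eqxx.
    + move=> t _; rewrite patchE; have [h1 h2] := H (cons_rV (t, y)); case: ifPn => // /negP ht.
      have [->|/h2 h] := eqVneq (f (cons_rV (t, y))) 0; first by rewrite normr0.
      exfalso; apply: ht; rewrite inE /= in_itv /= -ler_norml.
      by have := h ord0; rewrite cons_rV0.
  move=> h i; apply: contrapT => hi; move/eqP: h; apply.
  rewrite /I1 (_ : (fun t => _) = cst 0); first by rewrite Rintegral_cst // mul0r.
  apply/funext => t /=; apply/eqP/negPn/negP => /(H _).2 /(_ (lift ord0 i)).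
  by rewrite cons_rVS.
- split => //; exists r, (c * fine (bl n (@box n r))) => t; split.
    rewrite /In; apply: (le_trans (le_normr_Rintegral _ _)) => //; first exact: nice_int.
    rewrite -Rintegral_cst; last exact: measurable_box.
    rewrite [leRHS]Rintegral_mkcond; apply: le_Rintegral => //.
    + rewrite -[X in _.-integrable _ X]/(abse \o (EFin \o (fun y => f (cons_rV (t, y))))).
      by apply: integrable_abse; exact: nice_int.
    + apply: nice_int; split.
        by apply/(measurable_restrictT _ _).1 => //; exact: measurable_box.
      exists r, c => y; rewrite patchE; case: ifPn => [|_].
        rewrite inE /= => h; rewrite ger0_norm //; split => // _ i; have := h i.
        by rewrite /= in_itv /= ler_norml.
      by rewrite normr0 eqxx.
    + move=> y _; rewrite patchE; have [h1 h2] := H (cons_rV (t, y)); case: ifPn => // /negP ht.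
      have [->|/h2 h] := eqVneq (f (cons_rV (t, y))) 0; first by rewrite normr0.
      exfalso; apply: ht; rewrite inE /= => i; rewrite /= in_itv /= -ler_norml.
      by have := h (lift ord0 i); rewrite cons_rVS.
  move=> h; apply: contrapT => hi; move/eqP: h; apply.
  rewrite /In (_ : (fun t => _) = cst 0); first by rewrite Rintegral_cst // mul0r.
  apply/funext => y /=; apply/eqP/negPn/negP => /(H _).2 /(_ ord0).
  by rewrite cons_rV0.
- split; last first.
    rewrite /In /I1 /Rintegral InE -(integral12_prod_meas1 fi) /fubini_F; congr fine.
    by apply: eq_integral => y _; rewrite e2.
  rewrite /In /Rintegral InE -(integral21_prod_meas1 fi) /fubini_G; congr fine.
  by apply: eq_integral => y _; rewrite e1.
Qed.

End nice.

Section nice_ops.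
Context (R : realType).
Local Notation leb := (@lebesgue_measure R).
Local Notation bl n := (borel_lebesgue R n).

Lemma measurable_coordR n (i : 'I_n) :
  measurable_fun [set: 'rV[R]_n] (fun x : 'rV[R]_n => x ord0 i).
Proof. exact: measurable_coord_rV. Qed.

Section ops.
Context (n : nat).
Implicit Types f g : 'rV[R]_n -> R.

Lemma niceD f g : nice f -> nice g -> nice (fun x => f x + g x).
Proof.
move=> [mf [r [c H]]] [mg [r' [c' H']]]; split; first exact: measurable_funD.
exists (Num.max r r'), (c + c') => x; have [h1 h2] := H x; have [h1' h2'] := H' x; split.
  by apply: (le_trans (ler_normD _ _)); exact: lerD.
move=> h i; rewrite le_max.
have [f0|/h2 ->//] := eqVneq (f x) 0; have [g0|/h2' ->//] := eqVneq (g x) 0.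
  by rewrite f0 g0 addr0 eqxx in h.
by rewrite orbT.
Qed.

Lemma niceM f g (c : R) : nice f -> measurable_fun setT g -> (forall x, `|g x| <= c) ->
  nice (fun x => f x * g x).
Proof.
move=> [mf [r [c1 H]]] mg H'; split; first exact: measurable_funM.
exists r, (c1 * c) => x; have [h1 h2] := H x; split.
  by rewrite normrM; apply: ler_pM.
by move=> h i; apply: h2; apply: contra_neq h => ->; rewrite mul0r.
Qed.

Lemma niceZ f (a : R) : nice f -> nice (fun x => a * f x).
Proof.
move=> nf; have := niceM (g := fun=> a) (c := `|a|) nf (measurable_cst _) (fun=> lexx _).
by rewrite (_ : (fun x => f x * a) = fun x => a * f x) //; apply/funext => x; rewrite mulrC.
Qed.

Lemma niceN f : nice f -> nice (fun x => - f x).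
Proof.
move=> /(niceZ (-1)).
by rewrite (_ : (fun x => -1 * f x) = fun x => - f x) //; apply/funext => x; rewrite mulN1r.
Qed.

Lemma niceB f g : nice f -> nice g -> nice (fun x => f x - g x).
Proof. by move=> nf /niceN; exact: niceD. Qed.

Lemma nice_norm f : nice f -> nice (fun x => `|f x|).
Proof.
move=> [mf [r [c H]]]; split; first exact: measurableT_comp.
by exists r, c => x; rewrite normr_id normr_eq0; exact: H.
Qed.

Lemma nice0 : nice (fun _ : 'rV[R]_n => 0).
Proof. by split => //; exists 0, 0 => x; rewrite normr0 eqxx. Qed.

Lemma nice_sum (I : Type) (s : seq I) (P : pred I) (F : I -> 'rV[R]_n -> R) :
  (forall i, P i -> nice (F i)) -> nice (fun x => \sum_(i <- s | P i) F i x).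
Proof.
move=> H; elim: s => [|i s IH].
  by under eq_fun do rewrite big_nil; exact: nice0.
case: (boolP (P i)) => Pi.
  by under eq_fun do rewrite big_cons Pi; apply: niceD => //; exact: H.
by under eq_fun do rewrite big_cons (negbTE Pi).
Qed.

Lemma In_D f g : nice f -> nice g -> In (fun x => f x + g x) = In f + In g.
Proof. by move=> nf ng; rewrite /In RintegralD //; exact: nice_int. Qed.

Lemma In_Z f (a : R) : nice f -> In (fun x => a * f x) = a * In f.
Proof. by move=> nf; rewrite /In RintegralZl //; exact: nice_int. Qed.

Lemma In_N f : nice f -> In (fun x => - f x) = - In f.
Proof.
by move=> nf; rewrite -mulN1r -In_Z //; congr In; apply/funext => x; rewrite mulN1r.
Qed.

Lemma In_B f g : nice f -> nice g -> In (fun x => f x - g x) = In f - In g.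
Proof. by move=> nf ng; rewrite In_D ?In_N //; exact: niceN. Qed.

Lemma In_0 : In (fun _ : 'rV[R]_n => 0 : R) = 0.
Proof. by rewrite /In Rintegral_cst // mul0r. Qed.

Lemma In_sum (I : Type) (s : seq I) (P : pred I) (F : I -> 'rV[R]_n -> R) :
  (forall i, P i -> nice (F i)) ->
  In (fun x => \sum_(i <- s | P i) F i x) = \sum_(i <- s | P i) In (F i).
Proof.
move=> H; elim: s => [|i s IH].
  by under eq_fun do rewrite big_nil; rewrite big_nil In_0.
rewrite big_cons; case: ifPn => Pi.
  under eq_fun do rewrite big_cons Pi.
  by rewrite In_D ?IH //; [exact: H|exact: nice_sum].
by under eq_fun do rewrite big_cons (negbTE Pi).
Qed.

Lemma In_le f g : nice f -> nice g -> (forall x, f x <= g x) -> In f <= In g.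
Proof. by move=> nf ng fg; apply: le_Rintegral => //; exact: nice_int. Qed.

Lemma In_ge0 f : (forall x, 0 <= f x) -> 0 <= In f.
Proof. by move=> f0; apply: Rintegral_ge0. Qed.

Lemma In_norm f : nice f -> `|In f| <= In (fun x => `|f x|).
Proof. by move=> nf; apply: le_normr_Rintegral => //; exact: nice_int. Qed.

Lemma In_abs_le f g : nice f -> nice g -> (forall x, `|f x| <= g x) -> `|In f| <= In g.
Proof.
by move=> nf ng fg; apply: (le_trans (In_norm nf)); apply: In_le => //; exact: nice_norm.
Qed.

End ops.

Lemma nice_comp n m (f : 'rV[R]_n -> R) (g : 'rV[R]_m -> 'rV[R]_n) :
  nice f -> measurable_fun setT g ->
  (forall r : R, exists r' : R, forall x, (forall i, `|g x ord0 i| <= r) ->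
     forall i, `|x ord0 i| <= r') ->
  nice (fun x => f (g x)).
Proof.
move=> [mf [r [c H]]] mg H'; split; first exact: measurableT_comp.
have [r' hr'] := H' r; exists r', c => x; have [h1 h2] := H (g x).
by split => // /h2; exact: hr'.
Qed.

Lemma nice1_comp (f : R -> R) (a b : R) : a != 0 -> nice1 f -> nice1 (fun t => f (a * t + b)).
Proof.
move=> a0 [mf [r [c H]]]; split.
  apply: (measurableT_comp mf) => /=.
  by apply: measurable_funD => //; exact: measurable_funM.
exists ((r + `|b|) / `|a|), c => t; have [h1 h2] := H (a * t + b); split => // /h2 h.
rewrite ler_pdivlMr ?normr_gt0 // mulrC -normrM.
rewrite -[a * t](addrK b); apply: (le_trans (ler_normB _ _)).
by rewrite lerD2r.
Qed.

Definition aff (a b : R) (t : measurableTypeR R) : measurableTypeR R := a * t + b.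

Lemma measurable_aff a b : measurable_fun setT (aff a b).
Proof. by apply: measurable_funD => //; exact: measurable_funM. Qed.

Definition aff_measure (a b : R) : {measure set (measurableTypeR R) -> \bar R}.
Proof.
refine (mscale (NngNum (normr_ge0 a)) (pushforward leb (aff a b))).
exact: measurable_aff.
Defined.

(** Lebesgue measure is determined by the intervals []x, y]]. For negative [a] the preimage is
    closed on the left instead, which does not change its length. *)
Lemma aff_pushforward (a b : R) : a != 0 -> forall A : set R, measurable A ->
  leb A = aff_measure a b A.
Proof.
move=> a0 A mA; apply: lebesgue_measure_unique => //= _ [[x y]] _ <-.
rewrite /aff_measure /mscale /= /pushforward.
have [ap|an|a00] := ltgtP 0 a; last by rewrite -a00 eqxx in a0.
- have -> : aff a b @^-1` `]x, y] = `](x - b) / a, (y - b) / a]%classic.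
    apply/seteqP; split => t /=; rewrite !in_itv /= /aff.
      by rewrite ltr_pdivrMr // ler_pdivlMr // mulrC ltrBlDr lerBrDr.
    by rewrite ltr_pdivrMr // ler_pdivlMr // mulrC ltrBlDr lerBrDr.
  rewrite !lebesgue_measure_itv /= !lte_fin ltr_pM2r ?invr_gt0 // ltrD2r.
  case: ifP => _; last by rewrite mule0.
  by rewrite -!EFinB -EFinM gtr0_norm //; congr EFin; field.
- have -> : aff a b @^-1` `]x, y] = `[(y - b) / a, (x - b) / a[%classic.
    apply/seteqP; split => t /=; rewrite !in_itv /= /aff.
      by rewrite ler_ndivrMr // ltr_ndivlMr // mulrC ltrBlDr lerBrDr => /andP[-> ->].
    by rewrite ler_ndivrMr // ltr_ndivlMr // mulrC ltrBlDr lerBrDr => /andP[-> ->].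
  rewrite !lebesgue_measure_itv /= !lte_fin ltr_nM2r ?invr_lt0 // ltrD2r.
  case: ifP => _; last by rewrite mule0.
  by rewrite -!EFinB -EFinM ltr0_norm //; congr EFin; field.
Qed.

Lemma ge0_integral_aff (g : R -> \bar R) (a b : R) : a != 0 ->
  measurable_fun setT g -> (forall t, 0 <= g t)%E ->
  (\int[leb]_t g t = `|a|%:E * \int[leb]_t g (a * t + b)%R)%E.
Proof.
move=> a0 mg g0.
rewrite (_ : (\int[leb]_x g x =
  \int[aff_measure a b]_x g x)%E).
  rewrite ge0_integral_mscale //=; congr (_ * _)%E.
  by rewrite ge0_integral_pushforward //=; exact: measurable_aff.
by apply: eq_measure_integral => A mA _; exact: aff_pushforward.
Qed.

Lemma I1_aff (f : R -> R) (a b : R) : a != 0 -> nice1 f ->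
  I1 f = `|a| * I1 (fun t => f (a * t + b)).
Proof.
move=> a0 nf; have nf' := nice1_comp b a0 nf.
have if1 := nice1_int nf; have if2 := nice1_int nf'.
rewrite /I1 /Rintegral integralE [in RHS]integralE.
have mf : measurable_fun setT (fun t : R => (f t)%:E) by apply/measurable_EFinP; case: nf.
rewrite (ge0_integral_aff b a0 (measurable_funepos mf)) //.
rewrite (ge0_integral_aff b a0 (measurable_funeneg mf)) //.
have cp : ((fun t => (f (a * t + b))%:E)^\+ = (fun t => (fun t => (f t)%:E)^\+ (a * t + b)%R))%E.
  exact: (funepos_comp (fun t : R => (f t)%:E) (fun t => a * t + b)).
have cn : ((fun t => (f (a * t + b))%:E)^\- = (fun t => (fun t => (f t)%:E)^\- (a * t + b)%R))%E.
  exact: (funeneg_comp (fun t : R => (f t)%:E) (fun t => a * t + b)).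
have := integrable_pos_fin_num measurableT if2.
have := integrable_neg_fin_num measurableT if2.
rewrite cp cn => fn fp.
by rewrite -muleBr ?fin_num_adde_defl ?fin_numN // fineM // fin_numB fp fn.
Qed.

End nice_ops.

(** * Linear changes of variables *)

Section nice_lin.
Context (R : realType).
Local Notation leb := (@lebesgue_measure R).
Local Notation bl n := (borel_lebesgue R n).

Lemma nice_consD n (f : 'rV[R]_n.+1 -> R) : nice f ->
  In f = In (fun y => I1 (fun t => f (cons_rV (t, y)))).
Proof. by case/nice_cons => _ _ _ _ []. Qed.

Lemma nice_consC n (f : 'rV[R]_n.+1 -> R) : nice f ->
  In f = I1 (fun t => In (fun y => f (cons_rV (t, y)))).
Proof. by case/nice_cons => _ _ _ _ []. Qed.

Lemma nice_cons1 n (f : 'rV[R]_n.+1 -> R) y : nice f -> nice1 (fun t => f (cons_rV (t, y))).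
Proof. by case/nice_cons. Qed.

Lemma nice_cons2 n (f : 'rV[R]_n.+1 -> R) t : nice f -> nice (fun y => f (cons_rV (t, y))).
Proof. by case/nice_cons. Qed.

Lemma nice_consI n (f : 'rV[R]_n.+1 -> R) : nice f ->
  nice (fun y => I1 (fun t => f (cons_rV (t, y)))).
Proof. by case/nice_cons. Qed.

Lemma nice_consI1 n (f : 'rV[R]_n.+1 -> R) : nice f ->
  nice1 (fun t => In (fun y => f (cons_rV (t, y)))).
Proof. by case/nice_cons. Qed.

Lemma In_0dim (f : 'rV[R]_0 -> R) : nice f -> In f = f 0.
Proof.
move=> nf; rewrite /In /= /Rintegral integral_dirac //=.
  by rewrite indicT mul1r.
by apply/measurable_EFinP; case: nf.
Qed.

Lemma cons_rVD n (t s : R) (y z : 'rV[R]_n) :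
  cons_rV (t, y) + cons_rV (s, z) = cons_rV (t + s, y + z).
Proof.
by apply/rowP => i; case: (unliftP ord0 i) => [j ->|->]; rewrite [LHS]mxE ?cons_rVS ?cons_rV0 //= mxE.
Qed.

Lemma cons_rVZ n (a t : R) (y : 'rV[R]_n) : a *: cons_rV (t, y) = cons_rV (a * t, a *: y).
Proof.
by apply/rowP => i; case: (unliftP ord0 i) => [j ->|->]; rewrite [LHS]mxE ?cons_rVS ?cons_rV0 //= mxE.
Qed.

Lemma nice_aff n (f : 'rV[R]_n -> R) (a : R) (b : 'rV[R]_n) : a != 0 -> nice f ->
  nice (fun x => f (a *: x + b)).
Proof.
move=> a0 nf; apply: (nice_comp (g := fun x => a *: x + b)) => //.
  apply: measurable_fun_rVP => i; under eq_fun do rewrite !mxE.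
  by apply: measurable_funD => //; apply: measurable_funM => //; exact: measurable_coordR.
move=> r; exists ((r + \sum_i `|b ord0 i|) / `|a|) => x hx i.
rewrite ler_pdivlMr ?normr_gt0 // mulrC -normrM.
have := hx i; rewrite !mxE => h.
rewrite -[a * _](addrK (b ord0 i)); apply: (le_trans (ler_normB _ _)).
rewrite lerD //; rewrite (bigD1 i) //= lerDl; exact: sumr_ge0.
Qed.

Lemma In_aff n (f : 'rV[R]_n -> R) (a : R) (b : 'rV[R]_n) : a != 0 -> nice f ->
  In f = `|a| ^+ n * In (fun x => f (a *: x + b)).
Proof.
move=> a0; elim: n f b => [|n IH] f b nf.
  rewrite expr0 mul1r !In_0dim //; last exact: nice_aff.
  by congr f; apply/rowP; case.
have nf' := nice_aff b a0 nf.
rewrite (nice_consC nf) (nice_consC nf').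
pose b0 := b ord0 ord0; pose b' := \row_i b ord0 (lift ord0 i).
have -> : (fun t => In (fun y => f (a *: cons_rV (t, y) + b))) =
   (fun t => In (fun y => f (cons_rV (a * t + b0, a *: y + b')))).
  by apply/funext => t; congr In; apply/funext => y; rewrite -{1}(cons_rV_split b) cons_rVZ cons_rVD.
rewrite (I1_aff b0 a0) ?exprS; last exact: nice_consI1.
rewrite -mulrA; congr (_ * _).
have e t : In (fun y => f (cons_rV (a * t + b0, y))) = `|a| ^+ n * In (fun y => f (cons_rV (a * t + b0, a *: y + b'))).
  by rewrite (IH _ b') //; exact: nice_cons2.
under eq_fun do rewrite e.
rewrite /I1 RintegralZl //; apply: (nice1_int (f := fun t => _)).
pose h t := In (fun y => f (cons_rV (t, y))).
have nh : nice1 h by exact: nice_consI1.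
have /(nice1_comp b0 a0) : nice1 (fun t => In (fun y => f (cons_rV (t, a *: y + b')))).
  (* Rescaling the tail alone stays in the class; integrating the tail out and then substituting in
     the first coordinate gives the integrability needed to pull out the constant. *)
  pose f2 (x : 'rV[R]_n.+1) := f (cons_rV (x ord0 ord0, a *: (\row_i x ord0 (lift ord0 i)) + b')).
  have nf2 : nice f2.
    apply: (nice_comp (g := fun x => cons_rV (x ord0 ord0, a *: (\row_i x ord0 (lift ord0 i)) + b'))) => //.
      apply: measurable_fun_rVP => i; case: (unliftP ord0 i) => [j ->|->].
        under eq_fun do rewrite cons_rVS /= !mxE.
        by apply: measurable_funD => //; apply: measurable_funM => //; exact: measurable_coordR.
      by under eq_fun do rewrite cons_rV0 /=; exact: measurable_coordR.
    move=> r; exists (Num.max r ((r + \sum_i `|b' ord0 i|) / `|a|)) => x hx i.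
    rewrite le_max; case: (unliftP ord0 i) => [j ->|->]; last first.
      by have := hx ord0; rewrite cons_rV0 /= => ->.
    rewrite ler_pdivlMr ?normr_gt0 // mulrC -normrM.
    have := hx (lift ord0 j); rewrite cons_rVS /= !mxE => h'.
    apply/orP; right; rewrite -[a * _](addrK (b ord0 (lift ord0 j))); apply: (le_trans (ler_normB _ _)).
    rewrite lerD // (bigD1 j) //= mxE lerDl; exact: sumr_ge0.
  have := nice_consI1 nf2; congr nice1; apply/funext => t; congr In; apply/funext => y.
  rewrite /f2 cons_rV0 /=; congr (f (cons_rV (_, _ *: _ + _))).
  by apply/rowP => i; rewrite mxE cons_rVS.
by [].
Qed.

Definition ins n (i : 'I_n.+1) (t : R) (y : 'rV[R]_n) : 'rV[R]_n.+1 :=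
  \row_j (if unlift i j is Some k then y ord0 k else t).

Lemma ins_eq n (i : 'I_n.+1) t y : ins i t y ord0 i = t.
Proof. by rewrite mxE unlift_none. Qed.

Lemma ins_lift n (i : 'I_n.+1) t y k : ins i t y ord0 (lift i k) = y ord0 k.
Proof. by rewrite mxE liftK. Qed.

Lemma ins0 n t (y : 'rV[R]_n) : ins ord0 t y = cons_rV (t, y).
Proof.
by apply/rowP => i; case: (unliftP ord0 i) => [j ->|->]; rewrite ?ins_eq ?ins_lift ?cons_rV0 ?cons_rVS.
Qed.

Lemma insS n (j : 'I_n.+1) t s (z : 'rV[R]_n) :
  ins (lift ord0 j) t (cons_rV (s, z)) = cons_rV (s, ins j t z).
Proof.
apply/rowP => k; case: (unliftP (lift ord0 j) k) => [k' ->|->].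
  rewrite ins_lift; case: (unliftP ord0 k') => [l ->|->].
    have -> : lift (lift ord0 j) (lift ord0 l) = lift ord0 (lift j l).
      by apply/val_inj => /=; rewrite /bump /= !add1n ltnS addnS.
    by rewrite !cons_rVS ins_lift.
  have -> : lift (lift ord0 j) ord0 = ord0 :> 'I_n.+2 by apply/val_inj.
  by rewrite !cons_rV0.
by rewrite ins_eq cons_rVS ins_eq.
Qed.

Definition tl n (x : 'rV[R]_n.+1) : 'rV[R]_n := \row_i x ord0 (lift ord0 i).

Lemma tl_cons n t (y : 'rV[R]_n) : tl (cons_rV (t, y)) = y.
Proof. by apply/rowP => i; rewrite mxE cons_rVS. Qed.

Lemma cons_tl n (x : 'rV[R]_n.+1) : cons_rV (x ord0 ord0, tl x) = x.
Proof. exact: cons_rV_split. Qed.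

Lemma nice_ins n (i : 'I_n.+1) (f : 'rV[R]_n.+1 -> R) : nice f ->
  nice (fun x => f (ins i (x ord0 ord0) (tl x))).
Proof.
move=> nf; apply: (nice_comp (g := fun x => ins i (x ord0 ord0) (tl x))) => //.
  apply: measurable_fun_rVP => j; case: (unliftP i j) => [k ->|->].
    by under eq_fun do rewrite ins_lift mxE; exact: measurable_coordR.
  by under eq_fun do rewrite ins_eq; exact: measurable_coordR.
move=> r; exists r => x hx j; case: (unliftP ord0 j) => [k ->|->].
  by have := hx (lift i k); rewrite ins_lift mxE.
by have := hx i; rewrite ins_eq.
Qed.

(** Fubini in both orders: in the induction step the inserted coordinate is integrated inside and
    the first one outside, so the induction hypothesis applies within the sections. *)
Lemma In_ins n (i : 'I_n.+1) (f : 'rV[R]_n.+1 -> R) : nice f ->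
  In (fun x => f (ins i (x ord0 ord0) (tl x))) = In f.
Proof.
elim: n i f => [|n IH] i f nf.
  by congr In; apply/funext => x; rewrite (ord1 i) ins0 cons_tl.
case: (unliftP ord0 i) => [j ->|->]; last first.
  by congr In; apply/funext => x; rewrite ins0 cons_tl.
have nf' := nice_ins (lift ord0 j) nf.
rewrite (nice_consD nf') (nice_consC (nice_consI nf')) (nice_consC nf); congr I1.
apply/funext => s; rewrite -(IH j); last exact: nice_cons2.
rewrite (nice_consD (nice_ins j (nice_cons2 s nf))).
congr In; apply/funext => z; congr I1; apply/funext => t.
by rewrite cons_rV0 tl_cons insS cons_rV0 tl_cons.
Qed.

Lemma In_insD n (i : 'I_n.+1) (f : 'rV[R]_n.+1 -> R) : nice f ->
  In f = In (fun y => I1 (fun t => f (ins i t y))).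
Proof.
move=> nf; rewrite -(In_ins i nf) (nice_consD (nice_ins i nf)).
by congr In; apply/funext => y; congr I1; apply/funext => t; rewrite cons_rV0 tl_cons.
Qed.

Lemma nice_insI n (i : 'I_n.+1) (f : 'rV[R]_n.+1 -> R) : nice f ->
  nice (fun y => I1 (fun t => f (ins i t y))).
Proof.
move=> nf; have := nice_consI (nice_ins i nf); congr nice.
by apply/funext => y; congr I1; apply/funext => t; rewrite cons_rV0 tl_cons.
Qed.

Lemma nice_ins1 n (i : 'I_n.+1) (f : 'rV[R]_n.+1 -> R) y : nice f ->
  nice1 (fun t => f (ins i t y)).
Proof.
move=> nf; have := nice_cons1 y (nice_ins i nf); congr nice1.
by apply/funext => t; rewrite cons_rV0 tl_cons.
Qed.

Lemma measurable_mulmx n m (G : 'M[R]_(n, m)) :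
  measurable_fun setT (fun x : 'rV[R]_n => x *m G).
Proof.
apply: measurable_fun_rVP => i; under eq_fun do rewrite mxE.
apply: measurable_sum => j; apply: measurable_funM => //; exact: measurable_coordR.
Qed.

Lemma mulmx_bound n m (G : 'M[R]_(n, m)) (r : R) : exists r' : R, forall x : 'rV[R]_n,
  (forall i, `|x ord0 i| <= r) -> forall j, `|(x *m G) ord0 j| <= r'.
Proof.
exists (\sum_i \sum_j r * `|G i j|) => x hx j; rewrite mxE.
apply: (le_trans (ler_norm_sum _ _ _)); apply: ler_sum => i _.
have r0 : 0 <= r by exact: le_trans (hx i).
rewrite normrM (bigD1 j) //=; apply: (@le_trans _ _ (r * `|G i j|)).
  by rewrite ler_wpM2r.
by rewrite lerDl; apply: sumr_ge0 => k _; rewrite mulr_ge0.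
Qed.

Lemma nice_mulmx n (G : 'M[R]_n) (f : 'rV[R]_n -> R) : G \in unitmx -> nice f ->
  nice (fun x => f (x *m G)).
Proof.
move=> uG nf; apply: (nice_comp (g := mulmx^~ G)) => //; first exact: measurable_mulmx.
move=> r; have [r' hr] := mulmx_bound (invmx G) r; exists r' => x /hr.
by rewrite mulmxK.
Qed.

(* [c] stands for [1 / |\det G|]; recording the change of variables formula
   instead avoids determinants. *)
Lemma dir_coord n (v : 'rV[R]_n.+1) : v != 0 -> exists2 G : 'M[R]_n.+1, G \in unitmx &
  exists2 c : R, 0 < c & (forall x, dot v (x *m G) = x ord0 ord0) /\
    (forall f, nice f -> In (fun x => f (x *m G)) = c * In f).
Proof.
move=> v0; have [i vi0] : exists i, v ord0 i != 0.
  apply/existsP; apply: contraNT v0; rewrite negb_exists => /forallP h.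
  by apply/eqP/rowP => i; rewrite mxE; apply/eqP; rewrite -[_ == _]negbK; exact: h.
pose cc (y : 'rV[R]_n) := \sum_k v ord0 (lift i k) * y ord0 k.
pose a := (v ord0 i)^-1.
have a0 : a != 0 by rewrite invr_eq0.
(* The coordinates of [x *m G] other than [i] are the tail of [x]; coordinate [i] is solved from the
   requirement that the product with [v] be the first coordinate of [x]. Only one coordinate is
   rescaled, by [a], which gives the factor [|v i|]. *)
pose G : 'M[R]_n.+1 := \matrix_(p, q) (if unlift i q is Some k then (p == lift ord0 k)%:R
    else if unlift ord0 p is Some k then - (v ord0 (lift i k) * a) else a).
have GE x : x *m G = ins i (a * x ord0 ord0 - a * cc (tl x)) (tl x).
  apply/rowP => q; case: (unliftP i q) => [k ->|->].
    rewrite ins_lift !mxE (bigD1 (lift ord0 k)) //= !mxE liftK eqxx mulr1 big1 ?addr0 // => p pk.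
    by rewrite mxE liftK (negbTE pk) mulr0.
  rewrite ins_eq mxE big_ord_recl !mxE unlift_none unlift_none mulrC; congr (_ + _).
  rewrite /cc mulr_sumr -sumrN; apply: eq_bigr => k _.
  by rewrite !mxE unlift_none liftK; ring.
have dG x : dot v (x *m G) = x ord0 ord0.
  rewrite GE /dot (bigD1 i) //= ins_eq.
  rewrite (_ : \sum_(j | j != i) _ = cc (tl x)).
    by rewrite /a; field.
  rewrite (reindex_omap (lift i) (unlift i)) /=; last first.
    by move=> j; case: unliftP => [k ->|->] //; rewrite eqxx.
  rewrite /cc; apply: eq_big => k; first by rewrite liftK eqxx andbT eq_sym neq_lift.
  by move=> _; rewrite ins_lift.
exists G.
  rewrite -row_free_unit; apply: inj_row_free => x xG.
  apply/rowP => j; rewrite mxE; case: (unliftP ord0 j) => [k ->|->].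
    by have := congr1 (fun y : 'rV_ _ => y ord0 (lift i k)) xG; rewrite GE ins_lift !mxE.
  by rewrite -dG xG /dot big1 // => k _; rewrite mxE mulr0.
exists `|v ord0 i|; first by rewrite normr_gt0.
split => // f nf.
have nfi : forall y, nice1 (fun t => f (ins i t y)) by move=> y; exact: nice_ins1.
have uG : G \in unitmx.
  rewrite -row_free_unit; apply: inj_row_free => x xG.
  apply/rowP => j; rewrite mxE; case: (unliftP ord0 j) => [k ->|->].
    by have := congr1 (fun y : 'rV_ _ => y ord0 (lift i k)) xG; rewrite GE ins_lift !mxE.
  by rewrite -dG xG /dot big1 // => k _; rewrite mxE mulr0.
rewrite (nice_consD (nice_mulmx uG nf)) (In_insD i nf) -In_Z; last exact: nice_insI.
congr In; apply/funext => y.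
rewrite (I1_aff (- (a * cc y)) a0 (nfi y)) mulrA.
rewrite (_ : `|v ord0 i| * `|a| = 1); last by rewrite -normrM /a mulfV // normr1.
by rewrite mul1r; congr I1; apply/funext => t; rewrite GE cons_rV0 tl_cons.
Qed.

Lemma nice_prod n m (f : 'rV[R]_n -> R) (g : 'rV[R]_m -> R) : nice f -> nice g ->
  nice (fun z : 'rV[R]_(n + m) => f (lsubmx z) * g (rsubmx z)).
Proof.
move=> [mf [r [c H]]] [mg [r' [c' H']]]; split.
  apply: measurable_funM.
    apply: (measurableT_comp mf); apply: measurable_fun_rVP => i.
    by under eq_fun do rewrite mxE; exact: measurable_coordR.
  apply: (measurableT_comp mg); apply: measurable_fun_rVP => i.
  by under eq_fun do rewrite mxE; exact: measurable_coordR.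
exists (Num.max r r'), (c * c') => z.
have [h1 h2] := H (lsubmx z); have [h1' h2'] := H' (rsubmx z); split.
  by rewrite normrM; apply: ler_pM.
rewrite mulf_eq0 negb_or => /andP[/h2 hl /h2' hr] i; rewrite le_max.
case: (splitP i) => j ij.
  have -> : i = lshift m j by apply/val_inj.
  by have := hl j; rewrite mxE => ->.
have -> : i = rshift n j by apply/val_inj.
by have := hr j; rewrite mxE => ->; rewrite orbT.
Qed.

Lemma In_prod n m (f : 'rV[R]_n -> R) (g : 'rV[R]_m -> R) : nice f -> nice g ->
  In (fun z : 'rV[R]_(n + m) => f (lsubmx z) * g (rsubmx z)) = In f * In g.
Proof.
elim: n f => [|n IH] f nf ng.
  rewrite In_0dim // -In_Z //; congr In; apply/funext => z.
  congr (f _ * g _); first by apply/rowP; case.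
  by apply/rowP => i; rewrite mxE; congr (z _ _); apply/val_inj.
rewrite (nice_consC (n := n + m) (nice_prod nf ng)) (nice_consC nf) /I1 mulrC -RintegralZl //; last first.
  by apply: nice1_int; exact: nice_consI1.
congr Rintegral; apply/funext => t; rewrite mulrC -IH //; last exact: nice_cons2.
congr In; apply/funext => y; congr (f _ * g _).
  apply/rowP => i; rewrite [LHS]mxE; case: (unliftP ord0 i) => [k ->|->].
    have -> : lshift m (lift ord0 k) = lift ord0 (lshift m k) by apply/val_inj.
    by rewrite (cons_rVS (n := n + m) (t, y)) (cons_rVS (t, lsubmx y)) /= mxE.
  have -> : lshift m (ord0 : 'I_n.+1) = (ord0 : 'I_(n + m).+1) by apply/val_inj.
  by rewrite (cons_rV0 (n := n + m) (t, y)) (cons_rV0 (t, lsubmx y)).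
apply/rowP => i; rewrite [LHS]mxE [RHS]mxE.
have -> : rshift n.+1 i = lift ord0 (rshift n i) by apply/val_inj.
by rewrite (cons_rVS (n := n + m) (t, y)).
Qed.

End nice_lin.

(** * Volumes of bounded Borel sets *)

Section volume.
Context (R : realType).
Local Notation leb := (@lebesgue_measure R).
Local Notation bl n := (borel_lebesgue R n).

Definition bset n (E : set 'rV[R]_n) :=
  measurable E /\ exists r : R, forall x, E x -> forall i, `|x ord0 i| <= r.

Definition vol n (E : set 'rV[R]_n) : R := In (\1_E : 'rV[R]_n -> R).

Section vol.
Context (n : nat).
Implicit Types E F : set 'rV[R]_n.

Lemma nice_indic E : bset E -> nice (\1_E : 'rV[R]_n -> R).
Proof.
move=> [mE [r hr]]; split; first exact: measurable_indic.
exists r, 1 => x; rewrite indicE; case: (boolP (x \in E)) => [xE|_].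
  by rewrite normr1; split => // _; apply: hr; rewrite inE in xE.
by rewrite normr0 eqxx.
Qed.

Lemma vol_ge0 E : 0 <= vol E.
Proof. by apply: In_ge0 => x; rewrite indicE. Qed.

Lemma bset_sub E F : measurable E -> E `<=` F -> bset F -> bset E.
Proof. by move=> mE EF [_ [r hr]]; split => //; exists r => x /EF; exact: hr. Qed.

Lemma bsetI E F : bset E -> measurable F -> bset (E `&` F).
Proof. by move=> bE mF; apply: (bset_sub _ _ bE) => //; apply: measurableI => //; case: bE. Qed.

Lemma bsetD E F : bset E -> measurable F -> bset (E `\` F).
Proof. by move=> bE mF; apply: (bset_sub _ _ bE) => //; apply: measurableD => //; case: bE. Qed.

Lemma bsetU E F : bset E -> bset F -> bset (E `|` F).
Proof.
move=> [mE [r hr]] [mF [s hs]]; split; first exact: measurableU.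
exists (Num.max r s) => x [/hr|/hs] h i; rewrite le_max; first by rewrite h.
by rewrite [X in _ || X]h orbT.
Qed.

Lemma vol_le E F : bset E -> bset F -> E `<=` F -> vol E <= vol F.
Proof.
move=> bE bF EF; apply: In_le; [exact: nice_indic|exact: nice_indic|] => x.
rewrite !indicE ler_nat; case: (boolP (x \in E)) => // xE.
by rewrite mem_set //; apply: EF; rewrite inE in xE.
Qed.

Lemma vol_setU E F : bset E -> bset F -> (forall x, E x -> F x -> False) ->
  vol (E `|` F) = vol E + vol F.
Proof.
move=> bE bF EF; rewrite -In_D; [|exact: nice_indic..]; congr In; apply/funext => x.
rewrite !indicE -natrD in_setU.
case: (boolP (x \in E)) => xE; case: (boolP (x \in F)) => xF //=.
by exfalso; rewrite !inE in xE xF; exact: EF xE xF.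
Qed.

Lemma vol_setDI E F : bset E -> measurable F -> vol E = vol (E `&` F) + vol (E `\` F).
Proof.
move=> bE mF; rewrite -vol_setU; first by rewrite setUIDK.
- exact: bsetI.
- exact: bsetD.
- by move=> x [_ Fx] [_]; exact.
Qed.

Lemma vol_set0 : vol (set0 : set 'rV[R]_n) = 0.
Proof. by rewrite /vol indic0 In_0. Qed.

Lemma vol_fin E : bset E -> (vol E)%:E = bl n E.
Proof.
move=> bE; rewrite /vol /In /Rintegral fineK.
  by rewrite integral_indic ?setIT //; case: bE.
by apply: integrable_fin_num => //; apply: nice_int; exact: nice_indic.
Qed.

Lemma nice_indicM E (g : 'rV[R]_n -> R) (c : R) : bset E -> measurable_fun setT g -> (forall x, `|g x| <= c) ->
  nice (fun x => \1_E x * g x).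
Proof. by move=> bE mg hg; apply: (niceM (c := c)) => //; exact: nice_indic. Qed.

Lemma In_indicM_le E (g : 'rV[R]_n -> R) (c : R) : bset E -> measurable_fun setT g -> (forall x, `|g x| <= c) ->
  `|In (fun x => \1_E x * g x)| <= c * vol E.
Proof.
move=> bE mg hg; rewrite -In_Z; last exact: nice_indic.
apply: In_abs_le; [exact: (nice_indicM (c := c))|by apply: niceZ; exact: nice_indic|].
by move=> x; rewrite normrM mulrC ler_pM // ger0_norm // indicE.
Qed.

(** Continuity from above along [s = 1 / (k + 1)]; monotonicity in [s] covers the values in between
    and identifies the uncountable intersection with a countable one. *)
Lemma vol_cont (E : R -> set 'rV[R]_n) (e : R) : 0 < e ->
  (forall s, 0 < s -> measurable (E s)) -> (forall s t, 0 < s -> s <= t -> E s `<=` E t) ->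
  bset (E 1) ->
  exists2 d : R, 0 < d & forall s, 0 < s -> s <= d -> vol (E s) <= vol (\bigcap_(s in [set s | 0 < s]) E s) + e.
Proof.
move=> e0 mE hE b1.
pose F k := E (k.+1%:R^-1).
have k0 k : 0 < k.+1%:R^-1 :> R by rewrite invr_gt0.
have k1 k : k.+1%:R^-1 <= 1 :> R by rewrite invf_le1 // ler1n.
have bF k : bset (F k) by apply: bset_sub b1; [exact: mE|exact: hE].
have cE : \bigcap_(s in [set s | 0 < s]) E s = \bigcap_k F k.
  apply/seteqP; split => x h; first by move=> k _; apply: h => /=.
  move=> s /= s0; near \oo => k.
  apply: (hE k.+1%:R^-1) => //; last by apply: h.
  by apply: ltW; near: k; exact: (near_infty_natSinv_lt (PosNum s0)).
have mI : measurable (\bigcap_k F k) by apply: bigcapT_measurable => k; case: (bF k).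
have bI : bset (\bigcap_k F k) by apply: bset_sub (bF 0%N) => // x; exact.
have cv : bl n \o F @ \oo --> bl n (\bigcap_k F k).
  apply: nonincreasing_cvg_mu => //.
  - by have := ltry (vol (F 0%N)); rewrite (vol_fin (bF 0%N)).
  - by move=> k; case: (bF k).
  - by move=> i j ij; apply/subsetPset; apply: hE => //; rewrite lef_pV2 ?posrE // ler_nat.
have cv' : (fun k => vol (F k)) @ \oo --> vol (\bigcap_k F k).
  have cv2 : (bl n \o F) @ \oo --> (vol (\bigcap_k F k))%:E by rewrite vol_fin.
  have e2 : fine \o (bl n \o F) = (fun k => vol (F k)).
    by apply/funext => k /=; rewrite -(vol_fin (bF k)).
  by have := fine_cvg cv2; rewrite e2 => h; apply: h.
rewrite cE.
have /cvgrPdist_le /(_ e e0) [N _ hN] := cv'.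
exists N.+1%:R^-1 => // s s0 sN.
have := hN N (leqnn N); rewrite ler_norml lerBrDr => /andP[h _].
apply: (@le_trans _ _ (vol (F N))).
  apply: vol_le => //; last exact: hE.
  by apply: bset_sub (bF N); [exact: mE|exact: hE].
by rewrite addrC -lerBlDr; lra.
Unshelve. all: by end_near. Qed.

End vol.

Lemma vol_aff n (E : set 'rV[R]_n) (a : R) (b : 'rV[R]_n) : a != 0 -> bset E ->
  bset [set x | E (a *: x + b)] /\ vol E = `|a| ^+ n * vol [set x | E (a *: x + b)].
Proof.
move=> a0 bE; have nE := nice_indic bE.
have e : (fun x => \1_E (a *: x + b)) = (\1_[set x | E (a *: x + b)] : 'rV[R]_n -> R).
  by apply/funext => x; rewrite !indicE; congr ((nat_of_bool _)%:R); apply/idP/idP; rewrite !inE.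
split; last by rewrite /vol (In_aff b a0) // e.
have [mf [r [c hr]]] := nice_aff b a0 nE; split; last first.
  by exists r => x Ex; apply: (hr x).2; rewrite indicE mem_set //= oner_neq0.
have := mf measurableT [set 1] (measurable_set1 _); rewrite setTI; congr measurable.
apply/seteqP; split => x /=; rewrite indicE; last by move=> h; rewrite mem_set.
case: (boolP (_ \in E)) => [/set_mem //|_ /eqP].
by rewrite eq_sym oner_eq0.
Qed.

Lemma vol_mulmx n (E : set 'rV[R]_n) (G : 'M[R]_n) (c : R) : G \in unitmx ->
  (forall f, nice f -> In (fun x => f (x *m G)) = c * In f) -> bset E ->
  bset [set x | E (x *m G)] /\ vol [set x | E (x *m G)] = c * vol E.
Proof.
move=> uG hG bE; have nE := nice_indic bE.
have e : (fun x => \1_E (x *m G)) = (\1_[set x | E (x *m G)] : 'rV[R]_n -> R).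
  by apply/funext => x; rewrite !indicE; congr ((nat_of_bool _)%:R); apply/idP/idP; rewrite !inE.
split; last by rewrite /vol -hG // e.
have [mf [r [d hr]]] := nice_mulmx uG nE; split; last first.
  by exists r => x Ex; apply: (hr x).2; rewrite indicE mem_set //= oner_neq0.
have := mf measurableT [set 1] (measurable_set1 _); rewrite setTI; congr measurable.
apply/seteqP; split => x /=; rewrite indicE; last by move=> h; rewrite mem_set.
case: (boolP (_ \in E)) => [/set_mem //|_ /eqP].
by rewrite eq_sym oner_eq0.
Qed.

Lemma I1_point (f : R -> R) (c : R) : (forall t, t != c -> f t = 0) -> I1 f = 0.
Proof.
move=> hf; rewrite /I1 -(Rintegral_set1 f c) [RHS]Rintegral_mkcond; congr Rintegral.
apply/funext => t; rewrite patchE; case: ifPn => // /negP h.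
by apply: hf; apply: contra_notN h => /eqP ->; rewrite inE.
Qed.

Lemma measurable_dot n (v : 'rV[R]_n) : measurable_fun setT (dot v).
Proof.
apply: measurable_sum => i; apply: measurable_funM => //; exact: measurable_coordR.
Qed.

Lemma vol_hyperplane n (v : 'rV[R]_n) (c : R) (E : set 'rV[R]_n) : v != 0 -> bset E ->
  (forall x, E x -> dot v x = c) -> vol E = 0.
Proof.
case: n v E => [v _ /negP[]|n v E v0 bE h].
  by apply/eqP/rowP; case.
have [G uG [k k0 [dG hG]]] := dir_coord v0.
have [bE' vE'] := vol_mulmx uG hG bE.
apply/eqP; rewrite -(mulrI_eq0 _ (mulfI (lt0r_neq0 k0))) -vE'; apply/eqP.
rewrite /vol (nice_consD (nice_indic bE')) (_ : (fun y => _) = fun=> 0) ?In_0 //.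
apply/funext => y; apply: (I1_point (c := c)) => t tc.
rewrite indicE memNset //= => /h; rewrite dG cons_rV0 /= => tc'.
by rewrite tc' eqxx in tc.
Qed.

Lemma I1_sin (a b w th : R) : a <= b -> w != 0 ->
  w * I1 (fun t => \1_(`[a, b]%classic) t * sin (w * t + th)) = cos (w * a + th) - cos (w * b + th).
Proof.
move=> ab w0.
have -> : I1 (fun t => \1_(`[a, b]%classic) t * sin (w * t + th)) =
    \int[leb]_(t in `[a, b]) sin (w * t + th).
  rewrite /I1 [RHS]Rintegral_mkcond; congr Rintegral; apply/funext => t.
  by rewrite patchE indicE; case: ifP => _; rewrite ?mul1r ?mul0r.
move: ab; rewrite le_eqVlt => /predU1P[<-|aeb].
  by rewrite set_itv1 Rintegral_set1 mulr0 subrr.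
pose F (t : R) : R := - cos (w * t + th) / w.
have dF (t : R) : is_derive t 1 F (sin (w * t + th)).
  rewrite /F; apply: is_derive_eq.
  by rewrite /GRing.scale /=; field.
have cF (t : R) : {for t, continuous F}.
  by apply: differentiable_continuous; apply/derivable1_diffP; case: (dF t).
have csin (t : R) : {for t, continuous (fun t => sin (w * t + th))}.
  have d : is_derive t 1 (fun t : R => sin (w * t + th)) (w * cos (w * t + th)).
    by apply: is_derive_eq; rewrite /GRing.scale /=; ring.
  by apply: differentiable_continuous; apply/derivable1_diffP; case: d.
rewrite /Rintegral (continuous_FTC2 (F := F) aeb).
- by rewrite -EFinB /= /F; field.
- by apply: continuous_subspaceT => t; exact: csin.
- split.
  + by move=> t _; case: (dF t).
  + by apply: cvg_at_right_filter; exact: cF.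
  + by apply: cvg_at_left_filter; exact: cF.
- by move=> t _; rewrite derive1E; case: (dF t).
Qed.

End volume.

(** * Intersections of half-spaces *)

Section dot_lemmas.
Context (R : realType).

Lemma dotE n (u v : 'rV[R]_n) : dot u v = (u *m v^T) ord0 ord0.
Proof. by rewrite mxE; apply: eq_bigr => i _; rewrite mxE. Qed.

Lemma dotC n (u v : 'rV[R]_n) : dot u v = dot v u.
Proof. by apply: eq_bigr => i _; rewrite mulrC. Qed.

Lemma dotDr n (u v w : 'rV[R]_n) : dot u (v + w) = dot u v + dot u w.
Proof. by rewrite -big_split; apply: eq_bigr => i _; rewrite mxE mulrDr. Qed.

Lemma dotZr n (a : R) (u v : 'rV[R]_n) : dot u (a *: v) = a * dot u v.
Proof. by rewrite mulr_sumr; apply: eq_bigr => i _; rewrite mxE mulrCA. Qed.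

Lemma dotDl n (u v w : 'rV[R]_n) : dot (v + w) u = dot v u + dot w u.
Proof. by rewrite dotC dotDr !(dotC u). Qed.

Lemma dotZl n (a : R) (u v : 'rV[R]_n) : dot (a *: u) v = a * dot u v.
Proof. by rewrite dotC dotZr dotC. Qed.

Lemma dotNr n (u v : 'rV[R]_n) : dot u (- v) = - dot u v.
Proof. by rewrite -scaleN1r dotZr mulN1r. Qed.

Lemma dotNl n (u v : 'rV[R]_n) : dot (- u) v = - dot u v.
Proof. by rewrite dotC dotNr dotC. Qed.

Lemma dotBl n (u v w : 'rV[R]_n) : dot (v - w) u = dot v u - dot w u.
Proof. by rewrite dotDl dotNl. Qed.

Lemma dotBr n (u v w : 'rV[R]_n) : dot u (v - w) = dot u v - dot u w.
Proof. by rewrite dotDr dotNr. Qed.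

Lemma dot0l n (v : 'rV[R]_n) : dot 0 v = 0.
Proof. by rewrite /dot big1 // => i _; rewrite mxE mul0r. Qed.

Lemma dot0r n (v : 'rV[R]_n) : dot v 0 = 0.
Proof. by rewrite dotC dot0l. Qed.

Lemma dot_mulmx n m (v : 'rV[R]_m) (x : 'rV[R]_n) (G : 'M[R]_(n, m)) :
  dot v (x *m G) = dot (v *m G^T) x.
Proof. by rewrite !dotE trmx_mul mulmxA. Qed.

Lemma dot_cons n (v : 'rV[R]_n.+1) t (y : 'rV[R]_n) :
  dot v (cons_rV (t, y)) = v ord0 ord0 * t + dot (tl v) y.
Proof.
rewrite /dot big_ord_recl cons_rV0; congr (_ + _); apply: eq_bigr => i _.
by rewrite cons_rVS mxE.
Qed.

Lemma dot_cons2 n s t (x y : 'rV[R]_n) :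
  dot (cons_rV (s, x)) (cons_rV (t, y)) = s * t + dot x y.
Proof. by rewrite dot_cons cons_rV0 tl_cons. Qed.

End dot_lemmas.

Section hpoly.
Context (R : realType).

(** Normals are neither normalised nor required to be nonzero, so substitutions and slices act on
    the list without side conditions. *)
Definition hpoly n (L : seq ('rV[R]_n * R)) : set 'rV[R]_n :=
  [set x | forall p, p \in L -> dot p.1 x <= p.2].

Lemma measurable_dot_le n (v : 'rV[R]_n) (c : R) : measurable [set x | dot v x <= c].
Proof.
have := measurable_dot v measurableT (measurable_itv `]-oo, c]); rewrite setTI.
by congr measurable; apply/seteqP; split => x /=; rewrite in_itv.
Qed.

Lemma measurable_dot_gt n (v : 'rV[R]_n) (c : R) : measurable [set x | c < dot v x].
Proof.
rewrite (_ : [set x | c < dot v x] = ~` [set x | dot v x <= c]); last first.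
  by apply/seteqP; split => x /= ; rewrite ltNge => /negP.
by apply: measurableC; exact: measurable_dot_le.
Qed.

Lemma measurable_hpoly n (L : seq ('rV[R]_n * R)) : measurable (hpoly L).
Proof.
elim: L => [|p L IH].
  by rewrite (_ : hpoly [::] = setT) //; apply/seteqP; split.
rewrite (_ : hpoly (p :: L) = [set x | dot p.1 x <= p.2] `&` hpoly L).
  by apply: measurableI => //; exact: measurable_dot_le.
apply/seteqP; split => x.
  by move=> h; split; [apply: h; rewrite mem_head|move=> q qL; apply: h; rewrite in_cons qL orbT].
by move=> [h1 h2] q; rewrite in_cons => /predU1P[->|/h2].
Qed.

Lemma hpoly_mulmx n (L : seq ('rV[R]_n * R)) (G : 'M[R]_n) :
  [set x | hpoly L (x *m G)] = hpoly [seq (p.1 *m G^T, p.2) | p <- L].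
Proof.
apply/seteqP; split => x h.
  by move=> _ /mapP[p pL ->]; rewrite -dot_mulmx; exact: h.
by move=> p pL; rewrite dot_mulmx; exact: (h _ (map_f _ pL)).
Qed.

Lemma hpoly_convex n (L : seq ('rV[R]_n * R)) x y (t : R) : 0 <= t <= 1 ->
  hpoly L x -> hpoly L y -> hpoly L ((1 - t) *: x + t *: y).
Proof.
move=> /andP[t0 t1] hx hy p pL; rewrite dotDr !dotZr.
have := hx _ pL; have := hy _ pL; nra.
Qed.

Definition affv n (u : 'rV[R]_n * R) (y : 'rV[R]_n) := dot u.1 y + u.2.

Definition solve0 n (p : 'rV[R]_n.+1 * R) : 'rV[R]_n * R :=
  (- (p.1 ord0 ord0)^-1 *: tl p.1, (p.1 ord0 ord0)^-1 * p.2).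

(** An inequality with positive first coefficient bounds the first coordinate above by an affine
    function of the others. Duplicates are removed because sums over this list must count each
    boundary piece once. *)
Definition uppers n (L : seq ('rV[R]_n.+1 * R)) : seq ('rV[R]_n * R) :=
  undup [seq solve0 p | p <- [seq p : 'rV[R]_n.+1 * R <- L | 0 < p.1 ord0 ord0]].

Definition lowers n (L : seq ('rV[R]_n.+1 * R)) : seq ('rV[R]_n * R) :=
  undup [seq solve0 p | p <- [seq p : 'rV[R]_n.+1 * R <- L | p.1 ord0 ord0 < 0]].

Definition flats n (L : seq ('rV[R]_n.+1 * R)) : seq ('rV[R]_n * R) :=
  [seq (tl p.1, p.2) | p <- [seq p : 'rV[R]_n.+1 * R <- L | p.1 ord0 ord0 == 0]].

Lemma hpoly_cons n (L : seq ('rV[R]_n.+1 * R)) t y : hpoly L (cons_rV (t, y)) <->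
  [/\ hpoly (flats L) y, forall u, u \in uppers L -> t <= affv u y &
      forall u, u \in lowers L -> affv u y <= t].
Proof.
have E (p : 'rV[R]_n.+1 * R) : p.1 ord0 ord0 != 0 ->
    affv (solve0 p) y =
    (p.2 - dot (tl p.1) y) / p.1 ord0 ord0.
  by move=> p0; rewrite /affv /solve0 /= dotZl; ring.
split.
  move=> h; split.
  - move=> q /mapP[p]; rewrite mem_filter => /andP[/eqP p0 pL] ->.
    by have := h p pL; rewrite dot_cons p0 mul0r add0r.
  - move=> u; rewrite mem_undup => /mapP[p]; rewrite mem_filter => /andP[p0 pL] ->.
    have := h p pL; rewrite dot_cons E ?gt_eqF // ler_pdivlMr // mulrC; lra.
  - move=> u; rewrite mem_undup => /mapP[p]; rewrite mem_filter => /andP[p0 pL] ->.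
    have := h p pL; rewrite dot_cons E ?lt_eqF // ler_ndivrMr // mulrC; lra.
move=> [h0 hu hl] p pL; rewrite dot_cons.
have [p0|p0|p0] := ltgtP (p.1 ord0 ord0) 0.
- have := hl (solve0 p).
  rewrite mem_undup E ?lt_eqF // ler_ndivrMr //.
  have -> : (solve0 p) \in
    [seq solve0 p | p <- [seq p : 'rV[R]_n.+1 * R <- L | p.1 ord0 ord0 < 0]].
    by apply/mapP; exists p => //; rewrite mem_filter p0.
  by move=> /(_ isT); rewrite mulrC; lra.
- have := hu (solve0 p).
  rewrite mem_undup E ?gt_eqF // ler_pdivlMr //.
  have -> : (solve0 p) \in
    [seq solve0 p | p <- [seq p : 'rV[R]_n.+1 * R <- L | 0 < p.1 ord0 ord0]].
    by apply/mapP; exists p => //; rewrite mem_filter p0.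
  by move=> /(_ isT); rewrite mulrC; lra.
- rewrite p0 mul0r add0r.
  by apply: (h0 (tl p.1, p.2)); apply/mapP; exists p => //; rewrite mem_filter p0 eqxx.
Qed.

Lemma seq_min (T : eqType) (f : T -> R) (s : seq T) x0 : x0 \in s ->
  exists2 x, x \in s & forall y, y \in s -> f x <= f y.
Proof.
elim: s x0 => // a s IH x0 _.
case: s IH => [|b s] IH.
  by exists a; rewrite ?mem_head // => y; rewrite inE => /eqP ->.
have [x xs hx] := IH b (mem_head _ _).
have [le|lt] := leP (f a) (f x).
  exists a; first exact: mem_head.
  move=> y; rewrite inE => /predU1P[->//|/hx]; exact: le_trans.
exists x; first by rewrite inE xs orbT.
by move=> y; rewrite inE => /predU1P[->|/hx//]; exact: ltW.
Qed.

(** Boundedness makes both lists of bounds nonempty, as the fibre would otherwise contain a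
    half-line. Its ends are the least upper and the greatest lower bound at [y]. *)
Lemma hpoly_fiber n (L : seq ('rV[R]_n.+1 * R)) (r : R) y t0 :
  (forall x, hpoly L x -> forall i, `|x ord0 i| <= r) -> hpoly L (cons_rV (t0, y)) ->
  exists u l, [/\ u \in uppers L, l \in lowers L, affv l y <= affv u y &
     forall t, hpoly L (cons_rV (t, y)) <-> affv l y <= t <= affv u y].
Proof.
move=> hr h0; have /hpoly_cons[f0 u0 l0] := h0.
have [u uU hu] : exists2 u, u \in uppers L & forall u', u' \in uppers L -> affv u y <= affv u' y.
  case E : (uppers L) u0 => [|a s] u0.
    have : hpoly L (cons_rV (`|t0| + `|r| + 1, y)).
      apply/hpoly_cons; split => // [u|u /l0]; first by rewrite E.
      by move=> /le_trans; apply; rewrite -addrA (le_trans (ler_norm _)) // lerDl addr_ge0.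
    move=> /hr /(_ ord0); rewrite cons_rV0 /= ger0_norm ?addr_ge0 //.
    by have := ler_norm r; have := normr_ge0 t0; lra.
  by apply: (seq_min (fun u => affv u y) (mem_head a s)).
have [l lW hl] : exists2 l, l \in lowers L & forall l', l' \in lowers L -> - affv l y <= - affv l' y.
  case E : (lowers L) l0 => [|a s] l0.
    have : hpoly L (cons_rV (- (`|t0| + `|r| + 1), y)).
      apply/hpoly_cons; split => // [v /u0|v]; last by rewrite E.
      by move=> h; have := ler_norm (- t0); rewrite normrN; have := normr_ge0 r; lra.
    move=> /hr /(_ ord0); rewrite cons_rV0 /= normrN ger0_norm ?addr_ge0 //.
    by have := ler_norm r; have := normr_ge0 t0; lra.
  by apply: (seq_min (fun u => - affv u y) (mem_head a s)).
exists u, l; split => //; first by apply: (le_trans (l0 _ lW)); exact: u0.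
move=> t; split => [/hpoly_cons[_ h1 h2]|/andP[h1 h2]]; first by rewrite h1 ?h2.
apply/hpoly_cons; split => // [v /hu|v /hl]; first exact: le_trans.
by rewrite lerN2 => /le_trans; apply.
Qed.

(** The part of the polytope on the graph of [u], projected along the first coordinate. It is again
    an intersection of half-spaces, and slices are the case of constant [u], so the asymptotics can
    be applied to slices in turn. *)
Definition piece n (L : seq ('rV[R]_n.+1 * R)) (u : 'rV[R]_n * R) : set 'rV[R]_n :=
  [set y | hpoly L (cons_rV (affv u y, y))].

Lemma pieceE n (L : seq ('rV[R]_n.+1 * R)) (u : 'rV[R]_n * R) :
  piece L u = hpoly [seq ((p : 'rV[R]_n.+1 * R).1 ord0 ord0 *: u.1 + tl p.1, p.2 - p.1 ord0 ord0 * u.2) | p <- L].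
Proof.
have E (p : 'rV[R]_n.+1 * R) y : (dot p.1 (cons_rV (affv u y, y)) <= p.2) =
    (dot (p.1 ord0 ord0 *: u.1 + tl p.1) y <= p.2 - p.1 ord0 ord0 * u.2).
  by rewrite dot_cons dotDl dotZl /affv mulrDr lerBrDr addrAC.
apply/seteqP; split => y h; first by move=> _ /mapP[p pL ->]; rewrite -E; exact: h.
by move=> p pL; rewrite E; exact: (h _ (map_f _ pL)).
Qed.

Definition slice n (L : seq ('rV[R]_n.+1 * R)) (M : R) : set 'rV[R]_n :=
  [set y | hpoly L (cons_rV (M, y))].

Lemma slice_piece n (L : seq ('rV[R]_n.+1 * R)) M : slice L M = piece L (0, M).
Proof. by apply/seteqP; split => y; rewrite /slice /piece /= /affv /= dot0l add0r. Qed.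

Definition slice_list n (L : seq ('rV[R]_n.+1 * R)) (M : R) :=
  [seq ((p : 'rV[R]_n.+1 * R).1 ord0 ord0 *: (0 : 'rV[R]_n) + tl p.1, p.2 - p.1 ord0 ord0 * M) | p <- L].

Lemma sliceE n (L : seq ('rV[R]_n.+1 * R)) M : slice L M = hpoly (slice_list L M).
Proof. by rewrite slice_piece pieceE. Qed.

Lemma bset_hpoly n (L : seq ('rV[R]_n * R)) (r : R) :
  (forall x, hpoly L x -> forall i, `|x ord0 i| <= r) -> bset (hpoly L).
Proof. by move=> h; split; [exact: measurable_hpoly|exists r]. Qed.

Lemma bset_piece n (L : seq ('rV[R]_n.+1 * R)) u : bset (hpoly L) -> bset (piece L u).
Proof.
move=> [_ [r hr]]; split; first by rewrite pieceE; exact: measurable_hpoly.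
by exists r => y /hr h i; have := h (lift ord0 i); rewrite cons_rVS.
Qed.

Lemma bset_slice n (L : seq ('rV[R]_n.+1 * R)) M : bset (hpoly L) -> bset (slice L M).
Proof. by rewrite slice_piece; exact: bset_piece. Qed.

Lemma vol_null_cover n (Q : seq ('rV[R]_n * R)) (E : set 'rV[R]_n) : bset E ->
  (forall q, q \in Q -> q.1 != 0) ->
  (forall x, E x -> exists2 q, q \in Q & dot q.1 x = q.2) -> vol E = 0.
Proof.
elim: Q E => [|q Q IH] E bE hQ hE.
  rewrite (_ : E = set0) ?vol_set0 //; apply/seteqP; split => // x /hE[q]; by rewrite in_nil.
have mH : measurable [set x | dot q.1 x = q.2].
  have := measurable_dot q.1 measurableT (measurable_set1 q.2).
  by rewrite setTI; congr measurable; apply/seteqP; split.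
rewrite (vol_setDI bE mH) (vol_hyperplane (hQ q (mem_head _ _)) (bsetI bE mH) (c := q.2)); last first.
  by move=> x [].
rewrite add0r; apply: IH; first exact: bsetD.
  by move=> p pQ; apply: hQ; rewrite inE pQ orbT.
move=> x [/hE[p]]; rewrite inE => /predU1P[-> h nh|pQ h _]; first by [].
by exists p.
Qed.

(** A substitute for equality almost everywhere: the exceptional sets that arise for polytopes lie
    in finitely many hyperplanes. *)
Lemma In_eq_null n (Q : seq ('rV[R]_n * R)) (f g : 'rV[R]_n -> R) : nice f -> nice g ->
  (forall q, q \in Q -> q.1 != 0) ->
  (forall x, (forall q, q \in Q -> dot q.1 x != q.2) -> f x = g x) -> In f = In g.
Proof.
move=> nf ng hQ hE; apply/eqP; rewrite -subr_eq0 -In_B // -normr_le0.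
have [mh [r [c hc]]] := niceB nf ng.
pose D := [set x | f x - g x != 0].
have mD : measurable D.
  rewrite (_ : D = (fun x => f x - g x) @^-1` (~` [set 0])).
    by have := mh measurableT _ (measurableC (measurable_set1 0)); rewrite setTI.
  by apply/seteqP; split => x /eqP.
have bD : bset D by split => //; exists r => x; exact: (hc x).2.
have vD : vol D = 0.
  apply: (vol_null_cover bD hQ) => x; rewrite /D /= => h; apply: contrapT => nq.
  move/eqP: h; apply; rewrite hE ?subrr // => q qQ; apply/eqP => e; apply: nq.
  by exists q.
rewrite (_ : (fun x => _) = (fun x => \1_D x * (f x - g x))).
  have := In_indicM_le bD mh (fun x => (hc x).1); rewrite vD mulr0 => ->//.
apply/funext => x; rewrite indicE; case: (boolP (x \in D)) => [_|]; first by rewrite mul1r.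
by rewrite notin_setE /D /= => /negP; rewrite negbK mul0r => /eqP.
Qed.

End hpoly.

(** * Asymptotics of the Fourier transform of a polytope *)

Section asymptotics.
Context (R : realType).

(* The Fourier transform of [\1_P] vanishes at [w] iff [sJ P w th = 0] for all [th]. *)
Definition sJ n (P : set 'rV[R]_n) (w : 'rV[R]_n) (th : R) :=
  In (fun x => \1_P x * sin (2 * pi * dot w x + th)).

Lemma norm_sin_le1 (x : R) : `|sin x| <= 1.
Proof. by rewrite ler_norml sin_geN1 sin_le1. Qed.

Lemma measurable_sin_dot n (w : 'rV[R]_n) (th : R) :
  measurable_fun setT (fun x : 'rV[R]_n => sin (2 * pi * dot w x + th)).
Proof.
have ms : measurable_fun setT (@sin R).
  by apply: continuous_measurable_fun; exact: continuous_sin.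
apply: (measurableT_comp ms); apply: measurable_funD => //.
by apply: measurable_funM => //; exact: measurable_dot.
Qed.

Lemma nice_sJ n (P : set 'rV[R]_n) w th : bset P ->
  nice (fun x => \1_P x * sin (2 * pi * dot w x + th)).
Proof.
move=> bP; apply: (nice_indicM (c := 1)) => //; first exact: measurable_sin_dot.
by move=> x; exact: norm_sin_le1.
Qed.

Lemma sJ_le n (P : set 'rV[R]_n) w th : bset P -> `|sJ P w th| <= vol P.
Proof.
move=> bP; rewrite -[leRHS]mul1r; apply: In_indicM_le => //; first exact: measurable_sin_dot.
by move=> x; exact: norm_sin_le1.
Qed.

Lemma sJ_shift2pi n (P : set 'rV[R]_n) w th (z : int) : sJ P w (th + 2 * pi * z%:~R) = sJ P w th.
Proof.
congr In; apply/funext => x; congr (_ * _); rewrite addrA; move: (_ + th) => a.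
have e k b : sin (b + 2 * pi * k%:R) = sin b :> R.
  by rewrite mulr_natl mulr_natr; apply: periodicn; exact: sinD2pi.
case: z => k; first exact: e.
by rewrite NegzE mulrNz -pmulrn mulrN -[in RHS](subrK (2 * pi * k.+1%:R) a) e.
Qed.

Lemma bset_box n (r : R) : bset (@box R n r).
Proof.
split; first exact: measurable_box.
by exists r => x h i; have := h i; rewrite /= in_itv /= ler_norml.
Qed.

(** The fibre is empty or an interval; over an interval the integral of the sine is a difference of
    two cosines divided by [w]. *)
Lemma fiber_sin n (L : seq ('rV[R]_n.+1 * R)) (r : R) y w th : w != 0 ->
  (forall x, hpoly L x -> forall i, `|x ord0 i| <= r) ->
  `|I1 (fun t => \1_(hpoly L) (cons_rV (t, y)) * sin (w * t + th))| <=
     2 / `|w| * \1_(@box R n r) y.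
Proof.
move=> w0 hr; have nw : 0 < `|w| by rewrite normr_gt0.
have [[t0 ht0]|nt] := pselect (exists t0, hpoly L (cons_rV (t0, y))); last first.
  rewrite (_ : (fun t => _) = fun=> 0).
    rewrite /I1 Rintegral_cst // mul0r normr0 mulr_ge0 ?divr_ge0 //.
  by apply/funext => t; rewrite indicE memNset ?mul0r // => h; apply: nt; exists t.
have yb : @box R n r y.
  by move=> i; have := hr _ ht0 (lift ord0 i); rewrite cons_rVS /= in_itv /= ler_norml.
rewrite indicE mem_set // mulr1.
have [u [l [_ _ lu hul]]] := hpoly_fiber hr ht0.
rewrite (_ : (fun t => _) = fun t => \1_(`[affv l y, affv u y]%classic) t * sin (w * t + th)).
  rewrite ler_pdivlMr // mulrC -normrM I1_sin //.
  apply: (le_trans (ler_normB _ _)).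
  by have := @cos_geN1 R; have := @cos_le1 R => h1 h2; rewrite -[2]/(1 + 1) lerD // ler_norml h1 h2.
apply/funext => t; congr (_ * _); rewrite !indicE; congr ((nat_of_bool _)%:R).
by apply/idP/idP; rewrite !inE /= in_itv /=; apply hul.
Qed.

(** With [<g, x>] as first coordinate, every fibre contributes O(1/xi) by [fiber_sin], and the
    projection has bounded volume. Uniformity in [eta] and [th] matters, because later both depend
    on the zero that also determines [xi]. *)
Lemma riemann_lebesgue n (L : seq ('rV[R]_n * R)) (g : 'rV[R]_n) : bset (hpoly L) -> g != 0 ->
  forall tau eps : R, 0 < eps -> exists X : R, forall xi, X <= xi ->
    forall eta : 'rV[R]_n, (forall i, `|eta ord0 i| <= tau) -> forall th,
    `|sJ (hpoly L) (xi *: g + eta) th| <= eps.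
Proof.
case: n L g => [L g _ /negP[]|n L g bP g0 tau eps e0].
  by apply/eqP/rowP; case.
have [G uG [c c0 [dG hG]]] := dir_coord g0.
have [bP' _] := vol_mulmx uG hG bP.
pose L' := [seq (p.1 *m G^T, p.2) | p <- L].
have PE : [set x | hpoly L (x *m G)] = hpoly L' by exact: hpoly_mulmx.
rewrite PE in bP'; have [_ [r hr]] := bP'.
have [tau' ht'] := mulmx_bound G^T tau.
have vb : 0 <= vol (@box R n r) by exact: vol_ge0.
exists (`|tau'| + 1 + vol (@box R n r) / (c * eps)) => xi hxi eta heta th.
have he : `|(eta *m G^T) ord0 ord0| <= `|tau'| by apply: (le_trans (ht' eta heta ord0)); exact: ler_norm.
pose w := 2 * pi * (xi + (eta *m G^T) ord0 ord0).
have vq : 0 <= vol (@box R n r) / (c * eps) by rewrite divr_ge0 // mulr_ge0 // ltW.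
have xe : 1 + vol (@box R n r) / (c * eps) <= xi + (eta *m G^T) ord0 ord0.
  by move: he; rewrite ler_norml => /andP[]; lra.
have pi2 := @pi_ge2 R.
have w2 : 2 * (xi + (eta *m G^T) ord0 ord0) <= w by rewrite /w; nra.
have w0 : 0 < w by lra.
rewrite -(ler_pM2l c0) -{1}(gtr0_norm c0) -normrM /sJ -hG; last exact: nice_sJ.
have fE : (fun x => \1_(hpoly L) (x *m G) * sin (2 * pi * dot (xi *: g + eta) (x *m G) + th)) =
    (fun x => \1_(hpoly L') x * sin (2 * pi * (xi * x ord0 ord0 + dot (eta *m G^T) x) + th)).
  by apply/funext => x; rewrite -PE dotDl dotZl dG dot_mulmx; congr (_ * _).
have nf : nice (fun x => \1_(hpoly L') x * sin (2 * pi * (xi * x ord0 ord0 + dot (eta *m G^T) x) + th)).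
  by rewrite -fE; have h := nice_mulmx uG (nice_sJ (xi *: g + eta) th bP); exact: h.
rewrite fE (nice_consD nf).
apply: (@le_trans _ _ (In (fun y => 2 / w * \1_(@box R n r) y))).
  apply: In_abs_le; first exact: (nice_consI nf).
    by apply: niceZ; apply: nice_indic; exact: bset_box.
  move=> y; have := @fiber_sin n L' r y w (2 * pi * dot (tl (eta *m G^T)) y + th) (lt0r_neq0 w0) hr.
  rewrite (gtr0_norm w0); congr (`|I1 _| <= _); apply/funext => t; congr (_ * sin _).
  by rewrite dot_cons cons_rV0 /w /=; ring.
rewrite In_Z; last by apply: nice_indic; exact: bset_box.
rewrite -/(vol _) mulrAC ler_pdivrMr //.
have : vol (@box R n r) <= (c * eps) * (xi + (eta *m G^T) ord0 ord0).
  rewrite -ler_pdivrMl ?mulr_gt0 // mulrC; lra.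
have ce : 0 < c * eps by rewrite mulr_gt0.
nra.
Qed.

Lemma seq_uniform (T : eqType) (V : seq T) (Q : T -> R -> Prop) :
  (forall u, u \in V -> exists X : R, forall xi, X <= xi -> Q u xi) ->
  exists X : R, forall u, u \in V -> forall xi, X <= xi -> Q u xi.
Proof.
elim: V => [_|a V IH h]; first by exists 0.
have [u uV|X hX] := IH; first by apply: h; rewrite inE uV orbT.
have [Y hY] := h a (mem_head _ _).
exists (Num.max X Y) => u; rewrite inE => /predU1P[->|uV] xi; rewrite ge_max => /andP[h1 h2].
  exact: hY.
exact: hX.
Qed.

(** Pieces of nonconstant [u] tend to 0 by [riemann_lebesgue], constant bounds other than [M] have
    an empty piece, and the constant [M] contributes exactly the slice. *)
Lemma pieces_sum n (L : seq ('rV[R]_n.+1 * R)) (V : seq ('rV[R]_n * R)) (M : R) :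
  bset (hpoly L) -> uniq V ->
  (forall u, u \in V -> u.1 = 0 -> u.2 != M -> piece L u = set0) ->
  ((0, M) \notin V -> vol (slice L M) = 0) ->
  forall tau eps : R, 0 < eps -> exists X : R, forall xi, X <= xi ->
    forall eta : 'rV[R]_n, (forall i, `|eta ord0 i| <= tau) -> forall th,
    `|\sum_(u <- V) sJ (piece L u) (xi *: u.1 + eta) (2 * pi * (xi * u.2) + th) -
      sJ (slice L M) eta (2 * pi * (xi * M) + th)| <= eps.
Proof.
move=> bP uV h0 hM tau eps e0.
(* An equal share for each piece; the successor avoids a division by 0 when the list is empty. *)
have e1 : 0 < eps / (size V).+1%:R by rewrite divr_gt0.
have [X hX] : exists X : R, forall u, u \in V -> forall xi, X <= xi -> u != (0, M) ->
    forall eta : 'rV[R]_n, (forall i, `|eta ord0 i| <= tau) -> forall th,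
    `|sJ (piece L u) (xi *: u.1 + eta) th| <= eps / (size V).+1%:R.
  apply: seq_uniform => u uV'; have [u0|u0] := eqVneq u.1 0; last first.
    have bu := bset_piece u bP; rewrite pieceE in bu.
    have [X hX] := riemann_lebesgue bu u0 tau e1.
    by exists X => xi hxi _ eta heta th; rewrite pieceE; exact: hX.
  exists 0 => xi _ uM eta _ th; rewrite h0 //; last first.
    by apply: contra_neq uM => uM; rewrite -uM -u0; case: (u).
  rewrite /sJ (_ : (fun x => _) = fun=> 0) ?In_0 ?normr0 1?ltW //.
  by apply/funext => x; rewrite indicE in_set0 mul0r.
exists X => xi hxi eta heta th.
have main : forall W : seq ('rV[R]_n * R), {subset W <= V} -> (0, M) \notin W ->
    `|\sum_(u <- W) sJ (piece L u) (xi *: u.1 + eta) (2 * pi * (xi * u.2) + th)| <=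
    (size W)%:R * (eps / (size V).+1%:R).
  elim=> [_ _|u W IH sW nW]; first by rewrite big_nil normr0 mul0r.
  rewrite big_cons [size _]/= -[(size W).+1%:R]natr1 [leRHS]mulrDl mul1r; apply: (le_trans (ler_normD _ _)); rewrite [leRHS]addrC lerD //.
    apply: hX => //; first by apply: sW; exact: mem_head.
    by apply: contra nW => /eqP ->; exact: mem_head.
  apply: IH; first by move=> v vW; apply: sW; rewrite inE vW orbT.
  by apply: contra nW => h; rewrite inE h orbT.
have sz : (size V)%:R * (eps / (size V).+1%:R) <= eps.
  by rewrite mulrCA ler_piMr ?(ltW e0) // ler_pdivrMr // mul1r ler_nat.
case: (boolP ((0, M) \in V)) => MV.
  rewrite (bigD1_seq (0, M)) //= scaler0 add0r slice_piece addrAC subrr add0r.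
  rewrite -big_filter; apply: le_trans (main _ _ _) _.
  - by move=> u; rewrite mem_filter => /andP[].
  - by rewrite mem_filter eqxx.
  - apply: le_trans sz; rewrite ler_wpM2r ?(ltW e1) // ler_nat size_filter; exact: count_size.
have -> : sJ (slice L M) eta (2 * pi * (xi * M) + th) = 0.
  apply/eqP; rewrite -normr_le0; have := sJ_le eta (2 * pi * (xi * M) + th) (bset_slice M bP).
  by rewrite (hM MV).
rewrite subr0; apply: le_trans (main _ _ _) sz => //.
Qed.

(** Where no two bounds agree, [y] belongs to exactly one upper and one lower piece, so each sum
    reduces to one term, at an end of the fibre. *)
Lemma fiber_pieces n (L : seq ('rV[R]_n.+1 * R)) (F : R -> R) y : bset (hpoly L) ->
  (forall u v, u \in uppers L -> v \in uppers L -> u != v -> affv u y != affv v y) ->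
  (forall u v, u \in lowers L -> v \in lowers L -> u != v -> affv u y != affv v y) ->
  (exists t, hpoly L (cons_rV (t, y))) ->
  exists a b, [/\ a <= b, (forall t, hpoly L (cons_rV (t, y)) <-> a <= t <= b),
    \sum_(u <- uppers L) \1_(piece L u) y * F (affv u y) = F b &
    \sum_(u <- lowers L) \1_(piece L u) y * F (affv u y) = F a].
Proof.
move=> [_ [r hr]] hU hW [t0 ht0].
have [u [l [uU lW lu hul]]] := hpoly_fiber hr ht0.
exists (affv l y), (affv u y); split => //.
- rewrite (bigD1_seq u) //=; last exact: undup_uniq.
  rewrite indicE mem_set /piece /=; last by apply/hul; rewrite lu lexx.
  rewrite mul1r big_seq_cond big1 ?addr0 // => v /andP[vU vu].
  rewrite indicE memNset ?mul0r // => hv.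
  have /hul /andP[_ h1] := hv.
  have /hpoly_cons[_ h2 _] : hpoly L (cons_rV (affv u y, y)) by apply/hul; rewrite lu lexx.
  by move: (hU _ _ vU uU vu); rewrite eq_le h1 (h2 _ vU).
- rewrite (bigD1_seq l) //=; last exact: undup_uniq.
  rewrite indicE mem_set /piece /=; last by apply/hul; rewrite lu lexx.
  rewrite mul1r big_seq_cond big1 ?addr0 // => v /andP[vU vl].
  rewrite indicE memNset ?mul0r // => hv.
  have /hul /andP[h1 _] := hv.
  have /hpoly_cons[_ _ h2] : hpoly L (cons_rV (affv l y, y)) by apply/hul; rewrite lu lexx.
  by move: (hW _ _ vU lW vl); rewrite eq_le h1 (h2 _ vU).
Qed.

(** The hyperplanes on which two of the affine functions agree. Pairs with equal linear parts are
    dropped, since these functions are identical or agree nowhere. *)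
Definition crossings n (U : seq ('rV[R]_n * R)) : seq ('rV[R]_n * R) :=
  [seq q <- [seq (u.1 - v.1, v.2 - u.2) | u <- U, v <- U] | q.1 != 0].

Lemma crossingsP n (U : seq ('rV[R]_n * R)) y :
  (forall q, q \in crossings U -> dot q.1 y != q.2) ->
  forall u v, u \in U -> v \in U -> u != v -> affv u y != affv v y.
Proof.
move=> h u v uU vU uv; apply/eqP => e.
have [e1|e1] := eqVneq (u.1 - v.1) 0.
  move/eqP: uv; apply; move/eqP: e1; rewrite subr_eq0 => /eqP e1.
  by move: e; rewrite /affv e1 => /addrI e2; case: (u) (v) e1 e2 => ? ? [? ?] /= -> ->.
have : (u.1 - v.1, v.2 - u.2) \in crossings U.
  rewrite mem_filter /= e1; apply/allpairsP; exists (u, v); split => //.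
by move=> /h /=; rewrite dotBl; apply/negP; rewrite negbK; apply/eqP; move: e; rewrite /affv; lra.
Qed.

(** Integrating the sine along a fibre leaves its two ends, which sweep out the upper and the lower
    pieces. The shift by [pi / 2] turns the cosines of the antiderivative back into sines. *)
Lemma sJ_pieces n (L : seq ('rV[R]_n.+1 * R)) (xi : R) eta th : bset (hpoly L) -> 0 < xi ->
  2 * pi * xi * sJ (hpoly L) (cons_rV (xi, eta)) th =
    \sum_(u <- uppers L) sJ (piece L u) (xi *: u.1 + eta) (2 * pi * (xi * u.2) + (th - pi / 2)) -
    \sum_(u <- lowers L) sJ (piece L u) (xi *: u.1 + eta) (2 * pi * (xi * u.2) + (th - pi / 2)).
Proof.
move=> bP x0; have nf := nice_sJ (cons_rV (xi, eta)) th bP.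
have w0 : 2 * pi * xi != 0 :> R by rewrite !mulf_neq0 ?gt_eqF // pi_gt0.
have np u : nice (fun y => \1_(piece L u) y * sin (2 * pi * dot (xi *: u.1 + eta) y + (2 * pi * (xi * u.2) + (th - pi / 2)))).
  by apply: nice_sJ; exact: bset_piece.
rewrite /sJ (nice_consD nf) -(In_Z _ (nice_consI nf)).
rewrite -!In_sum -?In_B; [|by apply: nice_sum..|by []|by []].
have [_ [r hr]] := bP.
apply: (In_eq_null (Q := crossings (uppers L) ++ crossings (lowers L))).
- exact: (niceZ _ (nice_consI nf)).
- by apply: niceB; apply: nice_sum.
- by move=> q; rewrite mem_cat !mem_filter => /orP[] /andP[].
move=> y hy; pose F t := sin (2 * pi * (xi * t + dot eta y) + (th - pi / 2)).
have FE u : sin (2 * pi * dot (xi *: u.1 + eta) y + (2 * pi * (xi * u.2) + (th - pi / 2))) = F (affv u y).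
  by rewrite /F /affv dotDl dotZl; congr sin; ring.
under eq_bigr do rewrite FE.
under [X in _ - X]eq_bigr do rewrite FE.
have [ht|nt] := pselect (exists t, hpoly L (cons_rV (t, y))); last first.
  rewrite (_ : (fun t => _) = fun=> 0); last first.
    by apply/funext => t; rewrite indicE memNset ?mul0r // => h; apply: nt; exists t.
  rewrite /I1 Rintegral_cst // mul0r mulr0.
  rewrite !big1 ?subrr // => u _; rewrite indicE memNset ?mul0r // => h; apply: nt; by exists (affv u y).
have [|u v|a [b [ab hab -> ->]]] := fiber_pieces F bP _ _ ht.
- by apply: crossingsP => q qU; apply: hy; rewrite mem_cat qU.
- by apply: crossingsP => q qU; apply: hy; rewrite mem_cat qU orbT.
rewrite (_ : (fun t => _) = fun t => \1_(`[a, b]%classic) t * sin (2 * pi * xi * t + (2 * pi * dot eta y + th))).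
  rewrite I1_sin // /F !addrA !sinBpihalf.
  by rewrite opprK [RHS]addrC; congr (cos _ - cos _); ring.
apply/funext => t; congr (_ * sin _).
  rewrite !indicE; congr ((nat_of_bool _)%:R); apply/idP/idP; rewrite !inE /= in_itv /=; apply hab.
by rewrite dot_cons2; ring.
Qed.

(** [pieces_sum] for the upper and for the lower pieces of [sJ_pieces]. An extreme slice that is not
    a facet has area 0 and a zero term, so the formula needs no case distinction. *)
Lemma sJ_asymptotics n (L : seq ('rV[R]_n.+1 * R)) (M m : R) : bset (hpoly L) ->
  (exists2 x, hpoly L x & x ord0 ord0 = M) -> (forall x, hpoly L x -> x ord0 ord0 <= M) ->
  (exists2 x, hpoly L x & x ord0 ord0 = m) -> (forall x, hpoly L x -> m <= x ord0 ord0) ->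
  forall tau eps : R, 0 < eps -> exists X : R, forall xi, X <= xi ->
    forall eta : 'rV[R]_n, (forall i, `|eta ord0 i| <= tau) -> forall th,
    `|2 * pi * xi * sJ (hpoly L) (cons_rV (xi, eta)) th -
      (sJ (slice L M) eta (2 * pi * (xi * M) + (th - pi / 2)) -
       sJ (slice L m) eta (2 * pi * (xi * m) + (th - pi / 2)))| <= eps.
Proof.
move=> bP [xM PM xME] hM [xm Pm xmE] hm tau eps e0.
have e2 : 0 < eps / 2 by rewrite divr_gt0.
have [_ [r hr]] := bP.
have [|u uU u1 u2|MU|X hX] := pieces_sum (M := M) (V := uppers L) bP _ _ _ tau e2.
- exact: undup_uniq.
- apply/seteqP; split => // y; rewrite /piece /= => h.
  move/eqP: u2; apply; apply: le_anti; apply/andP; split.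
    by have := hM _ h; rewrite cons_rV0 /affv u1 /= dot0l add0r.
  move: PM; rewrite -(cons_tl xM) => /hpoly_cons[_ /(_ _ uU) + _].
  by rewrite /affv u1 dot0l add0r xME.
(* If the constant [M] is not among the bounds, then on the slice some nonconstant upper bound takes
   the value [M]. *)
- apply: (vol_null_cover (Q := [seq (q.1, M - q.2) | q <- [seq q <- uppers L | q.1 != 0]]) (bset_slice M bP)).
    by move=> q /mapP[p]; rewrite mem_filter => /andP[p0 _] ->.
  move=> y hy; have [u [l [uU _ lu hul]]] := hpoly_fiber hr hy.
  have uM : affv u y = M.
    apply: le_anti; apply/andP; split.
      have /hM : hpoly L (cons_rV (affv u y, y)) by apply/hul; rewrite lu lexx.
      by rewrite cons_rV0.
    by have /hul/andP[] := hy.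
  exists (u.1, M - u.2); last by rewrite /= -uM /affv addrK.
  apply/mapP; exists u => //; rewrite mem_filter uU andbT; apply: contra MU => /eqP u1.
  by move: uM; rewrite /affv u1 dot0l add0r => <-; rewrite -u1; case: (u) uU.
have [|u uU u1 u2|mU|Y hY] := pieces_sum (M := m) (V := lowers L) bP _ _ _ tau e2.
- exact: undup_uniq.
- apply/seteqP; split => // y; rewrite /piece /= => h.
  move/eqP: u2; apply; apply: le_anti; apply/andP; split; last first.
    by have := hm _ h; rewrite cons_rV0 /affv u1 /= dot0l add0r.
  move: Pm; rewrite -(cons_tl xm) => /hpoly_cons[_ _ /(_ _ uU)].
  by rewrite /affv u1 dot0l add0r xmE.
- apply: (vol_null_cover (Q := [seq (q.1, m - q.2) | q <- [seq q <- lowers L | q.1 != 0]]) (bset_slice m bP)).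
    by move=> q /mapP[p]; rewrite mem_filter => /andP[p0 _] ->.
  move=> y hy; have [u [l [_ lW lu hul]]] := hpoly_fiber hr hy.
  have lm : affv l y = m.
    apply: le_anti; apply/andP; split; first by have /hul/andP[] := hy.
    have /hm : hpoly L (cons_rV (affv l y, y)) by apply/hul; rewrite lu lexx.
    by rewrite cons_rV0.
  exists (l.1, m - l.2); last by rewrite /= -lm /affv addrK.
  apply/mapP; exists l => //; rewrite mem_filter lW andbT; apply: contra mU => /eqP l1.
  by move: lm; rewrite /affv l1 dot0l add0r => <-; rewrite -l1; case: (l) lW.
exists (Num.max 1 (Num.max X Y)) => xi; rewrite !ge_max => /and3P[xi1 hx1 hx2] eta heta th.
rewrite sJ_pieces //; last exact: lt_le_trans xi1.
have := hX _ hx1 _ heta (th - pi / 2); have := hY _ hx2 _ heta (th - pi / 2).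
set a := \sum_(u <- lowers L) _; set b := \sum_(u <- uppers L) _.
set c := sJ _ _ _; set d := sJ _ _ _.
rewrite !ler_norml => /andP[h1 h2] /andP[h3 h4]; apply/andP; split; lra.
Qed.

End asymptotics.

(** * Volumes of caps *)

Section caps.
Context (R : realType).

Lemma I1_le (f g : R -> R) : nice1 f -> nice1 g -> (forall t, f t <= g t) -> I1 f <= I1 g.
Proof. by move=> nf ng fg; apply: le_Rintegral => //; exact: nice1_int. Qed.

Lemma nice1_itv (a b : R) : nice1 (\1_(`[a, b]%classic) : R -> R).
Proof.
split; first exact: measurable_indic.
exists (Num.max `|a| `|b|), 1 => t; rewrite indicE; split; first by case: (_ \in _); rewrite ?normr1 ?normr0.
case: (boolP (t \in _)) => [|_]; last by rewrite eqxx.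
rewrite inE /= in_itv /= => /andP[h1 h2] _; rewrite ler_norml.
have : `|a| <= Num.max `|a| `|b| by rewrite le_max lexx.
have : `|b| <= Num.max `|a| `|b| by rewrite le_max lexx orbT.
have := ler_norm b; have := ler_norm (- a); rewrite normrN => *; apply/andP; split; lra.
Qed.

Lemma I1_itv (a b : R) : a <= b -> I1 (\1_(`[a, b]%classic) : R -> R) = b - a.
Proof.
move=> ab; rewrite /I1 /Rintegral integral_indic //= setIT lebesgue_measure_itv /= lte_fin.
by move: ab; rewrite le_eqVlt => /predU1P[->|->]; rewrite ?ltxx ?subrr.
Qed.

Lemma vol_slab_le n (X : set 'rV[R]_n.+1) (E : set 'rV[R]_n) (M s : R) : 0 <= s -> bset X -> bset E ->
  (forall t y, X (cons_rV (t, y)) -> M - s <= t <= M /\ E y) -> vol X <= s * vol E.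
Proof.
move=> s0 bX bE h; have nX := nice_indic bX.
rewrite /vol (nice_consD nX) -In_Z; last exact: nice_indic.
apply: In_le; [exact: nice_consI nX|by apply: niceZ; exact: nice_indic|] => y.
rewrite indicE; case: (boolP (y \in E)) => yE.
  rewrite mulr1 [leRHS](_ : s = I1 (\1_(`[M - s, M]%classic) : R -> R)); last by rewrite I1_itv; lra.
  apply: I1_le; [exact: nice_cons1 nX|exact: nice1_itv|] => t.
  rewrite !indicE ler_nat; case: (boolP (_ \in X)) => // tX.
  by rewrite mem_set //= in_itv /=; rewrite inE in tX; case: (h _ _ tX).
rewrite mulr0 (_ : (fun t => _) = fun=> 0); first by rewrite /I1 Rintegral_cst // mul0r.
apply/funext => t; rewrite indicE memNset // => /h[_ Ey].
by move/negP: yE; apply; rewrite inE.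
Qed.

Lemma vol_slab_ge n (X : set 'rV[R]_n.+1) (E : set 'rV[R]_n) (M s : R) : 0 <= s -> bset X -> bset E ->
  (forall t y, M - s < t <= M -> E y -> X (cons_rV (t, y))) -> s * vol E <= vol X.
Proof.
move=> s0 bX bE h; have nX := nice_indic bX.
rewrite /vol (nice_consD nX) -In_Z; last exact: nice_indic.
apply: In_le; [by apply: niceZ; exact: nice_indic|exact: nice_consI nX|] => y.
rewrite indicE; case: (boolP (y \in E)) => yE; last first.
  by rewrite mulr0; apply: Rintegral_ge0 => t _; rewrite indicE.
rewrite mulr1; apply/ler_addgt0Pr => e e0; rewrite -lerBlDr.
have [se|es] := leP s e.
  by apply: (@le_trans _ _ 0); [lra|apply: Rintegral_ge0 => t _; rewrite indicE].
(* The fibre is known to contain only a half-open interval; the closed interval of length [s - e]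
   lies inside it, and [e] is arbitrary. *)
rewrite [leLHS](_ : s - e = I1 (\1_(`[M - s + e, M]%classic) : R -> R)); last by rewrite I1_itv; lra.
apply: I1_le; [exact: nice1_itv|exact: nice_cons1 nX|] => t.
rewrite !indicE ler_nat; case: (boolP (_ \in `[M - s + e, M]%classic)) => // tI.
rewrite mem_set //; apply: h; last by rewrite inE in yE.
by rewrite inE /= in_itv /= in tI; case/andP: tI => *; apply/andP; split; lra.
Qed.

(** Covers the projection of a cap of depth [s], restricted by a condition on [w] that serves the
    intersection of two caps. Being described through the upper bounds, it is visibly a Borel
    set. *)
Definition shadow n (L : seq ('rV[R]_n.+1 * R)) (M : R) (w : 'rV[R]_n) (a b s : R) : set 'rV[R]_n :=
  [set y | exists2 u, u \in uppers L & [/\ piece L u y, M - s < affv u y & a - b * s < dot w y]].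

Lemma measurable_affv_gt n (u : 'rV[R]_n * R) (c : R) : measurable [set y | c < affv u y].
Proof.
rewrite (_ : [set y | _] = [set y | c - u.2 < dot u.1 y]); first exact: measurable_dot_gt.
by apply/seteqP; split => y; rewrite /= /affv ltrBlDr.
Qed.

Lemma measurable_shadow n (L : seq ('rV[R]_n.+1 * R)) M w a b s : measurable (shadow L M w a b s).
Proof.
rewrite /shadow; elim: (uppers L) => [|v U IH].
  by rewrite (_ : [set y | _] = set0) //; apply/seteqP; split => // y [].
rewrite (_ : [set y | _] = (piece L v `&` [set y | M - s < affv v y] `&` [set y | a - b * s < dot w y]) `|`
    [set y | exists2 u, u \in U & [/\ piece L u y, M - s < affv u y & a - b * s < dot w y]]).
  apply: measurableU => //; apply: measurableI; last exact: measurable_dot_gt.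
  apply: measurableI; last exact: measurable_affv_gt.
  by rewrite pieceE; exact: measurable_hpoly.
apply/seteqP; split => y.
  by move=> [u]; rewrite inE => /predU1P[->|uU] [h1 h2 h3]; [left|right; exists u].
move=> [[[h1 h2] h3]|[u uU h]]; first by exists v => //; exact: mem_head.
by exists u => //; rewrite inE uU orbT.
Qed.

(** Continuity from above: over a point of all the shadows the fibre has its upper end at [M], so
    the point lies in the top slice, and there [<w, y>] is at least [a]. *)
Lemma shadow_limit n (L : seq ('rV[R]_n.+1 * R)) (M : R) (w : 'rV[R]_n) (a b : R) :
  bset (hpoly L) -> (forall x, hpoly L x -> x ord0 ord0 <= M) -> 0 <= b ->
  forall e, 0 < e -> exists2 d : R, 0 < d & forall s, 0 < s -> s <= d ->
    bset (shadow L M w a b s) /\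
    vol (shadow L M w a b s) <= vol (slice L M `&` [set y | a <= dot w y]) + e.
Proof.
move=> bP hM b0 e e0; have [_ [r hr]] := bP.
have bS s : bset (shadow L M w a b s).
  split; first exact: measurable_shadow.
  exists r => y [u _ [/hr h _ _]] i; by have := h (lift ord0 i); rewrite cons_rVS.
have mS : measurable [set y : 'rV[R]_n | a <= dot w y].
  rewrite (_ : [set y | _] = [set y | dot (- w) y <= - a]); first exact: measurable_dot_le.
  by apply/seteqP; split => y; rewrite /= dotNl lerN2.
have [|s t s0 st y [u uU [h1 h2 h3]]||d d0 hd] := @vol_cont _ _ (shadow L M w a b) _ e0.
- by move=> s _; exact: measurable_shadow.
- by exists u => //; split => //; nra.
- exact: bS.
exists d => // s s0 sd; split; first exact: bS.
apply: (le_trans (hd s s0 sd)); rewrite lerD2r; apply: vol_le.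
- apply: bset_sub (bS 1); last by apply: bigcap_inf => /=; exact: ltr01.
  have -> : \bigcap_(s in [set s | 0 < s]) shadow L M w a b s = \bigcap_k shadow L M w a b (k.+1%:R^-1).
    apply/seteqP; split => y h; first by move=> k _; apply: h; rewrite /= invr_gt0.
    move=> t /= t0; near \oo => k.
    have [|u uU [h1 h2 h3]] := h k; first by [].
    have kt : k.+1%:R^-1 <= t by apply: ltW; near: k; exact: (near_infty_natSinv_lt (PosNum t0)).
    have bk : b * k.+1%:R^-1 <= b * t by rewrite ler_wpM2l.
    exists u => //; split => //.
      exact: le_lt_trans (lerB (lexx M) kt) h2.
    exact: le_lt_trans (lerB (lexx a) bk) h3.
  by apply: bigcapT_measurable => k; exact: measurable_shadow.
- by apply: bsetI => //; exact: bset_slice.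
move=> y h; have [u uU [h1 _ _]] := h 1 ltr01.
have [u' [l [uU' _ lu hul]]] := hpoly_fiber hr h1.
have top v : piece L v y -> affv v y <= affv u' y by move=> /hul /andP[].
have uM : M <= affv u' y.
  apply/ler_addgt0Pr => t t0; have [v vU [k1 k2 _]] := h t t0.
  have := top v k1; lra.
have hu' : hpoly L (cons_rV (affv u' y, y)) by apply/hul; rewrite lu lexx.
have uM' : affv u' y = M by apply: le_anti; rewrite uM; have := hM _ hu'; rewrite cons_rV0 /= => ->.
split; first by rewrite /slice /= -uM'.
rewrite /=; apply/ler_addgt0Pr => t t0; have b1 : 0 < b + 1 by lra.
have [|v vU [_ _ k3]] := h (t / (b + 1)); first by rewrite /= divr_gt0.
have : b * (t / (b + 1)) <= t.
  by rewrite mulrCA ler_piMr ?(ltW t0) // ler_pdivrMr // mul1r; lra.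
lra.
Unshelve. all: by end_near. Qed.

Lemma shadowP n (L : seq ('rV[R]_n.+1 * R)) (r M : R) (w : 'rV[R]_n) (a b s t : R) y :
  (forall x, hpoly L x -> forall i, `|x ord0 i| <= r) ->
  hpoly L (cons_rV (t, y)) -> M - s < t -> a - b * s < dot w y -> shadow L M w a b s y.
Proof.
move=> hr ht Mt hw; have [u [l [uU _ lu hul]]] := hpoly_fiber hr ht.
exists u => //; split => //; first by apply/hul; rewrite lu lexx.
by have /hul /andP[_] := ht; exact: lt_le_trans.
Qed.

Lemma bset_top_cap n (L : seq ('rV[R]_n.+1 * R)) (c : R) : bset (hpoly L) ->
  bset (hpoly L `&` [set x | c < x ord0 ord0]).
Proof.
move=> bP; apply: bsetI => //.
have := measurable_coordR (ord0 : 'I_n.+1) measurableT (measurable_itv `]c, +oo[).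
rewrite setTI; congr measurable; apply/seteqP; split => x /=; by rewrite in_itv /= andbT.
Qed.

(** The points of the top slice whose fibre stops above [M - s] decrease, as [s] tends to 0, to
    those whose fibre is a single point. There an upper and a lower bound meet, which happens only
    on finitely many hyperplanes. *)
Lemma fiber_deep n (L : seq ('rV[R]_n.+1 * R)) (M : R) : bset (hpoly L) -> 0 < vol (hpoly L) ->
  (forall x, hpoly L x -> x ord0 ord0 <= M) ->
  forall e, 0 < e -> exists2 d : R, 0 < d & forall s, 0 < s -> s <= d ->
    vol (slice L M) - e <= vol (slice L M `&` slice L (M - s)).
Proof.
move=> bP vP hM e e0; have [_ [r hr]] := bP.
have bM := bset_slice M bP.
have mS t : measurable (slice L t) by rewrite sliceE; exact: measurable_hpoly.
pose D s := slice L M `\` slice L (M - s).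
have hD s t : 0 < s -> s <= t -> D s `<=` D t.
  move=> s0 st y [h1 h2]; split => // h3; apply: h2.
  have t0 : 0 < t by exact: lt_le_trans st.
  have := @hpoly_convex _ _ L (cons_rV (M, y)) (cons_rV (M - t, y)) (s / t) _ h1 h3.
  rewrite !cons_rVZ cons_rVD -scalerDl subrK scale1r.
  rewrite (_ : (1 - s / t) * M + s / t * (M - t) = M - s); last by field; lra.
  by apply; apply/andP; split; [rewrite divr_ge0 // ltW|rewrite ler_pdivrMr // mul1r].
have [|||d d0 hd] := @vol_cont _ _ D _ e0.
- by move=> s _; apply: measurableD.
- exact: hD.
- exact: bsetD.
exists d => // s s0 sd; have := hd s s0 sd.
have -> : vol (\bigcap_(s in [set s | 0 < s]) D s) = 0.
  have bI : bset (\bigcap_(s in [set s | 0 < s]) D s).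
    apply: bset_sub (bsetD bM (mS (M - 1))); last by apply: bigcap_inf => /=; exact: ltr01.
    have -> : \bigcap_(s in [set s | 0 < s]) D s = \bigcap_k D (k.+1%:R^-1).
      apply/seteqP; split => y h; first by move=> k _; apply: h; rewrite /= invr_gt0.
      move=> t /= t0; near \oo => k.
      apply: (@hD (k.+1%:R^-1)); [by rewrite invr_gt0| |exact: h].
      by apply: ltW; near: k; exact: (near_infty_natSinv_lt (PosNum t0)).
    by apply: bigcapT_measurable => k; apply: measurableD.
  apply: (vol_null_cover (Q := [seq q <- [seq (u.1 - v.1, v.2 - u.2) | u <- uppers L, v <- lowers L] | q.1 != 0]) bI).
    by move=> q; rewrite mem_filter => /andP[].
  move=> y h; have [h1 _] := h 1 ltr01.
  have [u [l [uU lW lu hul]]] := hpoly_fiber hr h1.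
  have e1 : affv u y = M.
    apply: le_anti; apply/andP; split; last by have /hul/andP[] := h1.
    have /hM : hpoly L (cons_rV (affv u y, y)) by apply/hul; rewrite lu lexx.
    by rewrite cons_rV0.
  have e2 : affv l y = M.
    apply/eqP; rewrite eq_le -{1}e1 lu /= leNgt; apply/negP => lM.
    have [|_] := h ((M - affv l y)); first by rewrite /= subr_gt0.
    by apply; apply/hul; rewrite opprB addrC subrK lexx e1; exact: ltW.
  exists (u.1 - l.1, l.2 - u.2); last first.
    by rewrite /= dotBl; move: e1 e2; rewrite /affv; lra.
  rewrite mem_filter /=; apply/andP; split; last by apply/allpairsP; exists (u, l).
  (* Identical upper and lower bounds would confine the whole polytope to a hyperplane, against its
     positive volume. *)
  apply/eqP => ul; have ul1 : u.1 = l.1 by apply/eqP; rewrite -subr_eq0; apply/eqP.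
  have ul2 : u.2 = l.2 by move: e1 e2; rewrite /affv ul1; lra.
  have nz : cons_rV (1, - u.1) != 0 :> 'rV[R]_n.+1.
    apply/eqP => /(congr1 (fun z : 'rV[R]_n.+1 => z ord0 ord0)); rewrite cons_rV0 mxE /=.
    by apply/eqP; exact: oner_neq0.
  suff : vol (hpoly L) = 0 by move: vP => /[swap] ->; rewrite ltxx.
  apply: (vol_hyperplane nz bP (c := u.2)) => x.
  rewrite -{1}(cons_tl x) => /hpoly_cons[_ /(_ _ uU) k1 /(_ _ lW)].
  move: k1; rewrite -[X in dot _ X](cons_tl x) dot_cons2 dotNl /affv ul1 ul2 => k1 k2.
  by apply: le_anti; apply/andP; split; lra.
rewrite (vol_setDI bM (mS (M - s))) -/(D s); lra.
Unshelve. all: by end_near. Qed.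

(** The cap lies in the prism of height [s] over its shadow and contains, by convexity, the
    half-open prism over those points of the top slice whose fibre reaches [M - s]. *)
Lemma top_cap_area n (L : seq ('rV[R]_n.+1 * R)) (M : R) : bset (hpoly L) -> 0 < vol (hpoly L) ->
  (forall x, hpoly L x -> x ord0 ord0 <= M) ->
  forall e, 0 < e -> exists2 d : R, 0 < d & forall s, 0 < s -> s <= d ->
    `|vol (hpoly L `&` [set x | M - s < x ord0 ord0]) - s * vol (slice L M)| <= e * s.
Proof.
move=> bP vP hM e e0; have [_ [r hr]] := bP.
(* With [w = 0], [a = -1] and [b = 0] the second condition of the shadow reads [-1 < 0]. *)
have [d1 d10 h1] := @shadow_limit _ L M 0 (-1) 0 bP hM (lexx 0) _ e0.
have [d2 d20 h2] := fiber_deep bP vP hM e0.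
exists (Num.min d1 d2); first by rewrite lt_min d10.
move=> s s0; rewrite le_min => /andP[sd1 sd2].
have [bS vS] := h1 s s0 sd1; have := h2 s s0 sd2 => vD.
have bC := bset_top_cap (M - s) bP.
have mS t : measurable (slice L t) by rewrite sliceE; exact: measurable_hpoly.
have up : vol (hpoly L `&` [set x | M - s < x ord0 ord0]) <= s * vol (shadow L M 0 (-1) 0 s).
  apply: (vol_slab_le (M := M)) => //; first exact: ltW.
  move=> t y [ht]; rewrite /= cons_rV0 => tM; split.
    by have := hM _ ht; rewrite cons_rV0 /= => -> ; rewrite (ltW tM).
  by apply: (shadowP hr ht tM); rewrite dot0l mul0r subr0 ltrN10.
have dn : s * vol (slice L M `&` slice L (M - s)) <= vol (hpoly L `&` [set x | M - s < x ord0 ord0]).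
  apply: (vol_slab_ge (M := M)) => //; first exact: ltW.
    by apply: bsetI => //; exact: bset_slice.
  move=> t y /andP[t1 t2] [k1 k2]; split; last by rewrite /= cons_rV0.
  have := @hpoly_convex _ _ L (cons_rV (M, y)) (cons_rV (M - s, y)) ((M - t) / s) _ k1 k2.
  rewrite !cons_rVZ cons_rVD -scalerDl subrK scale1r.
  rewrite (_ : (1 - (M - t) / s) * M + (M - t) / s * (M - s) = t); last by field; lra.
  by apply; apply/andP; split; [rewrite divr_ge0 ?subr_ge0 // ltW|rewrite ler_pdivrMr // mul1r; lra].
have vS' : vol (shadow L M 0 (-1) 0 s) <= vol (slice L M) + e.
  apply: (le_trans vS); rewrite lerD2r; apply: vol_le.
  - by apply: bsetI; [exact: bset_slice|rewrite (_ : [set y | _] = setT) //; apply/seteqP; split => // y _ /=; rewrite dot0l lerN10].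
  - exact: bset_slice.
  - by move=> y [].
rewrite ler_norml; apply/andP; split; nra.
Qed.

(** The shadows shrink to the part of the top slice where [<w, x>] reaches [h]. As [tl w] is
    nonzero, this part is contained in a hyperplane of the slice and its area is 0. *)
Lemma top_cap_overlap n (L : seq ('rV[R]_n.+1 * R)) (M : R) (w : 'rV[R]_n.+1) (h : R) :
  bset (hpoly L) -> (forall x, hpoly L x -> x ord0 ord0 <= M) ->
  (forall x, hpoly L x -> dot w x <= h) -> tl w != 0 ->
  forall e, 0 < e -> exists2 d : R, 0 < d & forall s, 0 < s -> s <= d ->
    vol (hpoly L `&` [set x | M - s < x ord0 ord0] `&` [set x | h - s < dot w x]) <= e * s.
Proof.
move=> bP hM hw w0 e e0; have [_ [r hr]] := bP.
(* Replacing the first coordinate by [M] changes [<w, x>] by at most [|w 0| s]; the summand 1 is the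
   depth of the second cap. *)
pose b := 1 + `|w ord0 ord0|.
have b0 : 0 <= b by rewrite addr_ge0.
have [d d0 hd] := @shadow_limit _ L M (tl w) (h - w ord0 ord0 * M) b bP hM b0 _ e0.
exists d => // s s0 sd; have [bS vS] := hd s s0 sd.
have v0 : vol (slice L M `&` [set y | h - w ord0 ord0 * M <= dot (tl w) y]) = 0.
  apply: (vol_hyperplane (c := h - w ord0 ord0 * M) w0).
    apply: bsetI; first exact: bset_slice.
    rewrite (_ : [set y | _] = [set y | dot (- tl w) y <= - (h - w ord0 ord0 * M)]); first exact: measurable_dot_le.
    by apply/seteqP; split => y; rewrite /= dotNl lerN2.
  move=> y [k1 /= k2]; have := hw _ k1; rewrite dot_cons; lra.
rewrite v0 add0r in vS.
rewrite mulrC; apply: le_trans (ler_wpM2l (ltW s0) vS).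
apply: (vol_slab_le (M := M)) => //; first exact: ltW.
  by apply: bsetI; [exact: bset_top_cap|exact: measurable_dot_gt].
move=> t y [[ht]]; rewrite /= cons_rV0 dot_cons /= => tM tw.
have tM' : t <= M by have := hM _ ht; rewrite cons_rV0.
split; first by rewrite tM' ltW.
apply: (shadowP hr ht tM); rewrite /b.
have : `|w ord0 ord0 * (M - t)| <= `|w ord0 ord0| * s.
  by rewrite normrM ler_wpM2l // ger0_norm ?subr_ge0 //; lra.
by rewrite ler_norml => /andP[k1 k2]; lra.
Qed.

End caps.

(** * The Brunn-Minkowski inequality *)

Section brunn_minkowski.
Context (R : realType).

Lemma measurable_tl n : measurable_fun setT (@tl R n).
Proof. by apply: measurable_fun_rVP => i; under eq_fun do rewrite mxE; exact: measurable_coordR. Qed.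

(** Fubini on the region under the graph of [f]. The condition [0 <= r] in the level sets lets [r]
    range over the whole line. *)
Lemma layer_cake n (f : 'rV[R]_n -> R) : nice f -> (forall x, 0 <= f x) ->
  nice1 (fun r => vol [set y | 0 <= r < f y]) /\ In f = I1 (fun r => vol [set y | 0 <= r < f y]).
Proof.
move=> nf f0; have [mf [r [c hc]]] := nf.
pose S := [set x : 'rV[R]_n.+1 | 0 <= x ord0 ord0 < f (tl x)].
have bS : bset S.
  split.
    have m1 : measurable_fun setT (fun x : 'rV[R]_n.+1 => f (tl x)).
      by apply: measurableT_comp => //; exact: measurable_tl.
    have m2 := @measurable_coordR R n.+1 (ord0 : 'I_n.+1).
    have m3 := measurable_funB m1 m2.
    rewrite (_ : S = (fun x : 'rV[R]_n.+1 => x ord0 ord0) @^-1` `[0, +oo[%classic `&`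
        (fun x => f (tl x) - x ord0 ord0) @^-1` `]0, +oo[%classic).
      apply: measurableI.
        by have := m2 measurableT _ (measurable_itv `[0, +oo[); rewrite setTI.
      by have := m3 measurableT _ (measurable_itv `]0, +oo[); rewrite setTI.
    apply/seteqP; split => x; rewrite /S /= !in_itv /= !andbT subr_gt0; first by case/andP.
    by move=> [-> ->].
  exists (Num.max r c) => x /andP[x0 xf] i; rewrite le_max.
  have fx : f (tl x) != 0 by rewrite gt_eqF // (le_lt_trans x0).
  case: (unliftP ord0 i) => [j ->|->]; first by have := (hc _).2 fx j; rewrite mxE => ->.
  rewrite ger0_norm //; apply/orP; right; apply: (le_trans (ltW xf)).
  by apply: le_trans (hc (tl x)).1; exact: ler_norm.
have nS := nice_indic bS.
have e t y : (\1_S (cons_rV (t, y)) : R) = \1_[set y | 0 <= t < f y] y.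
  rewrite !indicE; congr ((nat_of_bool _)%:R); apply/idP/idP; rewrite !inE /S /= cons_rV0 tl_cons //.
split.
  have := nice_consI1 nS; congr nice1; apply/funext => t.
  by congr In; apply/funext => y; rewrite e.
transitivity (In (\1_S : 'rV[R]_n.+1 -> R)); last first.
  rewrite (nice_consC nS); congr I1; apply/funext => t.
  by congr In; apply/funext => y; rewrite e.
rewrite (nice_consD nS); congr In; apply/funext => y.
rewrite (_ : (fun t => _) = (\1_(`[0, f y[%classic) : R -> R)); last first.
  by apply/funext => t; rewrite e !indicE; congr ((nat_of_bool _)%:R); apply/idP/idP; rewrite !inE /= in_itv.
rewrite /I1 /Rintegral integral_indic //= setIT lebesgue_measure_itv /= lte_fin.
by have := f0 y; rewrite le_eqVlt => /predU1P[<-|->]; rewrite ?ltxx // -EFinB subr0.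
Qed.

Lemma nice1_rV1 (f : R -> R) : nice1 f ->
  nice (fun z : 'rV[R]_1 => f (z ord0 ord0)) /\ In (fun z : 'rV[R]_1 => f (z ord0 ord0)) = I1 f.
Proof.
move=> [mf [r [c hc]]].
have n1 : nice (fun z : 'rV[R]_1 => f (z ord0 ord0)).
  split; first by apply: (measurableT_comp mf); exact: measurable_coord_rV.
  exists r, c => x; split; first exact: (hc _).1.
  by move=> /(hc _).2 h i; rewrite (ord1 i).
split => //; rewrite (nice_consC n1); congr I1; apply/funext => t.
by rewrite In_0dim ?cons_rV0 //; apply: (nice_cons2 (f := fun z => f (z ord0 ord0))).
Qed.

Lemma vol_setT0 : vol [set: 'rV[R]_0] = 1.
Proof.
rewrite /vol In_0dim; first by rewrite indicT.
by apply: nice_indic; split => //; exists 0 => x _ [].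
Qed.

Lemma bset_halfline n (X : set 'rV[R]_n.+1) (c : R) : bset X ->
  [/\ bset (X `&` [set x | x ord0 ord0 <= c]), bset (X `&` [set x | c <= x ord0 ord0]),
      measurable [set x : 'rV[R]_n.+1 | x ord0 ord0 <= c] & measurable [set x : 'rV[R]_n.+1 | c <= x ord0 ord0]].
Proof.
move=> bX.
have m1 : measurable [set x : 'rV[R]_n.+1 | x ord0 ord0 <= c].
  have := measurable_coordR (ord0 : 'I_n.+1) measurableT (measurable_itv `]-oo, c]).
  by rewrite setTI; congr measurable; apply/seteqP; split => x /=; rewrite in_itv.
have m2 : measurable [set x : 'rV[R]_n.+1 | c <= x ord0 ord0].
  have := measurable_coordR (ord0 : 'I_n.+1) measurableT (measurable_itv `[c, +oo[).
  by rewrite setTI; congr measurable; apply/seteqP; split => x /=; rewrite in_itv /= andbT.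
by split => //; apply: bsetI.
Qed.

(** The supremum need not belong to [X]; a point of [X] within [e] of it leaves volume at most [e]
    beyond. *)
Lemma cut_top (X : set 'rV[R]_1) (e : R) : bset X -> X !=set0 -> 0 < e ->
  exists2 x, X x & vol X <= vol (X `&` [set z | z ord0 ord0 <= x ord0 ord0]) + e.
Proof.
move=> bX [x0 Xx0] e0; have [_ [r hr]] := bX.
pose S := [set z ord0 ord0 | z in X].
have hS : has_sup S.
  split; first by exists (x0 ord0 ord0), x0.
  by exists r => _ [z Xz <-]; apply: le_trans (hr z Xz ord0); exact: ler_norm.
have [_ [x Xx <-] hx] := sup_adherent e0 hS.
exists x => //.
have [b1 _ m1 _] := bset_halfline (x ord0 ord0) bX.
rewrite (vol_setDI bX m1) lerD2l -[leRHS]mulr1 -vol_setT0.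
apply: (vol_slab_le (M := sup S) (ltW e0)); first exact: bsetD.
  by split => //; exists 0 => y _ [].
move=> t y [h1 /=]; rewrite cons_rV0 /= => /negP; rewrite -ltNge => h2; split => //.
apply/andP; split; first by apply: ltW; apply: lt_trans h2.
by apply: sup_upper_bound => //; exists (cons_rV (t, y)) => //; rewrite cons_rV0.
Qed.

Lemma cut_bot (X : set 'rV[R]_1) (e : R) : bset X -> X !=set0 -> 0 < e ->
  exists2 x, X x & vol X <= vol (X `&` [set z | x ord0 ord0 <= z ord0 ord0]) + e.
Proof.
move=> bX [x0 Xx0] e0.
have a0 : -1 != 0 :> R by rewrite oppr_eq0 oner_neq0.
have [bN vN] := vol_aff 0 a0 bX.
have [|x Xx hx] := cut_top bN _ e0.
  by exists (- x0) => /=; rewrite addr0 scaleN1r opprK.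
exists (-1 *: x + 0) => //; rewrite vN normrN1 expr1 mul1r; apply: (le_trans hx).
have [_ b1 _ _] := bset_halfline ((-1 *: x + 0) ord0 ord0) bX.
have [_ ->] := vol_aff 0 a0 b1; rewrite normrN1 expr1 mul1r lerD2r.
rewrite le_eqVlt; apply/orP; left; apply/eqP; congr vol; apply/seteqP; split => z [h1 h2]; split => //.
  by move: h2; rewrite /= !mxE; lra.
by move: h2; rewrite /= !mxE; lra.
Qed.

(** Let [x] be almost the top of [X] and [y] almost the bottom of [Y]. The part of [X] below [x],
    averaged with [y], and the part of [Y] above [y], averaged with [x], lie in [Z] on opposite
    sides of [(x + y) / 2], so their lengths add. *)
Lemma brunn_minkowski1 (X Y Z : set 'rV[R]_1) : bset X -> bset Y -> bset Z ->
  X !=set0 -> Y !=set0 -> (forall x y, X x -> Y y -> Z (2^-1 *: (x + y))) ->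
  vol X + vol Y <= 2 * vol Z.
Proof.
move=> bX bY bZ X0 Y0 h; apply/ler_addgt0Pr => e e0.
have e2 : 0 < e / 2 by rewrite divr_gt0.
have [x Xx hx] := cut_top bX X0 e2.
have [y Yy hy] := cut_bot bY Y0 e2.
have [bX1 _ _ _] := bset_halfline (x ord0 ord0) bX.
have [_ bY1 _ _] := bset_halfline (y ord0 ord0) bY.
have a0 : 2 != 0 :> R by rewrite pnatr_eq0.
have [bZ1 vZ1] := vol_aff (- y) a0 bX1.
have [bZ2 vZ2] := vol_aff (- x) a0 bY1.
rewrite vZ1 normr_nat expr1 in hx; rewrite vZ2 normr_nat expr1 in hy.
move: bZ1 bZ2 hx hy; set Z1 := [set z | (X `&` _) _]; set Z2 := [set z | (Y `&` _) _] => bZ1 bZ2 hx hy.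
have v12 : vol (Z2 `&` Z1) = 0.
  apply: (@vol_hyperplane _ _ (const_mx 1) (2^-1 * (x ord0 ord0 + y ord0 ord0))).
  - by apply/eqP => /rowP /(_ ord0); rewrite !mxE; apply/eqP; exact: oner_neq0.
  - by apply: bsetI => //; case: bZ1.
  move=> z [[_ /= h1] [_ /= h2]]; rewrite /dot big_ord1 mxE mul1r.
  by move: h1 h2; rewrite !mxE => h1 h2; apply: le_anti; apply/andP; split; lra.
have sub : Z1 `|` Z2 `<=` Z.
  move=> z [[h1 _]|[h1 _]].
    by have := h _ _ h1 Yy; rewrite subrK scalerA mulVf // scale1r.
  by have := h _ _ Xx h1; rewrite addrC subrK scalerA mulVf // scale1r.
have := vol_le (bsetU bZ1 bZ2) bZ sub.
have -> : Z1 `|` Z2 = Z1 `|` (Z2 `\` Z1) by rewrite setUDr setDv setD0.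
have mZ1 : measurable Z1 by case: bZ1.
rewrite vol_setU //; last 2 first.
- exact: bsetD.
- by move=> z ? [].
have := vol_setDI bZ2 mZ1; rewrite v12 add0r => <-.
by lra.
Qed.

Lemma nice_sup n (F : 'rV[R]_n -> R) : nice F -> (forall x, 0 <= F x) -> In F != 0 ->
  exists2 a : R, 0 < a & (forall x, F x <= a) /\ (forall r, r < 1 -> exists x, r * a < F x).
Proof.
move=> nF F0 iF; have [_ [r [c hc]]] := nF.
have [x Fx] : exists x, F x != 0.
  apply: contrapT => h; move/eqP: iF; apply.
  rewrite (_ : F = fun=> 0) ?In_0 //; apply/funext => x; apply: contrapT => /eqP Fx.
  by apply: h; exists x.
have hS : has_sup (range F).
  by split; [exists (F x), x|exists c => _ [z _ <-]; apply: le_trans (hc z).1; exact: ler_norm].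
have ub y : F y <= sup (range F) by apply: sup_upper_bound => //; exists y.
have a0 : 0 < sup (range F) by apply: lt_le_trans (ub x); rewrite lt_def Fx F0.
exists (sup (range F)) => //; split => // s s1.
have e0 : 0 < (1 - s) * sup (range F) by rewrite mulr_gt0 // subr_gt0.
have [_ [y _ <-] hy] := sup_adherent e0 hS; exists y.
by move: hy; rewrite mulrBl mul1r opprB addrC subrK.
Qed.

(** After scaling [F] and [G] to supremum 1 and [H] by the geometric mean, the level sets of [F] and
    [G] at each height in [[0, 1[] are nonempty, so [brunn_minkowski1] applies level by level. The
    layer-cake formula adds up the levels. *)
Lemma prekopa_leindler1 (F G H : 'rV[R]_1 -> R) : nice F -> nice G -> nice H ->
  (forall x, 0 <= F x) -> (forall x, 0 <= G x) -> (forall x, 0 <= H x) ->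
  (forall x y, F x * G y <= H (2^-1 *: (x + y)) ^+ 2) ->
  In F * In G <= In H ^+ 2.
Proof.
move=> nF nG nH F0 G0 H0 h.
have [->|iF] := eqVneq (In F) 0; first by rewrite mul0r sqr_ge0.
have [->|iG] := eqVneq (In G) 0; first by rewrite mulr0 sqr_ge0.
have [a a0 [Fa ha]] := nice_sup nF F0 iF.
have [b b0 [Gb hb]] := nice_sup nG G0 iG.
pose c := Num.sqrt (a * b).
have ab0 : 0 < a * b by rewrite mulr_gt0.
have c0 : 0 < c by rewrite sqrtr_gt0.
have cc : c ^+ 2 = a * b by rewrite sqr_sqrtr // ltW.
have sc (f : 'rV[R]_1 -> R) k : nice f -> 0 < k -> (forall x, 0 <= f x) ->
    [/\ nice (fun x => k^-1 * f x), (forall x, 0 <= k^-1 * f x) & In f = k * In (fun x => k^-1 * f x)].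
  move=> nf k0 f0; split; first exact: niceZ.
    by move=> x; rewrite mulr_ge0 // invr_ge0 ltW.
  by rewrite In_Z // mulrA mulfV ?mul1r // gt_eqF.
have [nF' F'0 eF] := sc F a nF a0 F0.
have [nG' G'0 eG] := sc G b nG b0 G0.
have [nH' H'0 eH] := sc H c nH c0 H0.
have key : In (fun x => a^-1 * F x) + In (fun x => b^-1 * G x) <= 2 * In (fun x => c^-1 * H x).
  have [lF ->] := layer_cake nF' F'0; have [lG ->] := layer_cake nG' G'0.
  have [lH ->] := layer_cake nH' H'0.
  have [mF <-] := nice1_rV1 lF; have [mG <-] := nice1_rV1 lG; have [mH <-] := nice1_rV1 lH.
  rewrite -In_D // -In_Z //; apply: In_le; [exact: niceD|exact: niceZ|] => z.
  move: (z ord0 ord0) => r.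
  have bl (f : 'rV[R]_1 -> R) : nice f -> bset [set y | 0 <= r < f y].
    move=> [mf [r' [c' hc]]]; split.
      have [r0|r0] := leP 0 r; last first.
        by rewrite (_ : [set y | _] = set0) //; apply/seteqP; split => // y.
      have := mf measurableT _ (measurable_itv `]r, +oo[); rewrite setTI; congr measurable.
      by apply/seteqP; split => y /=; rewrite in_itv /= andbT.
    by exists r' => y /andP[r0 /(le_lt_trans r0) fy]; apply: (hc y).2; rewrite gt_eqF.
  have [r0|r0] := leP 0 r; last first.
    have E (f : 'rV[R]_1 -> R) : vol [set y | false && (r < f y)] = 0.
      by rewrite (_ : [set y | _] = set0) ?vol_set0 //; apply/seteqP; split.
    by rewrite !E addr0 mulr0.
  have [r1|r1] := leP 1 r.
    have E (f : 'rV[R]_1 -> R) k : 0 < k -> (forall x, f x <= k) -> vol [set y | true && (r < k^-1 * f y)] = 0.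
      move=> k0 fk; rewrite (_ : [set y | _] = set0) ?vol_set0 //; apply/seteqP; split => // y /=.
      rewrite ltNge => /negP; apply; apply: le_trans r1.
      by rewrite mulrC ler_pdivrMr // mul1r.
    by rewrite (E F a a0 Fa) (E G b b0 Gb) addr0 mulr_ge0 // vol_ge0.
  have := bl _ nF'; have := bl _ nG'; have := bl _ nH'; rewrite r0 /= => bH' bG' bF'.
  apply: brunn_minkowski1 => //.
  - by have [x hx] := ha r r1; exists x; rewrite /= mulrC ltr_pdivlMr.
  - by have [x hx] := hb r r1; exists x; rewrite /= mulrC ltr_pdivlMr.
  move=> x y /= hx hy; rewrite mulrC ltr_pdivlMr //.
  rewrite mulrC ltr_pdivlMr // in hx; rewrite mulrC ltr_pdivlMr // in hy.
  rewrite -(ltr_pXn2r (n := 2)) ?nnegrE ?mulr_ge0 ?(ltW c0) //.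
  apply: lt_le_trans (h x y); rewrite exprMn cc.
  rewrite (_ : r ^+ 2 * (a * b) = (r * a) * (r * b)); last by ring.
  by rewrite ltr_pM // mulr_ge0 // ltW.
rewrite eF eG eH exprMn cc mulrACA ler_pM2l //.
have := In_ge0 F'0; have := In_ge0 G'0; have := In_ge0 H'0.
move: key; set f := In _; set g := In _; set k := In _ => *.
have : (f + g) ^+ 2 <= (2 * k) ^+ 2 by rewrite ler_pXn2r ?nnegrE ?addr_ge0 ?mulr_ge0.
(* The arithmetic-geometric mean inequality turns the bound on the sum into one on the product. *)
have := sqr_ge0 (f - g); rewrite !expr2; nra.
Qed.

Lemma bset_section n (P : set 'rV[R]_n.+1) (t : R) : bset P -> bset [set y | P (cons_rV (t, y))].
Proof.
move=> [mP [r hr]]; split.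
  have mc : measurable_fun setT (fun y : 'rV[R]_n => cons_rV (t, y)).
    apply: measurable_fun_rVP => i; case: (unliftP ord0 i) => [j ->|->].
      by under eq_fun do rewrite cons_rVS /=; exact: measurable_coordR.
    by under eq_fun do rewrite cons_rV0 /=; exact: measurable_cst.
  by have := mc measurableT _ mP; rewrite setTI.
by exists r => y /hr h i; have := h (lift ord0 i); rewrite cons_rVS.
Qed.

(** Induction on the dimension: the induction hypothesis for sections is the assumption of
    [prekopa_leindler1] for the volumes of the sections. The product form is what makes this
    induction close. *)
Lemma brunn_minkowski n (P Q H : set 'rV[R]_n) : bset P -> bset Q -> bset H ->
  (forall x y, P x -> Q y -> H (2^-1 *: (x + y))) -> vol P * vol Q <= vol H ^+ 2.
Proof.
elim: n P Q H => [|n IH] P Q H bP bQ bH h.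
  rewrite /vol !In_0dim ?indicE; [|exact: nice_indic..].
  case: (boolP (0 \in P)) => P0; last by rewrite mul0r sqr_ge0.
  case: (boolP (0 \in Q)) => Q0; last by rewrite mulr0 sqr_ge0.
  rewrite mem_set ?expr1n ?mulr1 //; rewrite !inE in P0 Q0.
  by have := h _ _ P0 Q0; congr H; apply/rowP; case.
have E (X : set 'rV[R]_n.+1) : bset X ->
    [/\ nice (fun z : 'rV[R]_1 => vol [set y | X (cons_rV (z ord0 ord0, y))]) &
     vol X = In (fun z : 'rV[R]_1 => vol [set y | X (cons_rV (z ord0 ord0, y))])].
  move=> bX; have nX := nice_indic bX.
  have e t : In (fun y => \1_X (cons_rV (t, y))) = vol [set y | X (cons_rV (t, y))].
    by congr In; apply/funext => y; rewrite !indicE; congr ((nat_of_bool _)%:R).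
  have [n1 n2] := nice1_rV1 (nice_consI1 nX).
  split; first by move: n1; congr nice; apply/funext => z; rewrite e.
  rewrite {1}/vol (nice_consC nX) -n2; congr In; apply/funext => z; by rewrite e.
have [nP ->] := E P bP; have [nQ ->] := E Q bQ; have [nH ->] := E H bH.
apply: prekopa_leindler1 => // [x|x|x|x y]; try exact: vol_ge0.
apply: IH; [exact: bset_section..|] => u v hu hv.
have := h _ _ hu hv; rewrite cons_rVD cons_rVZ /=; congr (H (cons_rV (_, _))).
by rewrite !mxE.
Qed.

End brunn_minkowski.

(** * The equality case for the half-difference body *)

Section tails.
Context (R : realType) (n : nat).
Implicit Types (P K : set 'rV[R]_n.+1) (l : 'rV[R]_n.+1).

Definition tail P l (c : R) := vol (P `&` [set x | c < dot l x]).

Definition convexP P := forall x y (t : R), 0 <= t <= 1 -> P x -> P y -> P ((1 - t) *: x + t *: y).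

Lemma bset_tail P l c : bset P -> bset (P `&` [set x | c < dot l x]).
Proof. by move=> bP; apply: bsetI => //; exact: measurable_dot_gt. Qed.

Lemma tail_noninc P l c1 c2 : bset P -> c1 <= c2 -> tail P l c2 <= tail P l c1.
Proof.
move=> bP c12; apply: vol_le; [exact: bset_tail..|] => x [Px /= h]; split => //=.
exact: le_lt_trans h.
Qed.

Lemma tail_le P l c : bset P -> tail P l c <= vol P.
Proof. by move=> bP; apply: vol_le => //; exact: bset_tail. Qed.

Lemma tail_ge0 P l c : 0 <= tail P l c.
Proof. exact: vol_ge0. Qed.

Lemma tail_lip P l : bset P -> l != 0 -> exists2 C : R, 0 <= C & forall c1 c2, c1 <= c2 ->
  tail P l c1 <= tail P l c2 + C * (c2 - c1).
Proof.
move=> bP l0; have [G uG [c c0 [dG hG]]] := dir_coord l0.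
have [bP' _] := vol_mulmx uG hG bP; have [_ [r hr]] := bP'.
exists (c^-1 * vol (@box R n r)); first by rewrite mulr_ge0 ?invr_ge0 ?(ltW c0) // vol_ge0.
move=> c1 c2 c12.
have m2 := measurable_dot_gt l c2.
rewrite {1}/tail (vol_setDI (bset_tail l c1 bP) m2); apply: lerD.
  by apply: vol_le; [exact: bsetI (bset_tail l c1 bP) m2|exact: bset_tail|move=> x [[? _] ?]].
have bD := bsetD (bset_tail l c1 bP) m2.
have [bD' vD'] := vol_mulmx uG hG bD.
rewrite -mulrA ler_pdivlMl // -vD' mulrC.
apply: (vol_slab_le (M := c2)) => //; first by rewrite subr_ge0.
  split; [exact: measurable_box|exists r => x h i].
  by have := h i; rewrite /= in_itv /= ler_norml.
move=> t y [[h1 /= h2] /negP]; rewrite -leNgt dG cons_rV0 /= => h3.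
rewrite dG cons_rV0 /= in h2; split; first by apply/andP; split => //; lra.
move=> i; have := hr _ h1 (lift ord0 i); rewrite cons_rVS /= in_itv /=.
by rewrite ler_norml.
Qed.

Lemma vol_compl_tail P l c : bset P -> l != 0 ->
  vol (P `&` [set x | dot l x < c]) = vol P - tail P l c.
Proof.
move=> bP l0; have m1 := measurable_dot_gt l c.
rewrite (vol_setDI bP m1) -/(tail P l c) addrAC subrr add0r.
have m2 : measurable [set x | dot l x < c].
  rewrite (_ : [set x | _] = [set x | - c < dot (- l) x]); first exact: measurable_dot_gt.
  by apply/seteqP; split => x; rewrite /= dotNl ltrN2.
rewrite (vol_setDI (bsetD bP m1) m2).
rewrite [X in _ + X](_ : _ = 0) ?addr0.
  congr vol; apply/seteqP; split => x [h1 /= h2].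
    by do !split => //=; apply/negP; rewrite -leNgt ltW.
  by split => //; case: h1.
apply: (vol_hyperplane (c := c) l0); first by do 2 apply: bsetD => //.
move=> x [[_ /= /negP h1] /negP h2]; rewrite -leNgt in h1; rewrite -leNgt in h2.
by apply: le_anti; rewrite h1 h2.
Qed.

Lemma vol_homothety P x (t : R) : bset P -> 0 < t ->
  bset [set y | P (t^-1 *: (y - x) + x)] /\ vol [set y | P (t^-1 *: (y - x) + x)] = t ^+ n.+1 * vol P.
Proof.
move=> bP t0; have t1 : t^-1 != 0 by rewrite invr_eq0 gt_eqF.
have [b1 v1] := vol_aff (x - t^-1 *: x) t1 bP.
have e : [set y | P (t^-1 *: y + (x - t^-1 *: x))] = [set y | P (t^-1 *: (y - x) + x)].
  by apply/seteqP; split => y; rewrite /= scalerBr addrA addrAC.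
rewrite -e; split => //; rewrite v1 mulrA -exprMn ger0_norm ?invr_ge0 ?ltW //.
by rewrite mulfV ?gt_eqF // expr1n mul1r.
Qed.

Lemma homothety_eq (x y : 'rV[R]_n.+1) (t : R) : t != 0 ->
  y = (1 - t) *: x + t *: (t^-1 *: (y - x) + x).
Proof. by move=> t0; apply/rowP => i; rewrite !mxE; field. Qed.

(** A copy of [P] contracted towards [x] stays in [P] by convexity and, for a small ratio, inside
    the slab. *)
Lemma vol_slab_gt0 P l c1 c2 x : bset P -> convexP P -> 0 < vol P -> P x ->
  c1 < dot l x < c2 -> 0 < vol (P `&` [set y | c1 < dot l y] `&` [set y | dot l y <= c2]).
Proof.
move=> bP cP vP Px /andP[h1 h2]; have [_ [r hr]] := bP.
pose B := 1 + \sum_i `|l ord0 i| * (2 * `|r|).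
have B0 : 0 < B.
  by rewrite /B ltr_pwDl // sumr_ge0 // => i _; rewrite !mulr_ge0.
have hB y : P y -> `|dot l (y - x)| < B.
  move=> Py; rewrite /B /dot ltr_pwDl //; apply: (le_trans (ler_norm_sum _ _ _)).
  apply: ler_sum => i _; rewrite normrM ler_wpM2l // !mxE.
  apply: (le_trans (ler_normB _ _)); have := hr _ Py i; have := hr _ Px i; have := ler_norm r; lra.
pose e := Num.min (dot l x - c1) (c2 - dot l x).
have e0 : 0 < e by rewrite lt_min !subr_gt0 h1 h2.
pose t := Num.min 1 (e / B).
have t0 : 0 < t by rewrite lt_min ltr01 divr_gt0.
have t1 : t <= 1 by rewrite ge_min lexx.
have tB : t * B <= e by rewrite -ler_pdivlMr // /t ge_min lexx orbT.
have [bH vH] := vol_homothety x bP t0.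
apply: (@lt_le_trans _ _ (t ^+ n.+1 * vol P)); first by rewrite mulr_gt0 // exprn_gt0.
rewrite -vH; apply: vol_le => //.
  by apply: bsetI (bset_tail l c1 bP) _; exact: measurable_dot_le.
move=> y /= hy; set z := _ + x in hy.
have yz : y = (1 - t) *: x + t *: z.
  by apply: homothety_eq; rewrite gt_eqF.
have dy : dot l y = dot l x + t * dot l (z - x).
  rewrite yz dotBr dotDr !dotZr; ring.
have : `|t * dot l (z - x)| < e.
  by rewrite normrM gtr0_norm //; apply: lt_le_trans tB; rewrite ltr_pM2l // hB.
rewrite ltr_norml lt_min => /andP[k1 /[dup] k2 _].
have e1 : e <= dot l x - c1 by rewrite ge_min lexx.
have e2 : e <= c2 - dot l x by rewrite ge_min lexx orbT.
have k3 : t * dot l (z - x) < e by rewrite lt_min.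
split; first split; rewrite /=.
- by rewrite yz; apply: cP => //; rewrite (ltW t0) t1.
- by rewrite dy; lra.
- by rewrite dy; lra.
Qed.

Lemma vol_gt0_point P : 0 < vol P -> exists x, P x.
Proof.
move=> vP; apply: contrapT => h; move: vP; rewrite (_ : P = set0) ?vol_set0 ?ltxx //.
by apply/seteqP; split => // x Px; apply: h; exists x.
Qed.

(** Volume beyond [c1] and volume below [c2] give, by convexity, a point of [P] strictly between the
    two levels; [vol_slab_gt0] does the rest. *)
Lemma tail_strict P l c1 c2 : bset P -> convexP P -> l != 0 -> c1 < c2 ->
  0 < tail P l c1 -> tail P l c2 < vol P -> tail P l c2 < tail P l c1.
Proof.
move=> bP cP l0 c12 t1 t2.
have vP : 0 < vol P by apply: lt_le_trans t1 _; exact: tail_le.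
have [x [Px /= hx]] := vol_gt0_point t1.
have [y [Py /= hy]] : exists y, P y /\ dot l y < c2.
  have /vol_gt0_point [y [h1 h2]] : 0 < vol (P `&` [set x | dot l x < c2]).
    by rewrite vol_compl_tail // subr_gt0.
  by exists y.
have [z Pz hz] : exists2 z, P z & c1 < dot l z < c2.
  have [h|h] := ltP (dot l x) c2; first by exists x; rewrite ?hx.
  have [h'|h'] := ltP c1 (dot l y); first by exists y; rewrite ?h'.
  have d0 : 0 < dot l x - dot l y by lra.
  pose t := ((c1 + c2) / 2 - dot l y) / (dot l x - dot l y).
  exists ((1 - t) *: y + t *: x).
    apply: cP => //; apply/andP; split; first by rewrite divr_ge0 //; lra.
    by rewrite ler_pdivrMr // mul1r; lra.
  rewrite dotDr !dotZr (_ : _ + _ = (c1 + c2) / 2); first by apply/andP; split; lra.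
  by rewrite /t; field; lra.
have h := vol_slab_gt0 bP cP vP Pz hz.
have m2 := measurable_dot_gt l c2.
rewrite [ltRHS]/tail (vol_setDI (bset_tail l c1 bP) m2).
have -> : P `&` [set x | c1 < dot l x] `&` [set x | c2 < dot l x] = P `&` [set x | c2 < dot l x].
  apply/seteqP; split => u; first by move=> [[? _] ?].
  by move=> [? /= k]; do !split => //=; exact: lt_trans k.
rewrite ltrDl; move: h; congr (_ < vol _); apply/seteqP; split => u [k1 /= k2]; split => //=.
  by apply/negP; rewrite -leNgt.
by rewrite leNgt; apply/negP.
Qed.

Lemma dot_bounded P l : bset P -> exists2 B : R, 0 < B & forall x, P x -> `|dot l x| < B.
Proof.
move=> [_ [r hr]]; exists (1 + \sum_i `|l ord0 i| * `|r|).
  by rewrite ltr_pwDl // sumr_ge0 // => i _; rewrite mulr_ge0.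
move=> x Px; rewrite ltr_pwDl //; apply: (le_trans (ler_norm_sum _ _ _)).
apply: ler_sum => i _; rewrite normrM ler_wpM2l //; apply: (le_trans (hr _ Px i)); exact: ler_norm.
Qed.

(** The tail is Lipschitz and falls from [vol P] to 0, so the intermediate value theorem applies. *)
Lemma tail_hit P l (m : R) : bset P -> l != 0 -> 0 <= m <= vol P -> exists c, tail P l c = m.
Proof.
move=> bP l0 /andP[m0 mV]; have [B B0 hB] := dot_bounded l bP.
have [C C0 hC] := tail_lip bP l0.
have tB : tail P l B = 0.
  rewrite /tail (_ : _ `&` _ = set0) ?vol_set0 //; apply/seteqP; split => // x [Px /=].
  by move/(le_lt_trans (ler_norm _)): (hB _ Px) => h /(lt_trans h); rewrite ltxx.
have tNB : tail P l (- B) = vol P.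
  rewrite /tail (_ : _ `&` _ = P) //; apply/seteqP; split => x; first by case.
  by move=> Px; split => //=; have := hB _ Px; rewrite ltr_norml => /andP[].
have hL (u v : R) : `|tail P l u - tail P l v| <= C * `|u - v|.
  have [le|le] := leP u v.
    rewrite [`|u - v|]ler0_norm ?subr_le0 // opprB ger0_norm ?subr_ge0 ?tail_noninc //.
    by have := hC _ _ le; lra.
  have le' := ltW le.
  rewrite [`|u - v|]ger0_norm ?subr_ge0 // ler0_norm ?subr_le0 ?tail_noninc // opprB.
  by have := hC _ _ le'; lra.
have ct : continuous (tail P l).
  move=> x; apply/cvgrPdist_le => e e0.
  have C1 : 0 < C + 1 by lra.
  have d0 : 0 < e / (C + 1) by exact: divr_gt0.
  near=> y.
  have xy : `|x - y| <= e / (C + 1) by near: y; move/cvgrPdist_le : (@cvg_id _ (nbhs x)) => /(_ _ d0).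
  apply: (le_trans (hL _ _)); apply: (@le_trans _ _ (C * (e / (C + 1)))); first by rewrite ler_wpM2l.
  rewrite mulrCA; apply: ler_piMr; first exact: ltW.
  by rewrite ler_pdivrMr // mul1r; lra.
have nBB : - B <= B by lra.
have [||c _ hc] := @IVT _ (tail P l) (- B) B m nBB.
- exact: continuous_subspaceT.
- by rewrite tB tNB ge_min le_max m0 mV orbT.
by exists c.
Unshelve. all: by end_near. Qed.

Lemma tail_lt P l c1 c2 : bset P -> tail P l c1 < tail P l c2 -> c2 < c1.
Proof. by move=> bP; apply: contraTT; rewrite -!leNgt; exact: tail_noninc. Qed.

Section half_difference.
Variables (P K : set 'rV[R]_n.+1).
Hypotheses (bP : bset P) (cP : convexP P) (vP : 0 < vol P) (bK : bset K)
  (PK : forall x y, P x -> P y -> K (2^-1 *: (x - y))) (vK : vol K <= vol P).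

Lemma vol_neg (E : set 'rV[R]_n.+1) : bset E -> bset [set x | E (- x)] /\ vol [set x | E (- x)] = vol E.
Proof.
move=> bE; have N1 : (-1 : R) != 0 by rewrite oppr_eq0 oner_eq0.
have [b1 ->] := vol_aff 0 N1 bE; rewrite normrN1 expr1n mul1r.
have e : [set x | E (- x)] = [set x | E (-1 *: x + 0)].
  by apply/seteqP; split => x; rewrite /= scaleN1r addr0.
by rewrite e.
Qed.

Lemma measurable_dot_lt (l : 'rV[R]_n.+1) (c : R) : measurable [set x | dot l x < c].
Proof.
rewrite (_ : [set x | _] = [set x | - c < dot (- l) x]); first exact: measurable_dot_gt.
by apply/seteqP; split => x; rewrite /= dotNl ltrN2.
Qed.

(** Brunn-Minkowski for the part of [P] beyond [a] and the reflection of the part below [b]: their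
    half sums lie in [K] beyond [(a - b) / 2]. The next lemma treats the complementary parts. *)
Lemma half_difference_upper l a b : l != 0 ->
  tail P l a * (vol P - tail P l b) <= tail K l ((a - b) / 2) ^+ 2.
Proof.
move=> l0; rewrite -vol_compl_tail //.
have bb : bset (P `&` [set x | dot l x < b]) by apply: bsetI => //; exact: measurable_dot_lt.
have [b1 <-] := vol_neg bb.
apply: brunn_minkowski => //; [exact: bset_tail|exact: bset_tail|].
move=> x y [Px /= hx] [Py]; rewrite /= dotNr => hy; split.
  by rewrite -[y]opprK; exact: PK.
by rewrite /= dotZr dotDr; lra.
Qed.

Lemma half_difference_lower l a b : l != 0 ->
  (vol P - tail P l a) * tail P l b <= (vol K - tail K l ((a - b) / 2)) ^+ 2.
Proof.
move=> l0; rewrite -!vol_compl_tail //.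
have bb := bset_tail l b bP.
have ba : bset (P `&` [set x | dot l x < a]) by apply: bsetI => //; exact: measurable_dot_lt.
have [b1 v1] := vol_neg bb; rewrite /tail -v1.
apply: brunn_minkowski => //.
  by apply: bsetI => //; exact: measurable_dot_lt.
move=> x y [Px /= hx] [Py]; rewrite /= dotNr => hy; split.
  by rewrite -[y]opprK; exact: PK.
by rewrite /= dotZr dotDr; lra.
Qed.

(** For these levels both products are squares, so the tail of [K] is at least [m] and its
    complement at least [vol P - m]. As [vol K <= vol P], there is no room for strict inequality. *)
Lemma half_difference_quantile l (a b m : R) : l != 0 -> 0 <= m <= vol P ->
  tail P l a = m -> tail P l b = vol P - m -> tail K l ((a - b) / 2) = m.
Proof.
move=> l0 /andP[m0 mV] ea eb; have := half_difference_upper a b l0; have := half_difference_lower a b l0.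
rewrite ea eb opprB addrCA subrr addr0 -!expr2.
have S0 := tail_ge0 K l ((a - b) / 2); have SU := tail_le l ((a - b) / 2) bK.
rewrite !ler_sqr ?nnegrE ?subr_ge0 // => h1 h2.
by apply: le_anti; rewrite h2 andbT; move: vK h1; lra.
Qed.

Section direction.
Variable (l : 'rV[R]_n.+1).
Hypothesis l0 : l != 0.
Let V := vol P.
Let T := tail P l.

(* [T (A x) = 1/x] and [T (B x) = V - 1/x]: in the variable [x = 1/m] the
   strict log-convexity needed below holds along arithmetic progressions. *)
Let A (x : R) := xget 0 [set c | T c = x^-1].
Let B (x : R) := xget 0 [set c | T c = V - x^-1].

Let inV x : V^-1 < x -> 0 < x^-1 < V.
Proof.
move=> h; have x0 : 0 < x by apply: lt_trans h; rewrite invr_gt0.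
by rewrite invr_gt0 x0 /= -[V]invrK ltf_pV2 // posrE invr_gt0.
Qed.

Let AE x : V^-1 < x -> T (A x) = x^-1.
Proof.
move=> /inV /andP[h1 h2]; rewrite /A; case: xgetP => [? _ //|h].
by have [|c hc] := @tail_hit P l x^-1 bP l0; [rewrite !ltW|case: (h c)].
Qed.

Let BE x : V^-1 < x -> T (B x) = V - x^-1.
Proof.
move=> /inV /andP[h1 h2]; rewrite /B; case: xgetP => [? _ //|h].
have [|c hc] := @tail_hit P l (V - x^-1) bP l0; last by case: (h c).
by rewrite subr_ge0 ltW //= lerBlDr lerDl ltW.
Qed.

(** Otherwise the tail of [K] at [(A x - B z) / 2] is at most [1 / y], while [half_difference_upper]
    bounds its square below by [1 / (x z)]; but [x z < y ^ 2] for the midpoint [y] of distinct [x]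
    and [z]. *)
Let AB_le x z : V^-1 < x -> V^-1 < z -> x != z ->
  A x - B z <= A ((x + z) / 2) - B ((x + z) / 2).
Proof.
move=> hx hz xz; set y := (x + z) / 2.
have hy : V^-1 < y by rewrite /y; lra.
have /andP[x0 _] := inV hx; have /andP[z0 _] := inV hz; have /andP[y0 yV] := inV hy.
rewrite leNgt; apply/negP => h.
have e : tail K l ((A y - B y) / 2) = y^-1.
  by apply: half_difference_quantile => //; [rewrite !ltW|exact: AE|exact: BE].
have h2 : tail K l ((A x - B z) / 2) <= y^-1 by rewrite -e; apply: tail_noninc => //; lra.
have := half_difference_upper (A x) (B z) l0; rewrite -/T AE // BE // opprB addrCA subrr addr0.
apply/negP; rewrite -ltNge; apply: (@le_lt_trans _ _ (y^-1 ^+ 2)).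
  by rewrite ler_sqr ?nnegrE ?tail_ge0 // ltW.
rewrite exprVn -invfM ltf_pV2 ?posrE.
- rewrite /y -subr_gt0 (_ : _ - _ = ((x - z) / 2) ^+ 2); last by field.
  by rewrite exprn_even_gt0 //= mulf_neq0 ?invr_eq0 ?subr_eq0.
- by rewrite exprn_gt0 // -invr_gt0.
- by rewrite -invr_gt0 invfM mulr_gt0.
Qed.

(** The tail is strictly monotone around the level [V - 1/x], so its values at [B x - e] and
    [B x + e] enclose that level and all nearby ones. *)
Let B_cont x e : V^-1 < x -> 0 < e -> exists2 d : R, 0 < d & forall x', `|x' - x| <= d ->
  V^-1 < x' /\ `|B x' - B x| <= e.
Proof.
move=> hx e0; have /andP[x0 xV] := inV hx; have eB := BE hx.
have xp : 0 < x by rewrite -invr_gt0.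
have t1 : T (B x) < T (B x - e).
  apply: tail_strict => //; [by lra| |by rewrite -/T eB -/V; lra].
  by apply: (@lt_le_trans _ _ (T (B x))); [rewrite eB subr_gt0|apply: tail_noninc => //; lra].
have t2 : T (B x + e) < T (B x).
  apply: tail_strict => //; [by lra|by rewrite -/T eB subr_gt0|].
  by apply: (@le_lt_trans _ _ (T (B x))); [apply: tail_noninc => //; lra|rewrite -/T eB -/V; lra].
have q1 : V - T (B x - e) < x^-1 by move: t1; rewrite eB; lra.
have q2 : x^-1 < V - T (B x + e) by move: t2; rewrite eB; lra.
have q1' : 0 <= V - T (B x - e) by rewrite subr_ge0; exact: tail_le.
pose w1 := (V - T (B x - e) + x^-1) / 2.
have w10 : 0 < w1 by rewrite /w1; lra.
have w1x : w1 < x^-1 by rewrite /w1; lra.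
pose w2 := V - T (B x + e).
have w2V : w2 <= V by rewrite /w2 lerBlDr lerDl tail_ge0.
have w20 : 0 < w2 by exact: lt_trans q2.
have i1 : x < w1^-1 by rewrite -[x]invrK ltf_pV2 // posrE.
have i2 : w2^-1 < x by rewrite -[x]invrK ltf_pV2 ?posrE //.
have i3 : V^-1 <= w2^-1 by rewrite lef_pV2 ?posrE.
exists (Num.min ((w1^-1 - x) / 2) ((x - w2^-1) / 2)).
  by rewrite lt_min; apply/andP; split; lra.
move=> x'; rewrite ler_norml le_min => /andP[]; rewrite lerNl le_min => /andP[_ k1] /andP[k2 _].
have k3 : w2^-1 < x' by lra.
have k4 : x' < w1^-1 by lra.
have hx' : V^-1 < x' by exact: le_lt_trans k3.
have xp' : 0 < x' by apply: lt_trans k3; rewrite invr_gt0.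
split => //; have eB' := BE hx'.
rewrite ler_norml; apply/andP; split.
  rewrite lerBrDl; apply/ltW/(tail_lt bP (l := l)); rewrite -/T eB'.
  have : w1 < x'^-1 by rewrite -[w1]invrK ltf_pV2 // posrE invr_gt0.
  by rewrite /w1; lra.
rewrite lerBlDl; apply/ltW/(tail_lt bP (l := l)); rewrite -/T eB'.
have : x'^-1 < w2 by rewrite -[w2]invrK ltf_pV2 // posrE invr_gt0.
by rewrite /w2; lra.
Qed.

(** Along an arithmetic progression [AB_le] for the neighbours of a term says that
    [A (u i) + B (u (i + 1))] does not decrease with [i]. Telescoping from [x] to [x'] leaves only
    the offset of [B] by one step, removed by continuity. Either sign of the step is allowed, so
    [A + B] is constant. *)
Let AB_noninc x x' : V^-1 < x -> V^-1 < x' -> A x + B x <= A x' + B x'.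
Proof.
move=> hx hx'; have [->//|xx] := eqVneq x x'.
apply/ler_addgt0Pr => e e0; have e2 : 0 < e / 2 by lra.
have [d1 d10 h1] := B_cont hx e2; have [d2 d20 h2] := B_cont hx' e2.
pose d := Num.min d1 d2; have d0 : 0 < d by rewrite lt_min d10.
(* Enough steps for the increment [b] to have size at most [d], within which [B] moves by at most
   [e / 2] at either end. *)
pose N := (Num.truncn (`|x' - x| / d)).+1.
have N0 : 0 < N%:R :> R by rewrite ltr0n.
pose b := (x' - x) / N%:R.
have bd : `|b| <= d.
  rewrite normrM normfV (ger0_norm (ltW N0)) ler_pdivrMr // mulrC -ler_pdivrMr //.
  by rewrite ltW // truncnS_gt.
have b0 : b != 0 by apply: mulf_neq0; [rewrite subr_eq0 eq_sym|rewrite invr_eq0 gt_eqF].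
pose u i := x + i%:R * b.
have uN : u N = x' by rewrite /u /b mulrCA mulfV ?gt_eqF // mulr1 addrC subrK.
have [hd1 hd2] : d <= d1 /\ d <= d2 by rewrite !ge_min !lexx orbT.
have [|v1 f1] := h1 (u 1%N).
  by apply: le_trans hd1; rewrite /u mul1r addrAC subrr add0r.
have [|v2 f2] := h2 (u N.+1).
  by apply: le_trans hd2; rewrite -uN /u -natr1; rewrite (_ : _ - _ = b) //; ring.
have hu i : (i <= N.+1)%N -> V^-1 < u i.
  move=> iN; pose t : R := i%:R / N.+1%:R.
  have n1 : 0 < N.+1%:R :> R by rewrite ltr0n.
  have t0 : 0 <= t by rewrite divr_ge0.
  have t1 : t <= 1 by rewrite ler_pdivrMr // mul1r ler_nat.
  have -> : u i = (1 - t) * x + t * u N.+1.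
    by rewrite /u /t; field; rewrite gt_eqF //= -natr1 in n1 *; lra.
  have w0 : V^-1 < Num.min x (u N.+1) by rewrite lt_min hx.
  apply: (lt_le_trans w0); set w := Num.min _ _.
  have w1 : w <= x by rewrite ge_min lexx.
  have w2 : w <= u N.+1 by rewrite ge_min lexx orbT.
  have := mulr_ge0 t0 (_ : 0 <= u N.+1 - w); rewrite subr_ge0 => /(_ w2).
  have := mulr_ge0 (_ : 0 <= 1 - t) (_ : 0 <= x - w); rewrite !subr_ge0 => /(_ t1 w1); lra.
have step i : (i < N)%N -> A (u i) + B (u i.+1) <= A (u i.+1) + B (u i.+2).
  move=> iN; have := @AB_le (u i) (u i.+2) (hu _ _) (hu _ _).
  rewrite (_ : (u i + u i.+2) / 2 = u i.+1); last by rewrite /u -!natr1; field.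
  move=> h; suff : A (u i) - B (u i.+2) <= A (u i.+1) - B (u i.+1) by lra.
  apply: h; [exact: (leqW (ltnW iN))|by []|].
  rewrite -subr_eq0 /u -!natr1 (_ : _ - _ = - 2 * b); last by ring.
  by rewrite mulf_neq0 // oppr_eq0 pnatr_eq0.
have tele i : (i <= N)%N -> A (u 0%N) + B (u 1%N) <= A (u i) + B (u i.+1).
  elim: i => [//|i IH] iN; exact: le_trans (IH (ltnW iN)) (step _ iN).
have := tele N (leqnn _); rewrite uN.
have -> : u 0%N = x by rewrite /u mul0r addr0.
by move: f1 f2; rewrite !ler_norml; lra.
Qed.

(** The constant value [k] of [A + B]. Strict monotonicity identifies [t] with [A (1 / T t)], and
    [k - t] is then the corresponding [B]. *)
Let tail_reflect_strict : exists k : R,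
  (forall t : R, 0 < T t < V -> T (k - t) = V - T t) /\
  (exists t : R, 0 < T t < V).
Proof.
pose x := 2 / V; have hx : V^-1 < x.
  by rewrite /x -[ltLHS]mul1r ltr_pM2r ?invr_gt0 // ltrDl.
exists (A x + B x); split; last by exists (A x); rewrite AE // inV.
move=> t /andP[t0 tV]; pose y := (T t)^-1.
have hy : V^-1 < y by rewrite ltf_pV2 // posrE.
have eA : A y = t.
  have := AE hy; rewrite invrK => e.
  have [h|h|//] := ltgtP (A y) t.
    by have := tail_strict bP cP l0 h; rewrite -/T e ltxx => /(_ t0 tV).
  by have := tail_strict bP cP l0 h; rewrite -/T e ltxx => /(_ t0 tV).
have -> : A x + B x - t = B y.
  have : A x + B x = A y + B y by apply: le_anti; rewrite !AB_noninc.
  by rewrite eA; lra.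
by rewrite BE // invrK.
Qed.

(** Where the tail is 0 or [vol P] nothing can be inverted; monotonicity, compared with one level
    [s] of intermediate tail, settles these [t]. *)
Lemma tail_reflect : exists k : R, forall t, tail P l (k - t) = vol P - tail P l t.
Proof.
have [k [hk [s hs]]] := tail_reflect_strict; have hks := hk _ hs.
have /andP[s0 sV] := hs.
have mono := tail_noninc l bP.
have T0 t : 0 <= T t by exact: tail_ge0.
have TV t : T t <= V by exact: tail_le.
have inv t : 0 < T (k - t) < V -> T t = V - T (k - t).
  by move=> /hk; rewrite opprB addrCA subrr addr0.
exists k => t; rewrite -/T -/V.
have := T0 t; rewrite le_eqVlt => /predU1P[/esym t0|t0].
  rewrite t0 subr0; apply: le_anti; rewrite TV /= leNgt; apply/negP => h.
  have := T0 (k - t); rewrite le_eqVlt => /predU1P[/esym h0|h0].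
    have st : s < t by apply: (tail_lt bP (l := l)); rewrite -/T t0.
    have : T (k - s) <= T (k - t) by apply: mono; lra.
    by rewrite hks h0; lra.
  by have := inv t; rewrite h0 h t0 => /(_ isT); lra.
have := TV t; rewrite le_eqVlt => /predU1P[tV|tV]; last by rewrite hk ?t0.
rewrite tV subrr; apply: le_anti; rewrite T0 andbT leNgt; apply/negP => h.
have := TV (k - t); rewrite le_eqVlt => /predU1P[h0|h0].
  have st : t < s by apply: (tail_lt bP (l := l)); rewrite -/T tV.
  have : T (k - t) <= T (k - s) by apply: mono; lra.
  by rewrite hks h0; lra.
by have := inv t; rewrite h0 h tV => /(_ isT); lra.
Qed.

End direction.
End half_difference.

Lemma nice_dot_indic P l : bset P -> nice (fun x => \1_P x * dot l x).
Proof.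
move=> bP; have [B B0 hB] := dot_bounded l bP; have [mP [r hr]] := bP; split.
  by apply: measurable_funM; [exact: measurable_indic|exact: measurable_dot].
exists r, B => x; rewrite indicE; case: (boolP (x \in P)) => [|xP].
  by rewrite inE mul1r => Px; split; [exact/ltW/hB|move=> _; exact: hr].
by rewrite mul0r normr0 eqxx; split => //; exact: ltW.
Qed.

(** The distribution of [<l, x>] on [P] is symmetric about [k / 2], so the positive and negative
    parts of [<l, x> - k / 2] have level sets of equal volume. *)
Lemma tail_reflect_barycenter P l k : bset P -> l != 0 ->
  (forall t, tail P l (k - t) = vol P - tail P l t) ->
  In (fun x => \1_P x * dot l x) = k / 2 * vol P.
Proof.
move=> bP l0 hk; have nd := nice_dot_indic l bP; have ni := nice_indic bP.
pose g x := \1_P x * dot l x - k / 2 * \1_P x.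
have ng : nice g by apply: niceB => //; exact: niceZ.
pose gp x : R := Num.max (g x) 0; pose gn x : R := Num.max (- g x) 0.
have nmax (f : 'rV[R]_n.+1 -> R) : nice f -> nice (fun x => Num.max (f x) 0).
  move=> [mf [r [c hf]]]; split; first by apply: measurable_maxr.
  exists r, c => x; have [h1 h2] := hf x; split.
    by rewrite /Num.max; case: ifP => // _; rewrite normr0; exact: le_trans h1.
  by move=> h; apply: h2; apply: contra_neq h => ->; rewrite maxxx.
have ngp : nice gp by exact: nmax.
have ngn : nice gn by apply: nmax; exact: niceN.
have gE x : g x = gp x - gn x.
  by rewrite /gp /gn !maxEle; move: (g x) => a; case: leP => h1; case: leP => h2; lra.
have [gp0 gn0] : (forall x, 0 <= gp x) /\ (forall x, 0 <= gn x).
  by split => x; rewrite le_max lexx orbT.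
have In_eq : In gp = In gn.
  have [_ ->] := layer_cake ngp gp0; have [_ ->] := layer_cake ngn gn0.
  congr I1; apply/funext => r; have [r0|r0] := leP 0 r; last first.
    by congr vol; apply/seteqP; split => y /= /andP[]; rewrite leNgt r0.
  rewrite (_ : [set y | true && (r < gp y)] = P `&` [set x | k - (k / 2 - r) < dot l x]).
    rewrite (_ : [set y | true && (r < gn y)] = P `&` [set x | dot l x < k / 2 - r]).
      by rewrite vol_compl_tail // -hk.
    apply/seteqP; split => y; rewrite /= /gn lt_max /g indicE.
      case: (boolP (y \in P)) => [|_]; last by rewrite mul0r mulr0 subr0 oppr0 orbb ltNge r0.
      by rewrite inE mul1r mulr1 [r < 0]ltNge r0 orbF => Py h; split => //; lra.
    by move=> [Py h]; rewrite mem_set // mul1r mulr1; apply/orP; left; lra.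
  apply/seteqP; split => y; rewrite /= /gp lt_max /g indicE.
    case: (boolP (y \in P)) => [|_]; last by rewrite mul0r mulr0 subr0 orbb ltNge r0.
    by rewrite inE mul1r mulr1 [r < 0]ltNge r0 orbF => Py h; split => //; lra.
  by move=> [Py h]; rewrite mem_set // mul1r mulr1; apply/orP; left; lra.
have : In g = 0.
  by rewrite (_ : g = fun x => gp x - gn x) ?In_B ?In_eq ?subrr //; apply/funext.
by rewrite /g In_B //; [rewrite In_Z // => /eqP; rewrite subr_eq0 => /eqP|exact: niceZ].
Qed.

(** The centre is found as twice the barycentre, which has product [k] with each normal. If [z - x]
    violated an inequality, [x] would lie strictly below the level [k - p.2], where reflection of
    the empty tail leaves no volume, although [P] has volume near [x]. *)
Lemma half_difference_symmetric (L : seq ('rV[R]_n.+1 * R)) K : bset (hpoly L) -> 0 < vol (hpoly L) ->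
  bset K -> (forall x y, hpoly L x -> hpoly L y -> K (2^-1 *: (x - y))) -> vol K <= vol (hpoly L) ->
  exists z, forall x, hpoly L x -> hpoly L (z - x).
Proof.
set P := hpoly L => bP vP bK PK vK.
have cP : convexP P by move=> x y t t01; exact: hpoly_convex.
pose z : 'rV[R]_n.+1 := \row_i (2 / vol P * In (fun x => \1_P x * dot (delta_mx ord0 i) x)).
exists z => x Px p pL; have [p0|p0] := eqVneq p.1 0.
  by rewrite p0 dot0l; have := Px _ pL; rewrite p0 dot0l.
have [k hk] := tail_reflect bP cP vP bK PK vK p0.
have kE : dot p.1 z = k.
  have := tail_reflect_barycenter bP p0 hk.
  rewrite (_ : (fun x => _) = fun x => \sum_i p.1 ord0 i * (\1_P x * dot (delta_mx ord0 i) x)); last first.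
    apply/funext => y; rewrite mulr_sumr; apply: eq_bigr => i _.
    rewrite mulrCA; congr (_ * (_ * _)); rewrite /dot (bigD1 i) //= mxE !eqxx mul1r big1 ?addr0 // => j ji.
    by rewrite mxE eqxx (negbTE ji) mul0r.
  rewrite In_sum; last by move=> i _; apply: niceZ; exact: nice_dot_indic.
  rewrite (eq_bigr (fun i => p.1 ord0 i * In (fun y => \1_P y * dot (delta_mx ord0 i) y))); last first.
    by move=> i _; rewrite In_Z //; exact: nice_dot_indic.
  move=> h; rewrite /dot; under eq_bigr do rewrite mxE mulrCA.
  by rewrite -mulr_sumr h; field; rewrite gt_eqF.
rewrite dotBr kE leNgt; apply/negP => h.
have t0 : tail P p.1 p.2 = 0.
  rewrite /tail (_ : _ `&` _ = set0) ?vol_set0 //; apply/seteqP; split => // y [Py /=].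
  by rewrite ltNge (Py _ pL).
have := hk p.2; rewrite t0 subr0 => e.
have := vol_compl_tail (k - p.2) bP p0; rewrite e subrr => v0.
pose c2 := (dot p.1 x + (k - p.2)) / 2.
have c12 : dot p.1 x - 1 < dot p.1 x < c2 by rewrite /c2; apply/andP; split; lra.
have := vol_slab_gt0 bP cP vP Px c12.
apply/negP; rewrite -leNgt -v0; apply: vol_le.
- by apply: bsetI (bset_tail _ _ bP) _; exact: measurable_dot_le.
- by apply: bsetI => //; exact: measurable_dot_lt.
- by move=> y [[Py _] /= hy]; split => //=; rewrite /c2 in hy; lra.
Qed.

End tails.

(** * Symmetry from equal opposite caps *)

Section small.
Context (R : realType).

Lemma seq_small (T : eqType) (S : seq T) (Q : T -> R -> Prop) :
  (forall u, u \in S -> exists2 d : R, 0 < d & forall s, 0 < s -> s <= d -> Q u s) ->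
  exists2 d : R, 0 < d & forall u, u \in S -> forall s, 0 < s -> s <= d -> Q u s.
Proof.
elim: S => [_|a S IH h]; first by exists 1.
have [u uS|d d0 hd] := IH; first by apply: h; rewrite inE uS orbT.
have [d' d'0 hd'] := h a (mem_head _ _).
exists (Num.min d d'); first by rewrite lt_min d0.
by move=> u; rewrite inE => /predU1P[->|uS] s s0; rewrite le_min => /andP[h1 h2]; [exact: hd'|exact: hd].
Qed.

(* Log-concavity propagates [V (1/2) > V 0] to a linear growth of [V] to the
   right of 0, hence to a linear decrease of [V] to the left of 0. *)
Lemma midpoint_logconcave_le (V : R -> R) :
  (forall s t, V s * V t <= V (2^-1 * (s + t)) ^+ 2) -> (forall s, 0 <= V s) -> 0 < V 0 ->
  (forall e, 0 < e -> exists2 d : R, 0 < d & forall s, 0 < s -> s <= d -> V 0 - e * s <= V (- s)) ->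
  V 2^-1 <= V 0.
Proof.
move=> mid V0 Vp small.
have h2 m : 0 < 2^-1 ^+ m.+1 :> R by rewrite exprn_gt0 // invr_gt0.
(* Log-concavity on [[0, t]] bounds [V t / V 0] by the square of [V (t / 2) / V 0]; this is iterated
   from [t = 1/2]. *)
have grow m : V 2^-1 / V 0 <= (V (2^-1 ^+ m.+1) / V 0) ^+ (2 ^ m)%N.
  elim: m => [|m IH]; first by rewrite !expr1.
  apply: (le_trans IH); rewrite expnS exprM; apply: lerXn2r.
  - by rewrite nnegrE divr_ge0.
  - by rewrite nnegrE exprn_ge0 // divr_ge0.
  rewrite expr_div_n [V 0 ^+ 2]expr2 invfM mulrA ler_pM2r ?invr_gt0 // ler_pdivlMr //.
  rewrite mulrC; have := mid 0 (2^-1 ^+ m.+1); rewrite add0r.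
  by rewrite -exprS.
rewrite leNgt; apply/negP => h.
pose q := V 0 / V 2^-1; have Vh : 0 < V 2^-1 by exact: lt_trans h.
have q1 : q < 1 by rewrite ltr_pdivrMr // mul1r.
have e0 : 0 < (1 - q) * V 0 by rewrite mulr_gt0 // subr_gt0.
have [d d0 hd] := small _ e0.
have [m hm] : exists m, 2^-1 ^+ m.+1 <= Num.min d 1.
  have : 2^-1 ^+ m @[m --> \oo] --> (0 : R) by apply: cvg_expr; rewrite ger0_norm //; lra.
  move/cvgrPdist_le => /(_ (Num.min d 1)); rewrite lt_min d0 ltr01 => /(_ isT)[m _ hm].
  by exists m; have := hm m.+1 (leqW (leqnn _)); rewrite sub0r normrN ger0_norm // exprn_ge0.
move: hm; rewrite le_min => /andP[md m1].
set t := 2^-1 ^+ m.+1 in md m1; have t0 : 0 < t by exact: h2.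
have lowb := hd _ t0 md.
have up : V t * V (- t) <= V 0 ^+ 2.
  by have := mid t (- t); rewrite subrr mulr0.
have tN : t * (2 ^ m)%:R = 2^-1.
  by rewrite /t exprS natrX exprVn -mulrA mulVf ?mulr1 // expf_neq0 // pnatr_eq0.
have x1 : (1 - q) * t <= 1.
  have q0 : 0 < q by exact: divr_gt0.
  by apply: (@le_trans _ _ (1 * 1)); [apply: ler_pM; lra|rewrite mulr1].
have u1 : 1 - (1 - q) * t <= V (- t) / V 0.
  by rewrite ler_pdivlMr // mulrBl mul1r mulrAC; exact: lowb.
(* Bernoulli's inequality, to raise the small loss at [- t] to the power [2 ^ m]. *)
have bern k (x : R) : x <= 1 -> 1 - k%:R * x <= (1 - x) ^+ k.
  move=> hx; elim: k => [|k IH]; first by rewrite mul0r subr0 expr0.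
  rewrite exprSr; apply: (@le_trans _ _ ((1 - k%:R * x) * (1 - x))).
    rewrite -natr1 -subr_ge0 (_ : _ - _ = k%:R * x ^+ 2); last by ring.
    by rewrite mulr_ge0 // sqr_ge0.
  by rewrite ler_wpM2r // subr_ge0.
have b1 := bern (2 ^ m)%N _ x1.
have b2 : 1 - (2 ^ m)%:R * ((1 - q) * t) <= (V (- t) / V 0) ^+ (2 ^ m)%N.
  by apply: (le_trans b1); apply: lerXn2r; rewrite ?nnegrE ?divr_ge0 // subr_ge0.
have b3 : (V t / V 0) ^+ (2 ^ m)%N * (V (- t) / V 0) ^+ (2 ^ m)%N <= 1.
  rewrite -exprMn; apply: exprn_ile1; first by rewrite mulr_ge0 // divr_ge0.
  by rewrite mulrACA -invfM -expr2 ler_pdivrMr ?exprn_gt0 // mul1r.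
have b4 := grow m; rewrite -/t in b4.
have b5 : V 2^-1 / V 0 * (V (- t) / V 0) ^+ (2 ^ m)%N <= 1.
  by apply: le_trans b3; rewrite ler_wpM2r // exprn_ge0 // divr_ge0.
have b6 : V 2^-1 / V 0 * (1 - (2 ^ m)%:R * ((1 - q) * t)) <= 1.
  by apply: le_trans b5; rewrite ler_wpM2l // divr_ge0.
(* Since [t * 2 ^ m] is 1/2, what remains says [(1 + q) / 2 <= q], against [q < 1]. *)
have e1 : (2 ^ m)%:R * ((1 - q) * t) = (1 - q) / 2 by rewrite mulrCA [_ * t]mulrC tN.
move: b6; rewrite e1 mulrC -ler_pdivlMr ?divr_gt0 // invf_div -/q mul1r; lra.
Qed.
End small.

Section caps.
Context (R : realType).

(** Induction on the list: removing [E v] costs each of the other sets at most [d]. This crude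
    inclusion-exclusion suffices since overlaps of caps are o(s). *)
Lemma vol_union_le n (T : eqType) (S : seq T) (E : T -> set 'rV[R]_n) (F : set 'rV[R]_n) (d : R) :
  uniq S -> bset F -> (forall i, i \in S -> bset (E i) /\ E i `<=` F) ->
  (forall i j, i \in S -> j \in S -> i != j -> vol (E i `&` E j) <= d) -> 0 <= d ->
  \sum_(i <- S) vol (E i) <= vol F + (size S * size S)%:R * d.
Proof.
move=> uS bF hE hd d0; elim: S E F uS bF hE hd => [|v S IH] E F /=.
  by rewrite big_nil mul0r addr0 vol_ge0.
move=> /andP[vS uS] bF hE hd; rewrite big_cons.
have [bv vF] := hE v (mem_head _ _); have [mv _] := bv.
have hS i : i \in S -> i \in v :: S by rewrite inE => ->; rewrite orbT.
have vFE : vol (F `&` E v) = vol (E v).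
  by congr vol; apply/seteqP; split => x; [case|move=> h; split => //; exact: vF].
have := IH (fun i => E i `\` E v) (F `\` E v) uS (bsetD bF mv).
have -> : vol (F `\` E v) = vol F - vol (E v).
  by rewrite (vol_setDI bF mv) vFE addrAC subrr add0r.
move=> H; have {H} : \sum_(i <- S) vol (E i `\` E v) <= vol F - vol (E v) + (size S * size S)%:R * d.
  apply: H.
    move=> i iS; have [bi iF] := hE i (hS _ iS); split; first exact: bsetD.
    by move=> x [h1 h2]; split => //; exact: iF.
  move=> i j iS jS ij; apply: le_trans (hd _ _ (hS _ iS) (hS _ jS) ij).
  have [bi _] := hE i (hS _ iS); have [bj _] := hE j (hS _ jS); have [mj _] := bj.
  have mDj : measurable (E j `\` E v) by apply: measurableD.
  apply: vol_le; [by apply: bsetI => //; exact: bsetD|exact: bsetI|].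
  by move=> x [[? _] [? _]].
have : \sum_(i <- S) vol (E i) <= \sum_(i <- S) vol (E i `\` E v) + (size S)%:R * d.
  have -> : (size S)%:R * d = \sum_(i <- S) d by rewrite big_const_seq count_predT iter_addr_0 mulr_natl.
  rewrite -big_split /= [leLHS]big_seq [leRHS]big_seq; apply: ler_sum => i iS.
  have [bi _] := hE i (hS _ iS); rewrite (vol_setDI bi mv); set a := vol (_ `&` _).
  suff : a <= d by lra.
  apply: hd; [exact: hS|exact: mem_head|].
  by apply: contraNneq vS => <-.
rewrite !natrM -natr1 => h1 h2.
have k0 : 0 <= (size S)%:R :> R by [].
have : 0 <= (size S)%:R * d by rewrite mulr_ge0.
nra.
Qed.

Lemma vol_remove_le n (T : eqType) (S : seq T) (E : T -> set 'rV[R]_n) (F : set 'rV[R]_n) :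
  bset F -> (forall i, i \in S -> bset (E i)) ->
  bset [set x | F x /\ forall i, i \in S -> ~ E i x] /\
  vol F <= vol [set x | F x /\ forall i, i \in S -> ~ E i x] + \sum_(i <- S) vol (E i).
Proof.
move=> bF; elim: S => [|v S IH] hE.
  rewrite big_nil addr0 (_ : [set x | _] = F) //; apply/seteqP; split => x; first by case.
  by move=> Fx; split => // i; rewrite in_nil.
have [i iS|b1 h1] := IH; first by apply: hE; rewrite inE iS orbT.
have bv := hE v (mem_head _ _); have [mv _] := bv.
have e : [set x | F x /\ forall i, i \in v :: S -> ~ E i x] =
    [set x | F x /\ forall i, i \in S -> ~ E i x] `\` E v.
  apply/seteqP; split => x.
    move=> [Fx h]; split; last by apply: h; exact: mem_head.
    by split => // i iS; apply: h; rewrite inE iS orbT.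
  by move=> [[Fx h] hv]; split => // i; rewrite inE => /predU1P[->|/h].
rewrite e; split; first exact: bsetD.
apply: (le_trans h1); rewrite big_cons (vol_setDI b1 mv); set a := vol (_ `&` _).
suff : a <= vol (E v) by lra.
by apply: vol_le; [exact: bsetI|exact: bv|move=> x []].
Qed.

(** In coordinates with [<v, x>] first, [w] not being a multiple of [v] means that the tail of the
    transformed [w] is nonzero, as [top_cap_overlap] requires. *)
Lemma caps_overlap n (L : seq ('rV[R]_n.+1 * R)) (v w : 'rV[R]_n.+1) (hv hw : R) :
  bset (hpoly L) -> v != 0 -> (forall c, w != c *: v) ->
  (forall x, hpoly L x -> dot v x <= hv) -> (forall x, hpoly L x -> dot w x <= hw) ->
  forall e, 0 < e -> exists2 d : R, 0 < d & forall s, 0 < s -> s <= d ->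
    vol (hpoly L `&` [set x | hv - s < dot v x] `&` [set x | hw - s < dot w x]) <= e * s.
Proof.
move=> bP v0 vw h1 h2 e e0; have [G uG [c c0 [dG hG]]] := dir_coord v0.
set P := hpoly L.
have [bP' _] := vol_mulmx uG hG bP; have PE := hpoly_mulmx L G; rewrite PE in bP'.
have PEx x : hpoly [seq (p.1 *m G^T, p.2) | p <- L] x = P (x *m G) by rewrite -PE.
have [||||d d0 hd] := @top_cap_overlap R n [seq (p.1 *m G^T, p.2) | p <- L] hv (w *m G^T) hw bP' _ _ _ (e * c).
- by move=> x; rewrite PEx => /h1; rewrite dG.
- by move=> x; rewrite PEx => /h2; rewrite dot_mulmx.
- apply/eqP => t0; have : w *m G^T = (w *m G^T) ord0 ord0 *: (v *m G^T).
    have vG : v *m G^T = cons_rV (1, 0).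
      apply/rowP => i; have := dG (delta_mx ord0 i); rewrite dot_mulmx dotC => h.
      have dd (u : 'rV[R]_n.+1) : dot (delta_mx ord0 i) u = u ord0 i.
        rewrite /dot (bigD1 i) //= mxE !eqxx mul1r big1 ?addr0 // => j ji.
        by rewrite mxE eqxx (negbTE ji) mul0r.
      rewrite -(dd (v *m G^T)) h mxE eqxx /=; case: (unliftP ord0 i) => [j ->|->].
        by rewrite cons_rVS mxE.
      by rewrite cons_rV0.
    rewrite vG -[LHS]cons_tl t0 cons_rVZ mulr1 scaler0 //.
  rewrite scalemxAl => /(can_inj (mulmxK _)) => h; have := vw ((w *m G^T) ord0 ord0).
  by rewrite -h ?unitmx_tr // eqxx.
- exact: mulr_gt0.
exists d => // s s0 sd; have := hd s s0 sd.
have bE : bset (P `&` [set x | hv - s < dot v x] `&` [set x | hw - s < dot w x]).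
  by apply: bsetI (measurable_dot_gt _ _); apply: bsetI => //; exact: measurable_dot_gt.
have [_ vE] := vol_mulmx uG hG bE.
rewrite (_ : _ `&` _ = [set x | (P `&` [set x | hv - s < dot v x] `&` [set x | hw - s < dot w x]) (x *m G)]).
  by rewrite vE mulrAC -ler_pdivlMl // [e * s * c]mulrC mulrA mulVf ?mul1r // gt_eqF.
by rewrite -PE; apply/seteqP; split => x; rewrite /= dG -dot_mulmx.
Qed.

End caps.

Section caps_symmetric.
Context (R : realType) (n : nat).
Variables (L : seq ('rV[R]_n.+1 * R)) (h : 'rV[R]_n.+1 -> R).
Let P := hpoly L.
Hypotheses (bP : bset P) (vP : 0 < vol P) (hmax : forall v x, P x -> dot v x <= h v)
  (hatt : forall v, exists2 x, P x & dot v x = h v).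

(** Closed under negation, so that opposite caps can be paired; normalised, so that parallel members
    are equal or opposite; without repetition, so that sums over caps count each one once. *)
Definition unit_normals : seq 'rV[R]_n.+1 :=
  undup [seq `|v|^-1 *: v | v <- [seq q.1 | q <- [seq p : 'rV[R]_n.+1 * R <- L | p.1 != 0]] ++
                                 [seq - q.1 | q <- [seq p : 'rV[R]_n.+1 * R <- L | p.1 != 0]]].
Let S := unit_normals.

Let SP v : v \in S <-> exists2 p : 'rV[R]_n.+1 * R, p \in L & p.1 != 0 /\
  (v = `|p.1|^-1 *: p.1 \/ v = - (`|p.1|^-1 *: p.1)).
Proof.
rewrite mem_undup; split.
  move=> /mapP[u]; rewrite mem_cat => /orP[] /mapP[p]; rewrite mem_filter => /andP[p0 pL] -> ->.
    by exists p => //; split => //; left.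
  by exists p => //; split => //; right; rewrite normrN scalerN.
move=> [p pL [p0 vE]]; apply/mapP.
have pF : p \in [seq p : 'rV[R]_n.+1 * R <- L | p.1 != 0] by rewrite mem_filter p0.
case: vE => ->.
  by exists p.1 => //; rewrite mem_cat; apply/orP; left; apply/mapP; exists p.
exists (- p.1); last by rewrite normrN scalerN.
by rewrite mem_cat; apply/orP; right; apply/mapP; exists p.
Qed.

Let SN v : v \in S -> - v \in S.
Proof.
move=> /SP[p pL [p0 vE]]; apply/SP; exists p => //; split => //.
by case: vE => ->; [right|left; rewrite opprK].
Qed.

Let Snorm v : v \in S -> `|v| = 1.
Proof.
move=> /SP[p pL [p0 vE]].
have e : `| `|p.1|^-1 *: p.1 | = 1.
  by rewrite normrZ normfV normr_id mulVf // normr_eq0.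
by case: vE => ->; rewrite ?normrN.
Qed.

Let S0 v : v \in S -> v != 0.
Proof. by move=> /Snorm; apply: contra_eq_neq => ->; rewrite normr0 eq_sym oner_eq0. Qed.

Let Spar v w : v \in S -> w \in S -> w != v -> w != - v -> forall c, w != c *: v.
Proof.
move=> /Snorm nv /Snorm nw wv wNv c; apply/eqP => e; move: nw; rewrite e normrZ nv mulr1 => c1.
have [c0|c0] := leP 0 c.
  by move: wv; rewrite e -[c]ger0_norm // c1 scale1r eqxx.
by move: wNv; rewrite e (_ : c = -1) ?scaleN1r ?eqxx // -c1 ltr0_norm // opprK.
Qed.

(* These polytopes go from [P] at [s = 0] to [- P] at [s = 1]. *)
Definition interp (s : R) : seq ('rV[R]_n.+1 * R) :=
  [seq (v, (1 - s) * h v + s * h (- v)) | v <- S].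

Let interpP s x : hpoly (interp s) x <-> forall v, v \in S -> dot v x <= (1 - s) * h v + s * h (- v).
Proof.
split=> H; first by move=> v vS; apply: (H (v, _)); apply/mapP; exists v.
by move=> p /mapP[v vS ->]; exact: H.
Qed.

Let P_interp x : P x <-> forall v, v \in S -> dot v x <= h v.
Proof.
split=> [Px v _|H p pL]; first exact: hmax.
have [p0|p0] := eqVneq p.1 0.
  have [y Py _] := hatt 0; have := Py _ pL; by rewrite p0 !dot0l.
have np : 0 < `|p.1| by rewrite normr_gt0.
pose v := `|p.1|^-1 *: p.1.
have vS : v \in S by apply/SP; exists p => //; split => //; left.
have [y Py hy] := hatt v; have := H _ vS; rewrite -hy /v !dotZl ler_pM2l ?invr_gt0 // => /le_trans; apply.
exact: Py.
Qed.

Let interp0 : hpoly (interp 0) = P.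
Proof.
apply/seteqP; split => x.
  by move/interpP => H; apply/P_interp => v /H; rewrite subr0 mul1r mul0r addr0.
by move/P_interp => H; apply/interpP => v /H; rewrite subr0 mul1r mul0r addr0.
Qed.

Let interior_point : exists p, forall v, v \in S -> dot v p < h v.
Proof.
apply: contrapT => H; move: vP.
rewrite (@vol_null_cover R _ [seq (v, h v) | v <- S] P bP) ?ltxx //.
  by move=> q /mapP[v vS ->]; exact: S0.
move=> x Px; apply: contrapT => H'; apply: H; exists x => v vS.
rewrite lt_neqAle (hmax _ Px) andbT; apply/eqP => e; apply: H'.
by exists (v, h v) => //; apply/mapP; exists v.
Qed.

Hypothesis caps : forall v, v != 0 -> forall e, 0 < e ->
  exists2 d : R, 0 < d & forall s, 0 < s -> s <= d ->
   `|vol (P `&` [set x | h v - s < dot v x]) - vol (P `&` [set x | h (- v) - s < dot (- v) x])| <= e * s.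

Section with_interior_point.
Variable p : 'rV[R]_n.+1.
Hypothesis hp : forall v, v \in S -> dot v p < h v.
Let H v := h v - dot v p.

Let H0 v : v \in S -> 0 < H v.
Proof. by move=> vS; rewrite subr_gt0 hp. Qed.

Let Pp : P p.
Proof. by apply/P_interp => v vS; exact/ltW/hp. Qed.

Let HN v : H (- v) = h (- v) + dot v p.
Proof. by rewrite /H dotNl opprK. Qed.

Let Hbound : exists2 C : R, 1 <= C & forall v, v \in S -> H v <= C.
Proof.
exists (1 + \sum_(v <- S) `|H v|); first by rewrite lerDl sumr_ge0.
move=> v vS; rewrite (big_rem v) //=; have := ler_norm (H v).
have : 0 <= \sum_(y <- rem v S) `|H y| by rewrite sumr_ge0.
lra.
Qed.

(** Relative to the point [(1 - 2 s) p] the bounds of [interp s] are [(1 - s) H v + s H (- v)]. They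
    are at most [K H v] for a common [K], so the polytope lies in a dilate of [P]. *)
Let bset_interp s : bset (hpoly (interp s)).
Proof.
have [C C1 hC] := Hbound; have [_ [r hr]] := bP.
have [K K0 hK] : exists2 K : R, 0 < K & forall v, v \in S -> (1 - s) * H v + s * H (- v) <= K * H v.
  have : forall v, v \in S -> exists2 d : R, 0 < d & forall t, 0 < t -> t <= d ->
      t * ((1 - s) * H v + s * H (- v)) <= H v.
    move=> v vS; set a := _ + _; exists (H v / (`|a| + 1)); first by rewrite divr_gt0 ?H0 // ltr_wpDl.
    move=> t t0; rewrite ler_pdivlMr; last by rewrite ltr_wpDl.
    by have := ler_norm a; have := normr_ge0 a; nra.
  move=> /seq_small[d d0 hd]; exists d^-1; first by rewrite invr_gt0.
  by move=> v vS; rewrite ler_pdivlMl //; exact: (hd v vS d).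
pose c : 'rV[R]_n.+1 := (1 - 2 * s) *: p.
apply: (@bset_hpoly R n.+1 (interp s) (K * (`|r| + \sum_i `|p ord0 i|) + \sum_i `|c ord0 i|)).
move=> x /interpP hx i.
have Py : P (K^-1 *: (x - c) + p).
  apply/P_interp => v vS; rewrite dotDr dotZr dotBr -lerBrDr ler_pdivrMl //.
  apply: le_trans (hK v vS); have := hx v vS; rewrite HN /H /c dotZr; lra.
have := hr _ Py i; rewrite !mxE => h1.
have pb (u : 'rV[R]_n.+1) : `|u ord0 i| <= \sum_i `|u ord0 i|.
  by rewrite (bigD1 i) //= lerDl sumr_ge0.
have k1 := pb p; have k2 := pb c; rewrite /c mxE in k2.
set a := (1 - 2 * s) * p ord0 i in h1 k2 *; set Sc := \sum_i `|c ord0 i| in k2 *.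
set Sp := \sum_i `|p ord0 i| in k1 *.
have -> : x ord0 i = K * (K^-1 * (x ord0 i - a) + p ord0 i - p ord0 i) + a by field; lra.
apply: (le_trans (ler_normD _ _)); apply: lerD => //.
rewrite normrM (gtr0_norm K0) ler_pM2l //; apply: (le_trans (ler_normB _ _)); apply: lerD => //.
by apply: (le_trans h1); exact: ler_norm.
Qed.

Let Z sg := [set x | P x /\ forall v, v \in S -> ~ (P `&` [set x | h v - sg * H (- v) < dot v x]) x].

Let bcap v t : bset (P `&` [set x | h v - t < dot v x]).
Proof. exact: bsetI (measurable_dot_gt _ _). Qed.

(** The dilation [x |-> (1 + s) x + s p] carries the bound [h v - g H (- v)], with
    [g = s / (1 + s)], to the bound of [interp (- s)] for [v]. So going back from [P] amounts to
    cutting off caps whose depth is dictated by the opposite side. *)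
Let Z_interp (s : R) : 0 < s -> (1 + s) ^+ n.+1 * vol (Z (s / (1 + s))) <= vol (hpoly (interp (- s))).
Proof.
move=> s0; have s1 : 1 + s != 0 by lra.
have [b1 ->] := vol_aff (s *: p) s1 (bset_interp (- s)).
rewrite ger0_norm; last by lra.
rewrite ler_pM2l ?exprn_gt0 //; last by lra.
have [bZ _] := @vol_remove_le R _ _ S (fun v => P `&` [set x | h v - s / (1 + s) * H (- v) < dot v x]) P bP (fun v _ => bcap v _).
apply: vol_le => // x [Px hx] /=; apply/interpP => v vS.
have {hx} : dot v x <= h v - s / (1 + s) * H (- v).
  by rewrite leNgt; apply/negP => hv; apply: (hx v vS).
rewrite dotDr !dotZr HN => hx.
have : (1 + s) * dot v x <= (1 + s) * (h v - s / (1 + s) * (h (- v) + dot v p)).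
  by rewrite ler_pM2l //; lra.
rewrite mulrBr mulrA mulrCA mulfV // mulr1; lra.
Qed.

(** The contraction of [P] towards [p] has a known volume and avoids every cap of depth [sg H v]. *)
Let shrink sg : 0 < sg -> sg < 1 ->
  let T := [set y | P ((1 - sg)^-1 *: (y - p) + p)] in
  [/\ bset T, vol T = (1 - sg) ^+ n.+1 * vol P, T `<=` P &
      forall y v, v \in S -> T y -> dot v y <= h v - sg * H v].
Proof.
move=> g0 g1 /=; have t0 : 0 < 1 - sg by lra.
have [b1 v1] := vol_homothety p bP t0; split => //.
  move=> y /= hy; rewrite (homothety_eq p y (lt0r_neq0 t0)).
  by apply: hpoly_convex => //; lra.
move=> y v vS /= hy; rewrite (homothety_eq p y (lt0r_neq0 t0)) dotDr !dotZr.
have := hmax v hy; rewrite /H; set d := dot v (_ + p); nra.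
Qed.

(** [Z g] loses at most the caps of depth [g H (- v)] in the directions [v]. By assumption these
    match, up to o(g), the caps in the directions [- v], of the natural depth for a contraction;
    almost disjoint, these fit into [P] minus its contraction by [1 - g]. So [vol (Z g)] is at least
    [(1 - g) ^ (n + 1) vol P] up to o(g), and the factor [(1 + s) ^ (n + 1)] cancels since
    [(1 + s) (1 - g) = 1]. *)
Let interp_lower e : 0 < e -> exists2 d : R, 0 < d & forall s, 0 < s -> s <= d ->
  vol P - e * s <= vol (hpoly (interp (- s))).
Proof.
move=> e0; have [C C1 hC] := Hbound; have C0 : 0 < C by lra.
pose N : R := (size S)%:R + (size S * size S)%:R.
have N0 : 0 <= N by rewrite addr_ge0.
(* Collects the errors: the dilation factor is at most [2 ^ (n + 1)], depths are at most [g C], and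
   [N] counts the pairs of opposite caps plus the overlaps. *)
pose D := 2 ^+ n.+1 * C * (N + 1).
have D0 : 0 < D by rewrite !mulr_gt0 ?exprn_gt0 //; lra.
pose f := e / D; have f0 : 0 < f by exact: divr_gt0.
have [d1 d10 h1] : exists2 d : R, 0 < d & forall v, v \in S -> forall s, 0 < s -> s <= d ->
   `|vol (P `&` [set x | h v - s < dot v x]) - vol (P `&` [set x | h (- v) - s < dot (- v) x])| <= f * s.
  by apply: seq_small => v vS; apply: caps => //; exact: S0.
have [d2 d20 h2] : exists2 d : R, 0 < d & forall q, q \in [seq (v, w) | v <- S, w <- S] -> forall s, 0 < s -> s <= d ->
    q.2 != q.1 -> q.2 != - q.1 ->
    vol (P `&` [set x | h q.1 - s < dot q.1 x] `&` [set x | h q.2 - s < dot q.2 x]) <= f * s.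
  apply: seq_small => q /allpairsP[[v w] /= [vS wS ->]] /=.
  have [->|wv] := eqVneq w v; first by exists 1.
  have [->|wNv] := eqVneq w (- v); first by exists 1.
  have [d d0 hd] := caps_overlap bP (S0 vS) (Spar vS wS wv wNv) (hmax v) (hmax w) f0.
  by exists d => // s s0 sd _ _; exact: hd.
pose d := Num.min 1 (Num.min d1 d2 / C).
have m0 : 0 < Num.min d1 d2 by rewrite lt_min d10.
exists d; first by rewrite lt_min ltr01 divr_gt0.
move=> s s0; rewrite le_min => /andP[s1]; rewrite ler_pdivlMr // le_min => /andP[sd1 sd2].
have s1p : 0 < 1 + s by lra.
pose g := s / (1 + s); have g0 : 0 < g by exact: divr_gt0.
have [f0' [g0' C0']] : 0 <= f /\ 0 <= g /\ 0 <= C by do !split; exact: ltW.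
have gs : g <= s by rewrite ler_pdivrMr // ler_peMr //; lra.
have g1 : g < 1 by rewrite ltr_pdivrMr // mul1r; lra.
have gC : g * C <= s * C by rewrite ler_pM2r.
have gH v : v \in S -> 0 < g * H v /\ g * H v <= g * C.
  by move=> vS; rewrite mulr_gt0 ?H0 // ler_pM2l // hC.
pose cap v t := vol (P `&` [set x | h v - t < dot v x]).
have capsum : \sum_(v <- S) cap v (g * H (- v)) <= \sum_(v <- S) cap v (g * H v) + (size S)%:R * (f * (g * C)).
  (* Negation permutes [S]. *)
  have -> : \sum_(v <- S) cap v (g * H v) = \sum_(v <- S) cap (- v) (g * H (- v)).
    rewrite -(big_map -%R xpredT (fun v => cap v (g * H v))); apply: perm_big.
    apply: uniq_perm; [exact: undup_uniq| |].
      by rewrite map_inj_uniq ?undup_uniq //; exact: oppr_inj.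
    move=> v; apply/idP/mapP => [vS|[w wS ->]]; last exact: SN.
    by exists (- v); [exact: SN|rewrite opprK].
  have -> : (size S)%:R * (f * (g * C)) = \sum_(v <- S) (f * (g * C)).
    by rewrite big_const_seq count_predT iter_addr_0 mulr_natl.
  rewrite -big_split /= [leLHS]big_seq [leRHS]big_seq; apply: ler_sum => v vS.
  have [k0 k1] := gH _ (SN vS).
  have := h1 v vS (g * H (- v)) k0 (le_trans k1 (le_trans gC sd1)).
  rewrite ler_norml => /andP[_]; rewrite -/(cap v _) -/(cap (- v) _).
  have : f * (g * H (- v)) <= f * (g * C) by rewrite ler_pM2l.
  lra.
have [bT vT TP hT] := shrink g0 g1.
set T := [set y | _] in bT vT TP hT; have [mT _] := bT.
have capunion : \sum_(v <- S) cap v (g * H v) <= vol (P `\` T) + (size S * size S)%:R * (f * (g * C)).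
  apply: vol_union_le; [exact: undup_uniq|exact: bsetD| | |].
  - move=> v vS; split; first exact: bcap.
    by move=> x [Px /= hx]; split => // /(hT x v vS); rewrite leNgt hx.
  - move=> v w vS wS vw.
    (* Opposite caps are disjoint: their depths add up to [g] times the width [h v + h (- v)], and
       [g < 1]. *)
    have [wv|wv] := eqVneq w (- v).
      rewrite (_ : _ `&` _ = set0).
        rewrite vol_set0; apply: mulr_ge0; [exact: ltW|apply: mulr_ge0; exact: ltW].
      apply/seteqP; split => // x [[_ /= x1] [_ /=]]; rewrite wv dotNl.
      have := H0 vS; have := H0 (SN vS); rewrite HN /H => k1 k2 x2.
      have : g * (h v - dot v p) + g * (h (- v) + dot v p) < h v + h (- v).
        by rewrite -mulrDr (_ : _ - _ + _ = h v + h (- v)); [rewrite gtr_pMl //; lra|ring].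
      by move: x1 x2; rewrite /H; lra.
    have gC0 : 0 < g * C by exact: mulr_gt0.
    have q : (v, w) \in [seq (v, w) | v <- S, w <- S] by apply/allpairsP; exists (v, w).
    have := h2 _ q (g * C) gC0 (le_trans gC sd2); rewrite /= [w == v]eq_sym => /(_ vw wv); apply: le_trans.
    apply: vol_le.
    - by apply: bsetI; [exact: bcap|case: (bcap w (g * H w))].
    - by apply: bsetI (bcap _ _) (measurable_dot_gt _ _).
    - have [_ kv] := gH _ vS; have [_ kw] := gH _ wS.
      by move=> x [[Px /= x1] [_ /= x2]]; split; [split => //=|]; lra.
  - exact: mulr_ge0 f0' (mulr_ge0 g0' C0').
have volPT : vol (P `\` T) = vol P - (1 - g) ^+ n.+1 * vol P.
  have := vol_setDI bP mT; rewrite (_ : P `&` T = T) ?vT; first by lra.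
  by apply/seteqP; split => x; [case|move=> Tx; split => //; exact: TP].
have [bZ hZ] := @vol_remove_le R _ _ S (fun v => P `&` [set x | h v - g * H (- v) < dot v x]) P bP (fun v _ => bcap v _).
rewrite -/(Z g) in bZ hZ; rewrite -[X in _ <= _ + X]/(\sum_(v <- S) cap v (g * H (- v))) in hZ.
have Zlow : (1 - g) ^+ n.+1 * vol P - f * (g * C) * N <= vol (Z g).
  by move: hZ capsum capunion; rewrite volPT /N; lra.
have := Z_interp s0; rewrite -/g; apply: le_trans.
have e1 : (1 + s) * (1 - g) = 1 by rewrite /g; field; lra.
apply: (@le_trans _ _ ((1 + s) ^+ n.+1 * ((1 - g) ^+ n.+1 * vol P - f * (g * C) * N))); last first.
  by rewrite ler_pM2l // exprn_gt0.
rewrite mulrBr [X in _ <= X - _](_ : _ = vol P); last by rewrite mulrA -exprMn e1 expr1n mul1r.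
rewrite lerD2l lerN2.
have p2 : (1 + s) ^+ n.+1 <= 2 ^+ n.+1 by apply: lerXn2r; rewrite ?nnegrE; lra.
have q0 : 0 <= f * (g * C) * N by exact: mulr_ge0 (mulr_ge0 f0' (mulr_ge0 g0' C0')) N0.
apply: (@le_trans _ _ (2 ^+ n.+1 * (f * (g * C) * N))); first by rewrite ler_wpM2r.
have -> : e = f * D by rewrite /f divfK // gt_eqF.
rewrite /D (_ : _ * (f * _ * _) = f * (2 ^+ n.+1 * C) * (g * N)); last by ring.
rewrite (_ : f * _ * s = f * (2 ^+ n.+1 * C) * (s * (N + 1))); last by ring.
have q1 : 0 <= f * (2 ^+ n.+1 * C) by apply: mulr_ge0 => //; apply: mulr_ge0 => //; exact: exprn_ge0.
by rewrite ler_wpM2l //; nra.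
Qed.

Lemma caps_symmetric_at : exists z, forall x, P x -> P (z - x).
Proof.
have mid : vol (hpoly (interp 2^-1)) <= vol P.
  rewrite -interp0; apply: (@midpoint_logconcave_le R (fun s => vol (hpoly (interp s)))) => //.
  - move=> s t; apply: brunn_minkowski => // x y /interpP hx /interpP hy; apply/interpP => v vS.
    by rewrite dotZr dotDr; have := hx v vS; have := hy v vS; lra.
  - by move=> s; exact: vol_ge0.
  - by rewrite interp0.
  - by move=> e e0; rewrite interp0; exact: interp_lower.
apply: (half_difference_symmetric bP vP (bset_interp 2^-1)) => // x y Px Py.
apply/interpP => v vS; rewrite dotZr dotBr -dotNl; have := hmax v Px; have := hmax (- v) Py; lra.
Qed.

End with_interior_point.

Lemma caps_symmetric : exists z, forall x, P x -> P (z - x).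
Proof. by have [p hp] := interior_point; exact: caps_symmetric_at hp. Qed.

End caps_symmetric.

(** * Orthogonal exponentials on a product set *)

Section inner_product.
Context (R : realType) (d : nat).
Variable D : set 'rV[R]_d.
Hypothesis bD : bset D.
Implicit Types f g u : bool -> 'rV[R]_d -> R.

Definition bounded_meas f := forall b, measurable_fun setT (f b) /\ exists c : R, forall x, `|f b x| <= c.

(* The complex-valued function [f false + i f true]; [ip] is the real part of
   the complex inner product on [D]. *)
Definition ip f g := In (fun x => \1_D x * (f false x * g false x)) + In (fun x => \1_D x * (f true x * g true x)).

Lemma bounded_measM f g b : bounded_meas f -> bounded_meas g ->
  nice (fun x => \1_D x * (f b x * g b x)).
Proof.
move=> /(_ b)[mf [c hc]] /(_ b)[mg [c' hc']].
apply: (nice_indicM (c := c * c')) => //; first exact: measurable_funM.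
by move=> x; rewrite normrM; apply: ler_pM.
Qed.

Lemma bounded_measB f u (c : R) : bounded_meas f -> bounded_meas u -> bounded_meas (fun b x => f b x - c * u b x).
Proof.
move=> hf hu b; have [mf [a ha]] := hf b; have [mu [a' ha']] := hu b; split.
  by apply: measurable_funB => //; exact: measurable_funM.
exists (a + `|c| * a') => x; apply: (le_trans (ler_normB _ _)); apply: lerD => //.
by rewrite normrM ler_wpM2l.
Qed.

Lemma ip_sub_l f u g (c : R) : bounded_meas f -> bounded_meas u -> bounded_meas g ->
  ip (fun b x => f b x - c * u b x) g = ip f g - c * ip u g.
Proof.
move=> hf hu hg.
have E b : In (fun x => \1_D x * ((f b x - c * u b x) * g b x)) =
    In (fun x => \1_D x * (f b x * g b x)) - c * In (fun x => \1_D x * (u b x * g b x)).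
  have n1 := bounded_measM b hf hg; have n2 := bounded_measM b hu hg.
  rewrite -(In_Z c n2) -(In_B n1 (niceZ c n2)).
  by congr In; apply/funext => x; ring.
by rewrite /ip !E; ring.
Qed.

Lemma ipC f g : ip f g = ip g f.
Proof. by congr (_ + _); congr In; apply/funext => x; rewrite [X in _ * X]mulrC. Qed.

Lemma ip_ge0 f : 0 <= ip f f.
Proof.
by apply: addr_ge0; apply: In_ge0 => x; rewrite mulr_ge0 ?indicE // -expr2 sqr_ge0.
Qed.

Section orthogonal_family.
Variables (T : eqType) (u : T -> bool -> 'rV[R]_d -> R) (V : R).
Hypotheses (hu : forall i, bounded_meas (u i)) (hV : forall i, ip (u i) (u i) = V).

Definition residual (I : seq T) (c : T -> R) f b x := f b x - \sum_(i <- I) c i * u i b x.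

Lemma bounded_meas_residual I c f : bounded_meas f -> bounded_meas (residual I c f).
Proof.
elim: I f => [|i I IH] f hf.
  rewrite (_ : residual _ _ _ = f) //; apply/funext => b; apply/funext => x.
  by rewrite /residual big_nil subr0.
rewrite (_ : residual _ _ _ = residual I c (fun b x => f b x - c i * u i b x)).
  by apply: IH; exact: bounded_measB.
by apply/funext => b; apply/funext => x; rewrite /residual big_cons opprD addrA.
Qed.

Lemma residual_norm I c f : uniq I -> (forall i j, i \in I -> j \in I -> i != j -> ip (u i) (u j) = 0) ->
  bounded_meas f ->
  ip (residual I c f) (residual I c f) = ip f f - 2 * \sum_(i <- I) c i * ip f (u i) + V * \sum_(i <- I) c i ^+ 2.
Proof.
elim: I f => [|i I IH] f.
  move=> _ _ hf; rewrite (_ : residual _ _ _ = f) ?big_nil ?mulr0 ?subr0 ?addr0 //.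
  by apply/funext => b; apply/funext => x; rewrite /residual big_nil subr0.
move=> /= /andP[iI uI] orth hf.
have hf' := bounded_measB (c i) hf (hu i).
rewrite (_ : residual _ _ _ = residual I c (fun b x => f b x - c i * u i b x)); last first.
  by apply/funext => b; apply/funext => x; rewrite /residual big_cons opprD addrA.
rewrite IH //; last first.
  by move=> j k jI kI; apply: orth; rewrite inE ?jI ?kI orbT.
have e1 : ip (fun b x => f b x - c i * u i b x) (fun b x => f b x - c i * u i b x) =
    ip f f - 2 * (c i * ip f (u i)) + V * c i ^+ 2.
  rewrite (ip_sub_l _ hf (hu i) hf') [ip f _]ipC [ip (u i) _]ipC !ip_sub_l // hV [ip (u i) f]ipC; ring.
rewrite !big_cons e1.
have -> : \sum_(j <- I) c j * ip (fun b x => f b x - c i * u i b x) (u j) = \sum_(j <- I) c j * ip f (u j).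
  rewrite [LHS]big_seq [RHS]big_seq; apply: eq_bigr => j jI; rewrite ip_sub_l // orth ?mulr0 ?subr0 //.
  - exact: mem_head.
  - by rewrite inE jI orbT.
  - by apply: contraNneq iI => ->.
ring.
Qed.

Hypothesis V0 : 0 < V.

Lemma bessel I f : uniq I -> (forall i j, i \in I -> j \in I -> i != j -> ip (u i) (u j) = 0) ->
  bounded_meas f -> \sum_(i <- I) ip f (u i) ^+ 2 <= V * ip f f.
Proof.
move=> uI orth hf; have := ip_ge0 (residual I (fun i => ip f (u i) / V) f).
rewrite residual_norm //.
have -> : \sum_(i <- I) ip f (u i) / V * ip f (u i) = V^-1 * \sum_(i <- I) ip f (u i) ^+ 2.
  by rewrite mulr_sumr; apply: eq_bigr => i _; rewrite expr2; ring.
have -> : \sum_(i <- I) (ip f (u i) / V) ^+ 2 = V^-1 ^+ 2 * \sum_(i <- I) ip f (u i) ^+ 2.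
  by rewrite mulr_sumr; apply: eq_bigr => i _; rewrite exprMn mulrC.
set s := \sum_(i <- I) _.
rewrite expr2 !mulrA mulfV ?gt_eqF // mul1r => h.
by rewrite -ler_pdivrMl //; lra.
Qed.

(** Completing the square in each coefficient: any approximation of [f], not only the projection,
    bounds the energy on [I] from below. *)
Lemma best_approx I c f : uniq I -> (forall i j, i \in I -> j \in I -> i != j -> ip (u i) (u j) = 0) ->
  bounded_meas f -> V * (ip f f - ip (residual I c f) (residual I c f)) <= \sum_(i <- I) ip f (u i) ^+ 2.
Proof.
move=> uI orth hf; rewrite residual_norm // (_ : forall a b c : R, a - (a - b + c) = b - c); last by move=> *; ring.
rewrite mulrBr [2 * _]mulr_sumr !mulr_sumr -sumrB; apply: ler_sum => i _.
rewrite -subr_ge0 (_ : _ - _ = (ip f (u i) - V * c i) ^+ 2) ?sqr_ge0 //; ring.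
Qed.

End orthogonal_family.
End inner_product.

Section exponential_family.
Context (R : realType) (d : nat).
Variable D : set 'rV[R]_d.
Hypothesis bD : bset D.

Definition quarter (b : bool) : R := if b then pi / 2 else 0.

(* [ee mu th] is [exp (i (2 pi <mu, x> + th))]. *)
Definition ee (mu : 'rV[R]_d) (th : R) (b : bool) (x : 'rV[R]_d) : R :=
  sin (2 * pi * dot mu x + (th + quarter (~~ b))).

Lemma sin_shift (a : R) : sin (a + pi / 2) = cos a.
Proof. by rewrite sinD sin_pihalf cos_pihalf mulr0 add0r mulr1. Qed.

Lemma ee_cos mu th x : ee mu th false x = cos (2 * pi * dot mu x + th).
Proof. by rewrite /ee addrA sin_shift. Qed.

Lemma ee_sin mu th x : ee mu th true x = sin (2 * pi * dot mu x + th).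
Proof. by rewrite /ee addr0. Qed.

Lemma bounded_meas_ee mu th : bounded_meas (ee mu th).
Proof. by move=> b; split; [exact: measurable_sin_dot|exists 1 => x; exact: norm_sin_le1]. Qed.

Lemma ip_ee lam mu th ph : ip D (ee lam th) (ee mu ph) = sJ D (lam - mu) (th - ph + pi / 2).
Proof.
rewrite /ip /sJ -In_D; [|exact: (bounded_measM bD _ (bounded_meas_ee _ _) (bounded_meas_ee _ _))..].
congr In; apply/funext => x; rewrite !ee_cos !ee_sin -mulrDr addrA sin_shift -cosB; congr (_ * cos _).
by rewrite dotBl; ring.
Qed.

Lemma sJ_0 th : sJ D 0 th = sin th * vol D.
Proof.
rewrite /sJ /vol -In_Z; last exact: nice_indic.
by congr In; apply/funext => x; rewrite dot0l mulr0 add0r mulrC.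
Qed.

(** Over the reals an exponential spans a plane; the boolean chooses between the exponential and [i]
    times it. *)
Definition ee2 (p : 'rV[R]_d * bool) := ee p.1 (quarter p.2).

Lemma ip_ee2_norm p : ip D (ee2 p) (ee2 p) = vol D.
Proof. by rewrite ip_ee !subrr add0r sJ_0 sin_pihalf mul1r. Qed.

Lemma ip_ee2_orth (p q : 'rV[R]_d * bool) : (p.1 != q.1 -> forall th, sJ D (p.1 - q.1) th = 0) -> p != q ->
  ip D (ee2 p) (ee2 q) = 0.
Proof.
move=> h pq; rewrite ip_ee; have [e|/h ->//] := eqVneq p.1 q.1.
rewrite e subrr sJ_0; case: p q e pq {h} => [l b] [l' b'] /= ->.
case: b; case: b' => //=; rewrite ?eqxx // => _; rewrite /quarter.
  by rewrite subr0 -splitr sinpi mul0r.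
by rewrite sub0r addNr sin0 mul0r.
Qed.

End exponential_family.

Section phases.
Context (R : realType).

Lemma sin_sqr_ge : exists2 eta : R, 0 < eta & forall t : R, `|t| <= eta -> t ^+ 2 / 4 <= sin t ^+ 2.
Proof.
have H : h^-1 * sin h @[h --> (0:R)^'] --> (1 : R).
  have [+ ] := is_derive_sin (0:R); rewrite /derivable /derive cos0 => cv lm.
  rewrite (_ : (fun h => _) = (fun h : R => h^-1 *: ((sin \o shift 0) (h *: (1 : R)) - sin 0))).
    by rewrite -[X in _ --> X]lm; exact: cv.
  by apply/funext => h /=; rewrite sin0 subr0 addr0 /GRing.scale /= mulr1.
have /cvgrPdist_le/(_ _ (_ : 0 < 2^-1))[|e /= e0 he] := H; first by rewrite invr_gt0.
exists (e / 2); first by rewrite divr_gt0.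
move=> t te; have [->|t0] := eqVneq t 0; first by rewrite expr0n /= mul0r sqr_ge0.
have /he : ball_ Num.Def.normr 0 e t by rewrite /= sub0r normrN; lra.
move=> /(_ t0) h1.
have h2 : 2^-1 <= t^-1 * sin t by move: h1; rewrite ler_norml; lra.
have h3 : 2^-1 ^+ 2 <= (t^-1 * sin t) ^+ 2 by apply: lerXn2r; rewrite ?nnegrE //; lra.
have t2 : 0 < t ^+ 2 by rewrite exprn_even_gt0.
move: h3; rewrite exprMn (exprVn t) ler_pdivlMl //; lra.
Qed.

(** The colour records, for each [x] in the list, in which of finitely many cells of length less
    than [e] the fractional part of [<xi, x>] falls. *)
Lemma phase_colouring n (X : seq 'rV[R]_n) (e : R) : 0 < e ->
  exists (C : finType) (col : 'rV[R]_n -> C), forall xi xi', col xi = col xi' ->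
    forall x, x \in X -> exists z : int, `|dot (xi' - xi) x - z%:~R| <= e.
Proof.
move=> e0; pose K := (Num.truncn e^-1).
have K1 : 0 < K.+1%:R :> R by rewrite ltr0n.
pose fr (t : R) := t - (Num.floor t)%:~R.
have fr0 t : 0 <= fr t by rewrite subr_ge0 floor_le.
have fr1 t : fr t < 1 by rewrite ltrBlDl -intrD1 floorD1_gt.
pose k t : 'I_K.+1 := inord (Num.truncn (fr t * K.+1%:R)).
exists {ffun 'I_(size X) -> 'I_K.+1}, (fun xi : 'rV[R]_n => [ffun i : 'I_(size X) => k (dot xi (nth 0 X i))]).
move=> xi xi' /ffunP h x xX; have iX : (index x X < size X)%N by rewrite index_mem.
have := h (Ordinal iX); rewrite !ffunE /= nth_index // dotBl.
set a := dot xi x; set b := dot xi' x => hk.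
have tr t : (k t)%:R <= fr t * K.+1%:R < (k t)%:R + 1.
  have h0 : 0 <= fr t * K.+1%:R by rewrite mulr_ge0.
  have kE : k t = Num.truncn (fr t * K.+1%:R) :> nat.
    rewrite inordK // -(ltr_nat R); apply: (@le_lt_trans _ _ (fr t * K.+1%:R)).
      by rewrite truncn_le.
    by rewrite gtr_pMl.
  by rewrite kE Num.Theory.truncn_le h0 natr1 Num.Theory.truncnS_gt.
exists (Num.floor b - Num.floor a); rewrite intrB.
have := tr a; have := tr b; rewrite hk => /andP[h1 h2] /andP[h3 h4].
have h5 : `|(fr b - fr a) * K.+1%:R| <= 1 by rewrite ler_norml; lra.
rewrite (_ : _ - _ = fr b - fr a); last by rewrite /fr; ring.
have : e^-1 < K.+1%:R by exact: truncnS_gt.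
move: h5; rewrite normrM (gtr0_norm K1) -ler_pdivlMr // mul1r => /le_trans h6 h7; apply: h6.
by rewrite -[e]invrK lef_pV2 ?posrE ?invr_gt0 // ltW.
Qed.

End phases.

Section product.
Context (R : realType) (n m : nat).
Variables (A : set 'rV[R]_n) (B : set 'rV[R]_m).
Hypotheses (bA : bset A) (bB : bset B).

Definition prod_set : set 'rV[R]_(n + m) := [set z | A (lsubmx z) /\ B (rsubmx z)].
Let D := prod_set.

Lemma measurable_lsubmx : measurable_fun setT (@lsubmx R 1 n m).
Proof. by apply: measurable_fun_rVP => i; under eq_fun do rewrite mxE; exact: measurable_coordR. Qed.

Lemma measurable_rsubmx : measurable_fun setT (@rsubmx R 1 n m).
Proof. by apply: measurable_fun_rVP => i; under eq_fun do rewrite mxE; exact: measurable_coordR. Qed.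

Lemma bset_prod : bset D.
Proof.
have [mA [r hr]] := bA; have [mB [r' hr']] := bB; split.
  rewrite (_ : D = (@lsubmx R 1 n m @^-1` A) `&` (@rsubmx R 1 n m @^-1` B)) //.
  apply: measurableI; rewrite -[X in measurable X]setTI.
    exact: measurable_lsubmx.
  exact: measurable_rsubmx.
exists (Num.max r r') => z [hA hB] i; rewrite -[z]hsubmxK; case: (splitP i) => j ij.
  rewrite (_ : i = lshift m j); last exact/val_inj.
  by rewrite row_mxEl le_max hr.
rewrite (_ : i = rshift n j); last exact/val_inj.
by rewrite row_mxEr le_max hr' ?orbT.
Qed.

Lemma indic_prod z : \1_D z = \1_A (lsubmx z) * \1_B (rsubmx z) :> R.
Proof.
rewrite !indicE -natrM mulnb; congr ((nat_of_bool _)%:R); apply/idP/andP => [|[]].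
  by rewrite inE => -[h1 h2]; rewrite !inE.
by rewrite !inE => h1 h2; split.
Qed.

Lemma vol_prod : vol D = vol A * vol B.
Proof.
rewrite /vol -In_prod; [|exact: nice_indic..].
by congr In; apply/funext => z; exact: indic_prod.
Qed.

Lemma dot_split (l z : 'rV[R]_(n + m)) : dot l z = dot (lsubmx l) (lsubmx z) + dot (rsubmx l) (rsubmx z).
Proof.
rewrite /dot big_split_ord; congr (_ + _); apply: eq_bigr => i _; by rewrite !mxE.
Qed.

Lemma sJ_prod l th : sJ D l th = sJ A (lsubmx l) 0 * sJ B (rsubmx l) (th + pi / 2) +
  sJ A (lsubmx l) (pi / 2) * sJ B (rsubmx l) th.
Proof.
rewrite /sJ -In_prod; [|exact: (nice_sJ _ _ bA)|exact: (nice_sJ _ _ bB)].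
rewrite -In_prod; [|exact: (nice_sJ _ _ bA)|exact: (nice_sJ _ _ bB)].
rewrite -In_D; [|exact: nice_prod (nice_sJ _ _ bA) (nice_sJ _ _ bB)..].
congr In; apply/funext => z; rewrite indic_prod dot_split mulrDr -addrA sinD addr0.
by rewrite addrA !sin_shift; ring.
Qed.

Lemma sJ_trig n' (P : set 'rV[R]_n') w th : bset P -> sJ P w th = cos th * sJ P w 0 + sin th * sJ P w (pi / 2).
Proof.
move=> bP; rewrite /sJ -!In_Z; [|exact: nice_sJ..].
rewrite -In_D; [|by apply: niceZ; exact: nice_sJ..].
by congr In; apply/funext => x; rewrite addr0 sin_shift sinD; ring.
Qed.

(** The transform of a product set is the product of the transforms; this is the absence of zero
    divisors in the complex numbers, in real coordinates. *)
Lemma sJ_prod_eq0 l : (forall th, sJ D l th = 0) ->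
  (forall th, sJ A (lsubmx l) th = 0) \/ (forall th, sJ B (rsubmx l) th = 0).
Proof.
move=> h; have := h (pi / 2); have := h 0; rewrite !sJ_prod.
rewrite [sJ B _ (pi / 2 + pi / 2)](sJ_trig _ _ bB) -splitr cospi sinpi mul0r addr0 mulN1r add0r.
set a := sJ A _ 0; set b := sJ A _ _; set c := sJ B _ 0; set e := sJ B _ _ => h1 h2.
have : (a ^+ 2 + b ^+ 2) * (c ^+ 2 + e ^+ 2) = 0.
  (* Multiplicativity of the squared modulus. *)
  rewrite (_ : _ * _ = (a * e + b * c) ^+ 2 + (a * - c + b * e) ^+ 2); last by ring.
  by rewrite h1 h2 expr0n addr0.
move=> /eqP; rewrite mulf_eq0 => /orP[]; rewrite paddr_eq0 ?sqr_ge0 // !sqrf_eq0 => /andP[/eqP e1 /eqP e2].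
  by left => th; rewrite sJ_trig // -/a -/b e1 e2 !mulr0 addr0.
by right => th; rewrite sJ_trig // -/c -/e e1 e2 !mulr0 addr0.
Qed.

Lemma sJ_prod_zero l : (forall th, sJ B (rsubmx l) th = 0) -> forall th, sJ D l th = 0.
Proof. by move=> h th; rewrite sJ_prod !h !mulr0 addr0. Qed.

End product.

(** * Fourier energy of a modulated tent *)

Section core.

Lemma half_le_double (R : realType) (h : R) : 0 < h -> 0 <= h / 2 /\ h / 2 <= 2 * h.
Proof. by move=> h0; split; lra. Qed.

Lemma max0_lip (R : realType) (a b h : R) : `|Num.max 0 (h - a) - Num.max 0 (h - b)| <= `|a - b|.
Proof.
have h5 := ler_norm (a - b); have h6 : - (a - b) <= `|a - b| by rewrite -normrN ler_norm.
rewrite ler_norml !maxEle; case: (leP 0 (h - a)) => h1; case: (leP 0 (h - b)) => h2; apply/andP; split; lra.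
Qed.

Context (R : realType) (n m : nat).
Variables (A : set 'rV[R]_n) (B : set 'rV[R]_m) (Lam : set 'rV[R]_(n + m)).
Hypotheses (bA : bset A) (bB : bset B).
Let D := prod_set A B.
Let V := vol D.
Hypothesis V0 : 0 < V.
Hypothesis orth : forall l l', Lam l -> Lam l' -> l != l' -> forall th, sJ D (l - l') th = 0.

Definition freqs (s : seq 'rV[R]_(n + m)) := [seq (l, b) | l <- s, b <- [:: false; true]].

Variables (x0 : 'rV[R]_n) (h : R).
Hypotheses (h0 : 0 < h) (hA : forall x : 'rV[R]_n, (forall i, `|x ord0 i - x0 ord0 i| <= 2 * h) -> A x).

Let bD : bset D := bset_prod bA bB.

(** A cone over an l1 ball in the [A] directions, independent of the [B] directions. It is supported
    at sup-distance [h] from [x0] while [A] contains the box of radius [2 h], so small shifts of the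
    tent along [A] stay in [A]. *)
Definition tent (z : 'rV[R]_(n + m)) : R :=
  Num.max 0 (h - \sum_i `|lsubmx z ord0 i - x0 ord0 i|).

Lemma measurable_tent : measurable_fun setT tent.
Proof.
apply: measurable_maxr => //; apply: measurable_funB => //; apply: measurable_sum => i.
apply: measurableT_comp => //; apply: measurable_funB => //.
by under eq_fun do rewrite mxE; exact: measurable_coordR.
Qed.

Lemma tent_ge0 z : 0 <= tent z. Proof. by rewrite le_max lexx. Qed.

Lemma tent_le z : tent z <= h.
Proof. by rewrite ge_max (ltW h0) /= lerBlDr lerDl sumr_ge0. Qed.

Lemma tent_norm z : `|tent z| <= h.
Proof. by rewrite ger0_norm ?tent_ge0 // tent_le. Qed.

Lemma tent_supp z : tent z != 0 -> forall i, `|lsubmx z ord0 i - x0 ord0 i| <= h.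
Proof.
move=> t0 i; rewrite leNgt; apply: contra_neqN t0 => hi; apply/max_idPl.
rewrite subr_le0 (bigD1 i) //= (le_trans (ltW hi)) // lerDl sumr_ge0 //.
Qed.

Lemma tent_lip z (i : 'I_n) (d : R) :
  `|tent z - tent (z - d *: delta_mx ord0 (lshift m i))| <= `|d|.
Proof.
have E : `|(\sum_j `|lsubmx z ord0 j - x0 ord0 j|) -
   (\sum_j `|lsubmx (z - d *: delta_mx ord0 (lshift m i)) ord0 j - x0 ord0 j|)| <= `|d|.
  rewrite -sumrB (bigD1 i) //= big1 ?addr0.
    apply: (le_trans (ler_dist_dist _ _)); rewrite !mxE !eqxx mulr1.
    by rewrite (_ : _ - _ - _ = d) //; ring.
  move=> j ji; rewrite !mxE /= eq_lshift (negbTE ji) mulr0 subr0 subrr //.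
exact: le_trans (max0_lip _ _ _) E.
Qed.

Definition aa mu th := In (fun z => \1_D z * (tent z * sin (2 * pi * dot mu z + th))).
(** The squared modulus of the Fourier coefficient of the tent on [D] at [mu]. *)
Definition ww mu := aa mu 0 ^+ 2 + aa mu (pi / 2) ^+ 2.
Let W := In (fun z => \1_D z * (tent z * tent z)).

Let nice_aa mu th : nice (fun z => \1_D z * (tent z * sin (2 * pi * dot mu z + th))).
Proof.
apply: (nice_indicM (c := h * 1)) => //.
  by apply: measurable_funM; [exact: measurable_tent|exact: measurable_sin_dot].
by move=> z; rewrite normrM ler_pM ?tent_norm ?norm_sin_le1.
Qed.

Lemma aa_trig mu th : aa mu th = cos th * aa mu 0 + sin th * aa mu (pi / 2).
Proof.
rewrite /aa -!In_Z // -In_D; [|exact: niceZ..].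
by congr In; apply/funext => x; rewrite addr0 sin_shift sinD; ring.
Qed.

Lemma ww_rot mu th : aa mu th ^+ 2 + aa mu (th + pi / 2) ^+ 2 = ww mu.
Proof.
rewrite aa_trig (aa_trig _ (_ + _)) sin_shift (_ : cos (th + pi / 2) = - sin th); last first.
  by rewrite cosD sin_pihalf cos_pihalf mulr0 sub0r mulr1.
rewrite /ww; have := cos2Dsin2 th; set a := aa _ 0; set b := aa _ _ => e.
by rewrite -[RHS]mul1r -e; ring.
Qed.

Lemma ww_ge0 mu : 0 <= ww mu. Proof. by rewrite addr_ge0 ?sqr_ge0. Qed.

Definition tent_wave c b z := tent z * ee c 0 b z.

Lemma bounded_meas_wave c : bounded_meas (tent_wave c).
Proof.
move=> b; have [me [k hk]] := bounded_meas_ee c 0 b; split.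
  by apply: measurable_funM => //; exact: measurable_tent.
by exists (h * k) => z; rewrite normrM ler_pM ?tent_norm.
Qed.

Lemma ip_wave_gen (g : 'rV[R]_(n + m) -> R) c l th (k : R) : measurable_fun setT g -> (forall z, `|g z| <= k) ->
  ip D (fun b z => g z * ee c 0 b z) (ee l th) =
  In (fun z => \1_D z * (g z * sin (2 * pi * dot (l - c) z + (th + pi / 2)))).
Proof.
move=> mg hg.
have hw : bounded_meas (fun b z => g z * ee c 0 b z).
  move=> b; have [me [k' hk]] := bounded_meas_ee c 0 b; split; first exact: measurable_funM.
  by exists (k * k') => z; rewrite normrM ler_pM.
rewrite /ip -In_D; [|exact: (bounded_measM bD _ hw (bounded_meas_ee _ _))..].
congr In; apply/funext => z; rewrite !ee_cos !ee_sin !addr0 addrA sin_shift.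
rewrite (_ : 2 * pi * dot (l - c) z + th = (2 * pi * dot l z + th) - 2 * pi * dot c z).
  by rewrite cosB; ring.
by rewrite dotBl; ring.
Qed.

Lemma ip_wave c l th : ip D (tent_wave c) (ee l th) = aa (l - c) (th + pi / 2).
Proof. by rewrite (ip_wave_gen _ _ _ measurable_tent tent_norm). Qed.

Lemma sum_freqs (s : seq 'rV[R]_(n + m)) (F : 'rV[R]_(n + m) * bool -> R) :
  \sum_(p <- freqs s) F p = \sum_(l <- s) (F (l, false) + F (l, true)).
Proof.
rewrite /freqs big_allpairs; apply: eq_bigr => l _.
by rewrite big_cons big_seq1.
Qed.

Lemma sum_wave c s : \sum_(p <- freqs s) ip D (tent_wave c) (ee2 p) ^+ 2 = \sum_(l <- s) ww (l - c).
Proof.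
rewrite sum_freqs; apply: eq_bigr => l _; rewrite !ip_wave /= /quarter add0r; exact: ww_rot.
Qed.

Lemma wave_norm c : ip D (tent_wave c) (tent_wave c) = W.
Proof.
rewrite /ip -In_D; [|exact: (bounded_measM bD _ (bounded_meas_wave _) (bounded_meas_wave _))..].
congr In; apply/funext => z; rewrite /tent_wave ee_cos ee_sin -mulrDr; congr (_ * _).
have := cos2Dsin2 (2 * pi * dot c z + 0); set C := cos _; set S := sin _ => e.
rewrite (_ : _ + _ = tent z * tent z * (C ^+ 2 + S ^+ 2)); last by ring.
by rewrite e mulr1.
Qed.

Lemma uniq_freqs s : uniq s -> uniq (freqs s).
Proof. by move=> us; apply: allpairs_uniq => // -[a b] [c e] _ _ [-> ->]. Qed.

Lemma orth_freqs s : {subset s <= Lam} -> forall p q, p \in freqs s -> q \in freqs s -> p != q ->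
  ip D (ee2 p) (ee2 q) = 0.
Proof.
move=> sL p q /allpairsP[[l b] /= [ls _ ->]] /allpairsP[[l' b'] /= [ls' _ ->]] pq.
apply: ip_ee2_orth => //= ll; apply: orth => //; rewrite -inE; exact: sL.
Qed.

Lemma W_gt0 : 0 < W.
Proof.
have [vA vB] : 0 < vol A /\ 0 < vol B.
  move: V0; rewrite /V vol_prod // => h1; have := vol_ge0 A; have := vol_ge0 B.
  by rewrite !le_eqVlt => /predU1P[e|->] /predU1P[e'|->] //; move: h1; rewrite -?e -?e' ?mul0r ?mulr0 ltxx.
have [hh hh2] : 0 <= h / 2 /\ h / 2 <= 2 * h by exact: half_le_double.
(* On the box of radius [d] about [x0] the [n] distances sum to at most [h / 2], so the tent is at
   least [h / 2] there. *)
pose d := h / 2 / n.+1%:R; have d0 : 0 < d by rewrite !divr_gt0.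
pose E := [set x : 'rV[R]_n | forall i, `[x0 ord0 i - d, x0 ord0 i + d]%classic (x ord0 i)].
have mE : measurable E by apply: (measurable_rV_prod (A := fun i => `[x0 ord0 i - d, x0 ord0 i + d]%classic)).
have dh : d <= 2 * h.
  have : d <= h / 2 by rewrite ler_pdivrMr // ler_peMr // ler1n.
  by move/le_trans; apply.
have EA : E `<=` A.
  move=> x Ex; apply: hA => i; have := Ex i; rewrite /= in_itv /= ler_norml; lra.
have bE : bset E by exact: bset_sub EA bA.
have vE : 0 < vol E.
  rewrite -lte_fin vol_fin // (borel_lebesgue_prod (A := fun i => `[x0 ord0 i - d, x0 ord0 i + d]%classic)) //.
  rewrite (eq_bigr (fun=> (2 * d)%:E)).
    by rewrite prodEFin lte_fin prodr_gt0 // => i _; rewrite mulr_gt0.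
  move=> i _; rewrite lebesgue_measure_itv /= lte_fin ifT; last by rewrite ltrD2l gtrN.
  by rewrite -EFinB; congr EFin; ring.
have bEB := bset_prod bE bB.
apply: (@lt_le_trans _ _ ((h / 2) ^+ 2 * vol (prod_set E B))).
  by rewrite mulr_gt0 ?exprn_gt0 ?divr_gt0 // vol_prod // mulr_gt0.
rewrite /vol -In_Z; last exact: nice_indic.
apply: In_le; first by apply: niceZ; exact: nice_indic.
  apply: (nice_indicM (c := h * h)) => //; first by apply: measurable_funM; exact: measurable_tent.
  by move=> z; rewrite normrM ler_pM ?tent_norm.
move=> z; rewrite !indicE; case: (boolP (z \in prod_set E B)) => [|_]; last first.
  by rewrite mulr0 !mulr_ge0 ?tent_ge0.
rewrite inE => -[Ez Bz]; rewrite mem_set; last by split => //; exact: EA.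
rewrite mulr1 mul1r expr2.
suff ht : h / 2 <= tent z by rewrite ler_pM // divr_ge0 // ltW.
rewrite le_max; apply/orP; right.
suff : \sum_i `|lsubmx z ord0 i - x0 ord0 i| <= h / 2 by lra.
apply: (@le_trans _ _ (\sum_(i < n) d)).
  by apply: ler_sum => i _; have := Ez i; rewrite /= in_itv /= ler_norml; lra.
rewrite sumr_const card_ord; apply: (@le_trans _ _ (d * n.+1%:R)).
  by rewrite -[d *+ n]mulr_natr ler_pM2l // ler_nat.
by rewrite /d divfK // pnatr_eq0.
Qed.

(** Shifting the tent by [d] rotates its coefficient at [mu] by the phase [2 pi d mu_i]. Since
    [d <= h] the shifted support remains in [A], and the indicator of [D] is not affected. *)
Lemma shifted_wave c l (i : 'I_n) (d th : R) : 0 < d -> d <= h ->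
  let mu := l - c in
  ip D (fun b (z : 'rV[R]_(n + m)) => (tent z - tent (z - d *: delta_mx ord0 (lshift m i))) * ee c 0 b z) (ee l th) =
  aa mu (th + pi / 2) - aa mu (th + pi / 2 + 2 * pi * d * mu ord0 (lshift m i)).
Proof.
move=> d0 dh /=; set e := d *: delta_mx _ _; set mu := l - c; set t := th + pi / 2.
have mt : measurable_fun setT (fun z : 'rV[R]_(n + m) => tent (z - e)).
  apply: (measurableT_comp measurable_tent); apply: measurable_fun_rVP => j.
  by under eq_fun do rewrite !mxE; apply: measurable_funB => //; exact: measurable_coordR.
rewrite (ip_wave_gen _ _ _ (k := h + h)); last 2 first.
- by apply: measurable_funB => //; exact: measurable_tent.
- by move=> z; apply: (le_trans (ler_normB _ _)); rewrite lerD ?tent_norm.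
have n2 : nice (fun z : 'rV[R]_(n + m) => \1_D z * (tent (z - e) * sin (2 * pi * dot mu z + t))).
  apply: (nice_indicM (c := h * 1)) => //; first by apply: measurable_funM => //; exact: measurable_sin_dot.
  by move=> z; rewrite normrM ler_pM ?tent_norm ?norm_sin_le1.
transitivity (aa mu t - In (fun z : 'rV[R]_(n + m) => \1_D z * (tent (z - e) * sin (2 * pi * dot mu z + t)))).
  by rewrite /aa -In_B //; congr In; apply/funext => z; ring.
congr (_ - _); rewrite (In_aff (a := 1) e _ n2) ?oner_eq0 // normr1 expr1n mul1r.
congr In; apply/funext => z; rewrite scale1r addrK dotDr.
have -> : dot mu e = d * mu ord0 (lshift m i).
  rewrite /e dotZr; congr (_ * _); rewrite /dot (bigD1 (lshift m i)) //= [delta_mx _ _ _ _]mxE !eqxx mulr1 big1 ?addr0 // => j ji.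
  by rewrite [delta_mx _ _ _ _]mxE eqxx (negbTE ji) mulr0.
have -> : sin (2 * pi * (dot mu z + d * mu ord0 (lshift m i)) + t) =
    sin (2 * pi * dot mu z + (t + 2 * pi * d * mu ord0 (lshift m i))) by congr sin; ring.
rewrite !mulrA; congr (_ * _).
have [->|tz] := eqVneq (tent z) 0; first by rewrite !mulr0.
congr (_ * _); have hz := tent_supp tz.
have rz : rsubmx (z + e) = rsubmx z.
  by apply/rowP => j; rewrite !mxE /= eq_sym eq_lrshift mulr0 addr0.
rewrite !indic_prod rz; congr (_ * _); rewrite !indicE !mem_set //.
  by apply: hA => j; apply: (le_trans (hz j)); lra.
apply: hA => j; have := hz j; rewrite !mxE /= eq_lshift.
have : `|d * (j == i)%:R| <= h by case: eqP; rewrite ?mulr1 ?mulr0 ?normr0 ?gtr0_norm // ltW.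
by rewrite !ler_norml; lra.
Qed.

(** Bessel for the difference of the tent and its shift by [d]. Its squared norm is at most
    [d ^ 2 V] by the Lipschitz bound, and its coefficients are those of the tent times a factor of
    squared modulus [4 sin ^ 2 (pi d mu_i)], at least [(pi d mu_i) ^ 2] for small [d]. The [d ^ 2]
    cancels, so the choice of [d] according to [s] leaves no trace. *)
Lemma tail_sum c (i : 'I_n) s : uniq s -> {subset s <= Lam} ->
  \sum_(l <- s) (l - c) ord0 (lshift m i) ^+ 2 * ww (l - c) <= V ^+ 2.
Proof.
move=> us sL; have [eta eta0 hs] := sin_sqr_ge R.
pose M := 1 + \sum_(l <- s) `|(l - c) ord0 (lshift m i)|.
have M0 : 0 < M by rewrite ltr_wpDr ?sumr_ge0.
have hM l : l \in s -> `|(l - c) ord0 (lshift m i)| <= M.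
  move=> ls; rewrite /M (big_rem l) //=.
  have : 0 <= \sum_(y <- rem l s) `|(y - c) ord0 (lshift m i)| by rewrite sumr_ge0.
  lra.
have p0 : 0 < pi :> R := pi_gt0 R.
(* Keeps every [pi d mu_i] with frequency in [s] in the range where [sin_sqr_ge] holds. *)
pose d := Num.min h (eta / (pi * M)).
have d0 : 0 < d by rewrite lt_min h0 divr_gt0 // mulr_gt0.
have dh : d <= h by rewrite ge_min lexx.
have dM : pi * d * M <= eta by rewrite mulrAC mulrC -ler_pdivlMr ?mulr_gt0 // ge_min lexx orbT.
pose g b (z : 'rV[R]_(n + m)) := (tent z - tent (z - d *: delta_mx ord0 (lshift m i))) * ee c 0 b z.
have mt : measurable_fun setT (fun z : 'rV[R]_(n + m) => tent (z - d *: delta_mx ord0 (lshift m i))).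
  apply: (measurableT_comp measurable_tent); apply: measurable_fun_rVP => j.
  by under eq_fun do rewrite !mxE; apply: measurable_funB => //; exact: measurable_coordR.
have mg : measurable_fun setT (fun z : 'rV[R]_(n + m) => tent z - tent (z - d *: delta_mx ord0 (lshift m i))).
  by apply: measurable_funB => //; exact: measurable_tent.
have hg : bounded_meas g.
  move=> b; have [me [k hk]] := bounded_meas_ee c 0 b; split; first exact: measurable_funM.
  exists (`|d| * k) => z; rewrite normrM ler_pM //; exact: tent_lip.
have gg : ip D g g <= d ^+ 2 * V.
  rewrite /ip -In_D; [|exact: (bounded_measM bD _ hg hg)..].
  rewrite /V /vol -In_Z; last exact: nice_indic.
  apply: In_le; [by apply: niceD; exact: bounded_measM|by apply: niceZ; exact: nice_indic|].
  move=> z; rewrite -mulrDr mulrC ler_wpM2r ?indicE // /g ee_cos ee_sin.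
  rewrite (_ : forall a C S : R, a * C * (a * C) + a * S * (a * S) = a ^+ 2 * (C ^+ 2 + S ^+ 2)); last by move=> *; ring.
  rewrite cos2Dsin2 mulr1 -[leLHS]real_normK ?num_real // ler_sqr ?nnegrE ?(ltW d0) //.
  by apply: (le_trans (tent_lip _ _ _)); rewrite gtr0_norm.
have := @bessel R (n + m) D bD _ (@ee2 R (n + m)) V (fun p => bounded_meas_ee _ _) (ip_ee2_norm bD) V0 (freqs s) g (uniq_freqs us) (orth_freqs sL) hg.
rewrite sum_freqs => hb.
have step l : l \in s -> (d * pi) ^+ 2 * ((l - c) ord0 (lshift m i) ^+ 2 * ww (l - c)) <=
   ip D g (ee2 (l, false)) ^+ 2 + ip D g (ee2 (l, true)) ^+ 2.
  move=> ls; rewrite /ee2 /quarter /= !shifted_wave // add0r.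
  set mu := l - c; set x := mu ord0 _; set ph := 2 * pi * d * x.
  have -> : (aa mu (pi / 2) - aa mu (pi / 2 + ph)) ^+ 2 + (aa mu (pi / 2 + pi / 2) - aa mu (pi / 2 + pi / 2 + ph)) ^+ 2 =
     2 * (1 - cos ph) * ww mu.
    rewrite -splitr !(aa_trig mu (_ + ph)) (aa_trig mu pi) !(cosD _ ph) !(sinD _ ph) cospi sinpi cos_pihalf sin_pihalf /ww.
    have := cos2Dsin2 ph; set a := aa _ 0; set b := aa _ _; set C := cos _; set S := sin _ => e.
    rewrite (_ : 2 * (1 - C) = 1 - 2 * C + 1); last by ring.
    by rewrite -[X in _ - _ + X]e; ring.
  have -> : cos ph = 1 - 2 * sin (ph / 2) ^+ 2.
    rewrite [ph in LHS](splitr ph) cosD -!expr2; have := cos2Dsin2 (ph / 2); lra.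
  rewrite mulrA ler_wpM2r ?ww_ge0 //.
  have := hs (ph / 2).
  have -> : ph / 2 = pi * d * x by rewrite /ph; field.
  rewrite normrM => hs'; have := hs' (le_trans _ dM).
  have : `|pi * d| * `|x| <= pi * d * M.
    by rewrite gtr0_norm ?mulr_gt0 // ler_pM2l ?mulr_gt0 // hM.
  move=> k1 /(_ k1); nra.
set S := \sum_(l <- s) (l - c) ord0 (lshift m i) ^+ 2 * ww (l - c).
have H1 : (d * pi) ^+ 2 * S <= \sum_(l <- s) (ip D g (ee2 (l, false)) ^+ 2 + ip D g (ee2 (l, true)) ^+ 2).
  by rewrite mulr_sumr [leLHS]big_seq [leRHS]big_seq; apply: ler_sum => l /step.
have H := le_trans H1 (le_trans hb (ler_wpM2l (ltW V0) gg)).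
have S0 : 0 <= S by rewrite sumr_ge0 // => l _; rewrite mulr_ge0 ?ww_ge0 ?sqr_ge0.
have pi1 : 1 <= pi :> R by have := pi_ge2 R; lra.
have p2 : 1 <= pi ^+ 2 :> R by rewrite exprn_ege1.
apply: (@le_trans _ _ (pi ^+ 2 * S)); first by rewrite ler_peMl.
have d2 : 0 < d ^+ 2 by rewrite exprn_gt0.
by rewrite -(ler_pM2l d2); move: H; rewrite exprMn; lra.
Qed.

End core.

(** * Frequencies captured near separated centres *)

Section capture.
Context (R : realType) (n m : nat).
Variables (A : set 'rV[R]_n) (B : set 'rV[R]_m) (Lam : set 'rV[R]_(n + m)).
Hypotheses (bA : bset A) (bB : bset B).
Let D := prod_set A B.
Let V := vol D.
Hypothesis V0 : 0 < V.
Hypothesis orth : forall l l', Lam l -> Lam l' -> l != l' -> forall th, sJ D (l - l') th = 0.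

Hypothesis compl : forall f, bounded_meas f -> forall e : R, 0 < e ->
  exists s, [/\ uniq s, {subset s <= Lam} &
    exists c, ip D (residual (@ee2 R (n + m)) (freqs s) c f) (residual (@ee2 R (n + m)) (freqs s) c f) < e].
Variables (x0 : 'rV[R]_n) (h : R).
Hypotheses (h0 : 0 < h) (hA : forall x : 'rV[R]_n, (forall i, `|x ord0 i - x0 ord0 i| <= 2 * h) -> A x).

Let bD : bset D := bset_prod bA bB.

Local Notation ww := (ww A B x0 h).
Local Notation tent_wave := (tent_wave x0 h).
Let W := In (fun z => \1_D z * (tent x0 h z * tent x0 h z)).
Let W_gt0 : 0 < W := W_gt0 bA bB V0 h0 hA.
Let bounded_meas_wave (c : 'rV[R]_(n + m)) : bounded_meas (tent_wave c).
Proof. exact: (bounded_meas_wave x0 h0 c). Qed.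

Lemma capture (c : 'rV[R]_(n + m)) (e : R) : 0 < e -> exists s, [/\ uniq s, {subset s <= Lam} &
  V * (W - e) <= \sum_(l <- s) ww (l - c)].
Proof.
move=> e0; have [s [us sL [k hk]]] := compl (bounded_meas_wave c) e0.
exists s; split => //; rewrite -(sum_wave bA bB x0 h0).
have := @best_approx R (n + m) D bD _ (@ee2 R (n + m)) V (fun p => bounded_meas_ee _ _) (ip_ee2_norm bD) (freqs s) k _ (uniq_freqs us) (orth_freqs bA bB orth sL) (bounded_meas_wave c).
by apply: le_trans; rewrite ler_pM2l // (wave_norm bA bB x0 h0) lerD2l lerN2 ltW.
Qed.

(** From Chebyshev's inequality: by [tail_sum] the frequencies beyond radius [r] carry energy at
    most [n V ^ 2 / r ^ 2], and this value makes it at most [V W / 4]. The summand 1 ensures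
    [r <= r ^ 2]. *)
Definition capture_radius := 1 + 4 * n%:R * V / W.

Lemma capture_radius_gt0 : 0 < capture_radius.
Proof. by rewrite ltr_pwDl // !mulr_ge0 ?invr_ge0 ?(ltW V0) ?(ltW W_gt0). Qed.

Lemma capture_near (c : 'rV[R]_(n + m)) : exists s, [/\ uniq s, {subset s <= Lam},
  forall l, l \in s -> forall i : 'I_n, `|(l - c) ord0 (lshift m i)| <= capture_radius &
  V * W / 2 <= \sum_(l <- s) ww (l - c)].
Proof.
have W0 := W_gt0; have r0 := capture_radius_gt0.
(* A quarter of [V W] is given up here and a quarter to the far frequencies, which leaves half. *)
have [s [us sL hs]] := capture c (divr_gt0 W0 (ltr0n R 4)).
pose P l := [forall i : 'I_n, `|(l - c) ord0 (lshift m i)| <= capture_radius].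
exists [seq l <- s | P l]; split.
- exact: filter_uniq.
- by move=> l; rewrite mem_filter => /andP[_ /sL].
- by move=> l; rewrite mem_filter => /andP[/forallP].
rewrite big_filter; move: hs; rewrite (bigID P) /=; set a := \sum_(l <- s | P l) _ => hs.
suff : \sum_(l <- s | ~~ P l) ww (l - c) <= V * W / 4 by move: hs; rewrite /a; lra.
apply: (@le_trans _ _ (\sum_(l <- s) \sum_(i < n) capture_radius ^- 2 * ((l - c) ord0 (lshift m i) ^+ 2 * ww (l - c)))).
  rewrite big_mkcond; apply: ler_sum => l _; have pos (i : 'I_n) : 0 <= capture_radius ^- 2 * ((l - c) ord0 (lshift m i) ^+ 2 * ww (l - c)).
    apply: mulr_ge0; first by rewrite invr_ge0 exprn_ge0 // ltW.
    by apply: mulr_ge0; [exact: sqr_ge0|exact: ww_ge0].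
  case: ifPn => [|_]; last by rewrite sumr_ge0.
  rewrite negb_forall => /existsP[i]; rewrite -ltNge => hi; rewrite (bigD1 i) //=.
  rewrite ler_wpDr ?sumr_ge0 // mulrA ler_peMl ?ww_ge0 // mulrC ler_pdivlMr ?exprn_gt0 // mul1r.
  by rewrite -[leRHS]real_normK ?num_real // ler_sqr ?nnegrE ?normr_ge0 ?(ltW r0) // ltW.
rewrite exchange_big /=; apply: (@le_trans _ _ (\sum_(i < n) capture_radius ^- 2 * V ^+ 2)).
  apply: ler_sum => i _; rewrite -mulr_sumr ler_pM2l ?invr_gt0 ?exprn_gt0 //; exact: (tail_sum bA bB V0 orth h0 hA).
rewrite sumr_const card_ord -[leLHS]mulr_natr -mulrA.
rewrite ler_pdivrMl ?exprn_gt0 //.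
have rr : capture_radius <= capture_radius ^+ 2.
  by rewrite expr2 ler_peMr ?(ltW r0) // lerDl !mulr_ge0 ?invr_ge0 ?(ltW V0) ?(ltW W0).
have VW : 0 < V * W / 4 by rewrite divr_gt0 // mulr_gt0.
apply: (@le_trans _ _ (capture_radius * (V * W / 4))); last by rewrite ler_pM2r.
rewrite /capture_radius mulrDl [X in _ <= _ + X](_ : _ = V ^+ 2 * n%:R); first by rewrite lerDr mul1r ltW.
by field; rewrite gt_eqF.
Qed.

Lemma zeros_of_transform (X : seq 'rV[R]_n) (e : R) (c : nat -> 'rV[R]_n) : 0 < e ->
  (forall j k, (j < k)%N -> exists i, 2 * capture_radius < `|c k ord0 i - c j ord0 i|) ->
  exists j k (xi : 'rV[R]_n), [/\ (j < k)%N, forall i, `|xi ord0 i - (c k ord0 i - c j ord0 i)| <= 2 * capture_radius,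
    forall x, x \in X -> exists z : int, `|dot xi x - z%:~R| <= e & forall th, sJ A xi th = 0].
Proof.
move=> e0 sep; apply: contrapT => no.
have W0 := W_gt0.
have [C [col hcol]] := phase_colouring X e0.
pose cc j : 'rV[R]_(n + m) := row_mx (c j) 0.
have [s_ hs] := choice (fun j => capture_near (cc j)).
(* Each centre captures energy at least [V W / 2] and each colour will carry at most [V W], so more
   than [2 #|C|] centres are contradictory. *)
pose J := (2 * #|C|).+1.
pose Q0 := [seq (j, l) | j <- iota 0 J, l <- s_ j].
have Q0P p : p \in Q0 -> p.2 \in s_ p.1 by move=> /allpairsPdep[j [l [_ ls ->]]].
have uQ0 : uniq Q0.
  apply: allpairs_uniq_dep; first exact: iota_uniq.
    by move=> j _; have [] := hs j.
  by move=> [j l] [j' l'] _ _ /= [-> ->].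
(* Frequencies shifted by their centres, hence near 0. The shift leaves the [B] components
   unchanged, so zeros of the transform of [B] survive it. *)
pose u (i : (nat * 'rV[R]_(n + m)) * bool) := ee2 (i.1.2 - cc i.1.1, i.2).
have later p q : p \in Q0 -> q \in Q0 -> (q.1 < p.1)%N -> col (lsubmx p.2) = col (lsubmx q.2) ->
    forall b b', ip D (u (p, b)) (u (q, b')) = 0.
  move=> /Q0P pQ /Q0P qQ qp cpq b b'; rewrite (ip_ee bD) /=.
  have [_ sLp np _] := hs p.1; have [_ sLq nq _] := hs q.1.
  have lc k i (l : 'rV[R]_(n + m)) : (l - cc k) ord0 (lshift m i) = l ord0 (lshift m i) - c k ord0 i.
    by rewrite mxE [X in _ + X]mxE row_mxEl.
  (* One frequency cannot lie within the capture radius of two centres that are more than twice that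
     radius apart. *)
  have pq : p.2 != q.2.
    apply/eqP => e1; have [i] := sep _ _ qp; apply/negP; rewrite -leNgt.
    have := np _ pQ i; have := nq _ qQ i; rewrite !lc e1 !ler_norml; lra.
  have [|z|z] := @sJ_prod_eq0 R n m A B bA bB (p.2 - q.2).
  - by move=> th; apply: orth => //; rewrite -inE; [exact: sLp|exact: sLq].
  - exfalso; apply: no; exists q.1, p.1, (lsubmx (p.2 - q.2)); split => //.
      move=> i; have := np _ pQ i; have := nq _ qQ i; rewrite !lc !mxE !ler_norml; lra.
    move=> x xX; have [w hw] := hcol _ _ (esym cpq) x xX; exists w; move: hw.
    by rewrite (_ : lsubmx (p.2 - q.2) = lsubmx p.2 - lsubmx q.2) //; apply/rowP => i; rewrite !mxE.
  - apply: (sJ_prod_zero bA bB) => th'.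
    suff -> : rsubmx (p.2 - cc p.1 - (q.2 - cc q.1)) = rsubmx (p.2 - q.2) by exact: z.
    rewrite (_ : p.2 - cc p.1 - (q.2 - cc q.1) = (p.2 - q.2) + row_mx (c q.1 - c p.1) 0).
      by rewrite linearD /= row_mxKr addr0.
    rewrite opprD opprK addrACA; congr (_ + _).
    by rewrite /cc opp_row_mx add_row_mx oppr0 addr0 addrC.
have perC (kap : C) : \sum_(p <- Q0 | col (lsubmx p.2) == kap) ww (p.2 - cc p.1) <= V * W.
  rewrite -big_filter; set Q := [seq p <- Q0 | _].
  pose I := [seq (p, b) | p <- Q, b <- [:: false; true]].
  have uI : uniq I by apply: allpairs_uniq; [exact: filter_uniq|by []|move=> [? ?] [? ?] _ _ [-> ->]].
  have QP p : p \in Q -> p \in Q0 /\ col (lsubmx p.2) = kap.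
    by rewrite mem_filter => /andP[/eqP].
  (* After the shift one function, the unmodulated tent, has all the captured energies as its
     coefficients. *)
  have := @bessel R (n + m) D bD _ u V (fun p => bounded_meas_ee _ _) (fun p => ip_ee2_norm bD _) V0 I (tent_wave 0) uI.
  rewrite (wave_norm bA bB x0 h0) => H; apply: le_trans (H _ (bounded_meas_wave 0)).
    rewrite /I big_allpairs; apply: ler_sum => p _.
    by rewrite big_cons big_seq1 /u /= !(ip_wave bA bB x0 h0) !subr0 /= /quarter add0r (ww_rot bA bB x0 h0).
  move=> i j /allpairsP[[p b] /= [/QP[pQ cp] _ ->]] /allpairsP[[q b'] /= [/QP[qQ cq] _ ->]] pq.
  have [lt|lt|ee] := ltngtP p.1 q.1.
  - by rewrite ipC; apply: later; rewrite ?cp.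
  - by apply: later; rewrite ?cp.
  - apply: ip_ee2_orth => //= [|].
      rewrite ee => h1 th; rewrite opprD opprK addrACA addNr addr0; apply: orth.
      + by rewrite -inE; have [_ h2 _ _] := hs p.1; apply: h2; exact: Q0P.
      + by rewrite -inE; have [_ h2 _ _] := hs q.1; apply: h2; exact: Q0P.
      + by apply: contra h1 => /eqP ->.
    apply: contra pq => /eqP[]; rewrite ee => /addIr e1 ->.
    by case: (p) (q) ee e1 => ? ? [? ?] /= -> ->.
have total : J%:R * (V * W / 2) <= \sum_(p <- Q0) ww (p.2 - cc p.1).
  rewrite /Q0 big_allpairs_dep /= -[X in X%:R * _](size_iota 0 J) mulr_natl.
  have -> : (V * W / 2) *+ size (iota 0 J) = \sum_(j <- iota 0 J) (V * W / 2).
    by rewrite big_const_seq count_predT iter_addr_0.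
  by apply: ler_sum => j _; have [] := hs j.
have : \sum_(p <- Q0) ww (p.2 - cc p.1) <= #|C|%:R * (V * W).
  rewrite (partition_big (fun p : nat * 'rV[R]_(n + m) => col (lsubmx p.2)) xpredT) //=.
  apply: (@le_trans _ _ (\sum_(kap : C) V * W)); first by apply: ler_sum => kap _; exact: perC.
  by rewrite sumr_const mulr_natl.
move/(le_trans total); rewrite /J -natr1 natrM.
have VW : 0 < V * W by exact: mulr_gt0.
by move=> H; have : (2 * #|C|%:R + 1) * (V * W / 2) <= #|C|%:R * (V * W) := H; nra.
Qed.

End capture.

(** * From Lebesgue to Borel sets *)

Section completion.
Context (R : realType) (n : nat).
Local Notation bl := (borel_lebesgue R n).
Local Notation leb := (lebesgue_rV R n).
Local Notation L := (lebesgue_type R n).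

Lemma leb_borel (E : set 'rV[R]_n) : measurable E -> leb E = bl E.
Proof. by move=> mE; exact: measurable_mu_extE. Qed.

Lemma borel_leb_measurable (E : set 'rV[R]_n) : measurable E -> lebesgue_measurable E.
Proof. exact: caratheodory_measurable_mu_ext. Qed.

(** Countable Borel covers of [E] with excess [1 / (k + 1)] are intersected over [k] and cut down to
    [K]. *)
Lemma outer_borel (E K : set 'rV[R]_n) : E `<=` K -> measurable K -> (bl K < +oo)%E ->
  exists F : set 'rV[R]_n, [/\ measurable F, E `<=` F, F `<=` K & (bl F = (bl^*)%mu E)%E].
Proof.
move=> EK mK Kfin.
have Efin : ((bl^*)%mu E < +oo)%E.
  by apply: le_lt_trans Kfin; rewrite -(leb_borel mK); exact: le_mu_ext.
have inv0 k : 0 < k.+1%:R^-1 :> R by rewrite invr_gt0.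
have cov k : exists A : (set 'rV[R]_n)^nat, measurable_cover E A /\
    (\sum_(0 <= i <oo) bl (A i) < (bl^*)%mu E + k.+1%:R^-1%:E)%E.
  have fn : (bl^*)%mu E \is a fin_num by rewrite ge0_fin_numE // mu_ext_ge0.
  by move: fn => /lb_ereal_inf_adherent => /(_ _ (inv0 k))[_ [A cA <-] ?]; exists A.
have [A hA] := choice cov.
pose F := K `&` \bigcap_k \bigcup_i A k i.
have mU k : measurable (\bigcup_i A k i) by apply: bigcupT_measurable => i; have [[/(_ i)]] := hA k.
have mF : measurable F by apply: measurableI => //; exact: bigcapT_measurable.
have EF : E `<=` F.
  by move=> x Ex; split; [exact: EK|move=> k _; have [[_ h] _] := hA k; exact: h].
exists F; split => //; first by move=> x [].
apply/eqP; rewrite eq_le; apply/andP; split; last by rewrite -(leb_borel mF); exact: le_mu_ext.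
apply/lee_addgt0Pr => e e0.
have [k hk] : exists k, k.+1%:R^-1 <= e.
  exists (Num.truncn e^-1); rewrite -[X in _ <= X]invrK lef_pV2 ?posrE ?invr_gt0 //.
  by rewrite ltW // Num.Theory.truncnS_gt.
apply: (@le_trans _ _ (bl (\bigcup_i A k i))).
  by apply: le_measure; rewrite ?inE // => x [_ h]; exact: h.
apply: (@le_trans _ _ (\sum_(0 <= i <oo) bl (A k i))%E).
  apply: measure_sigma_subadditive => //.
  by move=> i; have [[/(_ i)]] := hA k.
have [_ /ltW h] := hA k; apply: (le_trans h); rewrite leeD2l // lee_fin.
Qed.

(** [outer_borel] is applied to [E] and to its complement in a box; [G] is the complement of the
    second hull, and the difference of the first hull and [G] is the null set. *)
Lemma lebesgue_inner_borel (E : set 'rV[R]_n) (r : R) : lebesgue_measurable E ->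
  (forall x, E x -> forall i, `|x ord0 i| <= r) ->
  exists G N : set 'rV[R]_n, [/\ bset G, bset N, G `<=` E, E `\` G `<=` N & vol N = 0].
Proof.
move=> mE hr; have mK := @measurable_box R n r; have Kfin := @box_lty R n r.
have EK : E `<=` @box R n r by move=> x Ex i; have := hr x Ex i; rewrite /= in_itv /= ler_norml.
have [F [mF EF FK vF]] := outer_borel EK mK Kfin.
have [F' [mF' EF' F'K vF']] := @outer_borel (@box R n r `\` E) (@box R n r) (@subDsetl _ _ _) mK Kfin.
have bF : bset F by exact: bset_sub mF FK (bset_box n r).
have bF' : bset F' by exact: bset_sub mF' F'K (bset_box n r).
pose G := @box R n r `\` F'.
have bG : bset G by exact: bsetD (bset_box n r) mF'.
have GE : G `<=` E by move=> x [Kx nF']; apply: contrapT => nE; apply: nF'; exact: EF'.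
have mG : measurable G by case: bG.
exists G, (F `\` G); split => //; first exact: bsetD.
  by move=> x [Ex nG]; split => //; exact: EF.
have GF : G `<=` F by move=> x /GE /EF.
have : vol F = vol G + vol (F `\` G).
  by rewrite (vol_setDI bF mG); congr (vol _ + _); apply/seteqP; split => x; [case|move=> Gx; split => //; exact: GF].
have : vol (@box R n r) = vol F' + vol G.
  rewrite (vol_setDI (bset_box n r) mF'); congr (vol _ + _); apply/seteqP; split => x; first by case.
  by move=> F'x; split => //; exact: F'K.
have : vol (@box R n r) = vol F + vol F'.
  apply: EFin_inj; rewrite EFinD !vol_fin ?vF ?vF' //; last exact: bset_box.
  (* Caratheodory's criterion for [E], tested on the box, says that the outer measures of the two
     parts add up. *)
  rewrite -(leb_borel mK); have := mE (@box R n r).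
  by rewrite (_ : _ `&` E = E) ?setDE //; apply/seteqP; split => x; [case|move=> Ex; split => //; exact: EK].
lra.
Qed.

Let idm : L -> 'rV[R]_n := id.
Let midm : measurable_fun setT idm.
Proof. by move=> _ Y mY; rewrite setTI; exact: borel_leb_measurable. Qed.

Lemma measurable_borel_leb d' (T : measurableType d') (D : set 'rV[R]_n) (f : 'rV[R]_n -> T) :
  measurable_fun setT f -> measurable_fun (D : set L) (f : L -> T).
Proof.
move=> mf; apply: (measurable_funS measurableT) => //.
exact: (measurableT_comp mf midm).
Qed.

Lemma ge0_integral_leb (D : set 'rV[R]_n) (f : 'rV[R]_n -> \bar R) : measurable D ->
  measurable_fun setT f -> (forall x, 0 <= f x)%E ->
  (\int[leb]_(x in D) f x = \int[bl]_(x in D) f x)%E.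
Proof.
move=> mD mf f0.
have := @ge0_integral_pushforward _ _ _ _ R idm midm leb D f mD (measurable_funTS mf) (fun x _ => f0 x).
move=> <-; apply: eq_measure_integral => E mE _.
exact: leb_borel.
Qed.

Section inner_approximation.
Variables (E D N : set 'rV[R]_n).
Hypotheses (mE : lebesgue_measurable E) (bD : bset D) (bN : bset N) (DE : D `<=` E)
  (EDN : E `\` D `<=` N) (N0 : vol N = 0).

Let mD : measurable D. Proof. by case: bD. Qed.

Let lD : @measurable _ L D. Proof. exact: borel_leb_measurable. Qed.

Lemma null_diff : leb (E `\` D) = 0%E.
Proof.
apply/eqP; rewrite eq_le measure_ge0 andbT.
have mN : measurable N by case: bN.
apply: (@le_trans _ _ (leb N)).
  by apply: le_measure => //; rewrite inE; [exact: measurableD|exact: borel_leb_measurable].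
by rewrite leb_borel // -vol_fin // N0.
Qed.

Lemma ge0_integral_approx (f : 'rV[R]_n -> \bar R) : measurable_fun setT f -> (forall x, 0 <= f x)%E ->
  (\int[leb]_(x in E) f x = \int[bl]_(x in D) f x)%E.
Proof.
move=> mf f0; rewrite -ge0_integral_leb //.
have mED : measurable (E `\` D : set L) by exact: measurableD.
have -> := @ge0_negligible_integral _ L R leb (E : set L) (E `\` D : set L) f mED mE
  (measurable_borel_leb mf) (fun x _ => f0 x) null_diff.
by rewrite setDD (_ : E `&` D = D) //; apply/seteqP; split => x; [case|move=> Dx; split => //; exact: DE].
Qed.

Lemma integral_approx (f : 'rV[R]_n -> R) (c : R) : measurable_fun setT f -> (forall x, `|f x| <= c) ->
  (\int[leb]_(x in E) (f x)%:E = (In (fun x => \1_D x * f x))%:E)%E.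
Proof.
move=> mf hf; have nf := nice_indicM bD mf hf.
transitivity (\int[bl]_(x in D) (f x)%:E)%E.
  have mfe : measurable_fun setT (EFin \o f) by exact/measurable_EFinP.
  rewrite integralE [RHS]integralE; congr (_ - _)%E.
    by apply: ge0_integral_approx => //; exact: measurable_funepos.
  by apply: ge0_integral_approx => //; exact: measurable_funeneg.
rewrite integral_mkcond /In /Rintegral fineK; last first.
  by apply: integrable_fin_num => //; exact: nice_int.
apply: eq_integral => x _; rewrite patchE indicE; case: ifP => _; by rewrite ?mul1r ?mul0r.
Qed.

End inner_approximation.
End completion.

(** * Translation of the spectral hypotheses into real integrals over a Borel set *)

Section from_spectrum.
Import mathcomp.real_closed.complex.
Context (R : realType) (d : nat).
Local Notation bl := (borel_lebesgue R d).
Local Notation leb := (lebesgue_rV R d).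
Local Notation L := (lebesgue_type R d).
Variables (E D N : set 'rV[R]_d) (Lam : set 'rV[R]_d).
Hypotheses (mE : lebesgue_measurable E) (bD : bset D) (bN : bset N) (DE : D `<=` E)
  (EDN : E `\` D `<=` N) (N0 : vol N = 0).

Lemma Re_mul (x y : R[i]) : complex.Re (x * y) = complex.Re x * complex.Re y - complex.Im x * complex.Im y.
Proof. by case: x => a b; case: y. Qed.

Lemma Im_mul (x y : R[i]) : complex.Im (x * y) = complex.Re x * complex.Im y + complex.Im x * complex.Re y.
Proof. by case: x => a b; case: y. Qed.

Lemma Re_conj (x : R[i]) : complex.Re (x^*)%C = complex.Re x.
Proof. by case: x. Qed.

Lemma Im_conj (x : R[i]) : complex.Im (x^*)%C = - complex.Im x.
Proof. by case: x. Qed.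

Lemma Re_sum (T : Type) (s : seq T) (F : T -> R[i]) : complex.Re (\sum_(i <- s) F i) = \sum_(i <- s) complex.Re (F i).
Proof. by apply: (big_morph (@complex.Re R)) => //; case=> a b; case. Qed.

Lemma Im_sum (T : Type) (s : seq T) (F : T -> R[i]) : complex.Im (\sum_(i <- s) F i) = \sum_(i <- s) complex.Im (F i).
Proof. by apply: (big_morph (@complex.Im R)) => //; case=> a b; case. Qed.

Lemma Re_exponential (l x : 'rV[R]_d) : complex.Re (exponential l x) = ee l 0 false x.
Proof. by rewrite ee_cos addr0. Qed.

Lemma Im_exponential (l x : 'rV[R]_d) : complex.Im (exponential l x) = ee l 0 true x.
Proof. by rewrite ee_sin addr0. Qed.

Lemma Rintegral_approx (f : 'rV[R]_d -> R) (c : R) : measurable_fun setT f -> (forall x, `|f x| <= c) ->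
  \int[leb]_(x in E) f x = In (fun x => \1_D x * f x).
Proof.
by move=> mf hf; rewrite /Rintegral (integral_approx mE bD bN DE EDN N0 mf hf).
Qed.

Lemma orthogonal_sJ : orthogonal_exponentials E Lam ->
  forall l l', Lam l -> Lam l' -> l != l' -> forall th, sJ D (l - l') th = 0.
Proof.
move=> orth l l' Ll Ll' ll th.
have := orth l l' Ll Ll' ll; rewrite /L2_inner => -[].
have -> : (fun x => complex.Re (exponential l x * (exponential l' x)^*%C)) = (fun x => sin (2 * pi * dot (l - l') x + pi / 2)).
  apply/funext => x; rewrite Re_mul Re_conj Im_conj !Re_exponential !Im_exponential !ee_cos !ee_sin !addr0.
  by rewrite sin_shift dotBl mulrBr cosB; ring.
have -> : (fun x => complex.Im (exponential l x * (exponential l' x)^*%C)) = (fun x => sin (2 * pi * dot (l - l') x + 0)).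
  apply/funext => x; rewrite Im_mul Re_conj Im_conj !Re_exponential !Im_exponential !ee_cos !ee_sin !addr0.
  by rewrite dotBl mulrBr sinB; ring.
rewrite !(Rintegral_approx (measurable_sin_dot _ _) (fun x => norm_sin_le1 _)).
rewrite -/(sJ D (l - l') _) -/(sJ D (l - l') _) => h1 h2.
by rewrite sJ_trig // h1 h2 !mulr0 addr0.
Qed.

Definition to_complex (f : bool -> 'rV[R]_d -> R) (x : 'rV[R]_d) : R[i] := (f false x +i* f true x)%C.

Lemma L2_norm_ip f : bounded_meas f -> L2_norm E (to_complex f) = (Num.sqrt (ip D f f))%:E.
Proof.
move=> hf; have [m0 [c0 hc0]] := hf false; have [m1 [c1 hc1]] := hf true.
rewrite /L2_norm unlock.
have -> : (fun x => (`|((fun x => (Normc.normc (to_complex f x))%:E) \_ E) x| `^ 2)%E) =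
    (fun x : L => (f false x ^+ 2 + f true x ^+ 2)%:E) \_ E.
  apply/funext => x; rewrite !patchE; case: ifP => _.
    rewrite abse_EFin poweR_EFin ger0_norm ?sqrtr_ge0 // (powR_mulrn 2) ?sqrtr_ge0 // sqr_sqrtr //.
    by rewrite addr_ge0 ?sqr_ge0.
  by rewrite (_ : point = 0%E) // abse0 poweR_EFin powR0 // pnatr_eq0.
rewrite -integral_mkcond.
have mf2 : measurable_fun setT (fun x => f false x ^+ 2 + f true x ^+ 2).
  by apply: measurable_funD; apply: measurable_funX.
rewrite (integral_approx mE bD bN DE EDN N0 (c := c0 ^+ 2 + c1 ^+ 2) mf2); last first.
  move=> x; apply: (le_trans (ler_normD _ _)); rewrite !normrX; apply: lerD; apply: lerXn2r; rewrite ?nnegrE //.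
    exact: le_trans (hc0 x).
  exact: le_trans (hc1 x).
rewrite poweR_EFin powR12_sqrt; last by apply: In_ge0 => x; rewrite mulr_ge0 ?indicE // addr_ge0 ?sqr_ge0.
congr (Num.sqrt _)%:E; rewrite /ip -In_D; [|exact: (bounded_measM bD _ hf hf)..].
by congr In; apply/funext => x; rewrite !expr2 mulrDr.
Qed.

Lemma complete_residual : complete_exponentials E Lam ->
  forall f, bounded_meas f -> forall e : R, 0 < e ->
  exists s, [/\ uniq s, {subset s <= Lam} &
    exists c, ip D (residual (@ee2 R d) [seq (l, b) | l <- s, b <- [:: false; true]] c f)
                   (residual (@ee2 R d) [seq (l, b) | l <- s, b <- [:: false; true]] c f) < e].
Proof.
move=> compl f hf e e0.
have inL2 : in_L2 E (to_complex f).
  split; last by rewrite L2_norm_ip // ltry.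
    by have [mf _] := hf false; exact: (measurable_borel_leb (D := E) mf).
  by have [mf _] := hf true; exact: (measurable_borel_leb (D := E) mf).
have se : 0 < Num.sqrt e by rewrite sqrtr_gt0.
have [s [c [sL hs]]] := compl _ inL2 _ se.
exists (undup s); split; [exact: undup_uniq|by move=> l; rewrite mem_undup; exact: sL|].
(* The given list may repeat frequencies; their coefficients are collected with multiplicity. *)
pose c' l := c l *+ count_mem l s.
pose k (p : 'rV[R]_d * bool) := if p.2 then complex.Im (c' p.1) else complex.Re (c' p.1).
exists k; set r := residual _ _ _ _.
have hr : bounded_meas r.
  by apply: bounded_meas_residual => // i; exact: bounded_meas_ee.
move: hs; rewrite (_ : (fun x => _) = to_complex r).
  by rewrite L2_norm_ip // lte_fin ltr_sqrt.
apply/funext => x.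
have -> : \sum_(l <- s) c l * exponential l x = \sum_(l <- undup s) c' l * exponential l x.
  rewrite -big_undup_iterop_count; apply: eq_bigr => l _.
  by rewrite /c' mulrnAl.
have sumk b : \sum_(p <- [seq (l, b) | l <- undup s, b <- [:: false; true]]) k p * ee2 p b x =
    \sum_(l <- undup s) (complex.Re (c' l) * ee l 0 b x + complex.Im (c' l) * ee l (pi / 2) b x).
  by rewrite big_allpairs; apply: eq_bigr => l _; rewrite big_cons big_seq1.
have cosS (t : R) : cos (t + pi / 2) = - sin t.
  by rewrite cosD sin_pihalf cos_pihalf mulr0 sub0r mulr1.
apply/eqP; rewrite eq_complex /to_complex /r /residual !sumk.
have -> (z w : R[i]) : complex.Re (z - w) = complex.Re z - complex.Re w by case: z; case: w.
have -> (z w : R[i]) : complex.Im (z - w) = complex.Im z - complex.Im w by case: z; case: w.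
rewrite Re_sum Im_sum /=; apply/andP; split; apply/eqP; congr (_ - _); apply: eq_bigr => l _.
  rewrite Re_mul Re_exponential Im_exponential !ee_cos !ee_sin !addr0 cosS; ring.
by rewrite Im_mul Re_exponential Im_exponential !ee_sin !ee_cos !addr0 sin_shift.
Qed.

End from_spectrum.

(** * Convex hulls as intersections of half-spaces *)

Section hull.
Context (R : realType) (n : nat).
Implicit Types (C : set 'rV[R]_n).

Lemma convex_setP C : convex_set C <->
  forall x y (t : R), 0 <= t -> t <= 1 -> C x -> C y -> C ((1 - t) *: x + t *: y).
Proof.
split=> [cC x y t t0 t1 Cx Cy|cC x y l].
  have := cC y x (Itv01 t0 t1) (mem_set Cy) (mem_set Cx).
  by rewrite inE /= addrC.
move=> /set_mem Cx /set_mem Cy; apply/mem_set.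
have l0 : 0 <= l%:num by exact: ge0.
have l1 : l%:num <= 1 by exact: le1.
by have := cC y x _ l0 l1 Cy Cx; rewrite addrC.
Qed.

(* [(x, tau)] lies in the cone generated by the [(p, 1)] for [p \in s]. *)
Fixpoint hull_cone (s : seq 'rV[R]_n) (x : 'rV[R]_n) (tau : R) : Prop :=
  if s is s0 :: s' then exists2 t : R, 0 <= t & hull_cone s' (x - t *: s0) (tau - t)
  else x = 0 /\ tau = 0.

Lemma hull_cone_ge0 s x tau : hull_cone s x tau -> 0 <= tau.
Proof.
elim: s x tau => [x tau [_ ->] //|s0 s IH x tau /= [t t0 /IH]].
by rewrite subr_ge0; exact: le_trans.
Qed.

Lemma hull_cone0 s x : hull_cone s x 0 -> x = 0.
Proof.
elim: s x => [x [] //|s0 s IH x /= [t t0]]; rewrite sub0r => h.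
have t1 := hull_cone_ge0 h; have {t1 t0} t0 : t = 0 by apply: le_anti; rewrite t0 -oppr_ge0 t1.
by move: h; rewrite t0 scale0r subr0 oppr0; exact: IH.
Qed.

Lemma hull_coneD s x y a b : hull_cone s x a -> hull_cone s y b -> hull_cone s (x + y) (a + b).
Proof.
elim: s x y a b => [x y a b [-> ->] [-> ->]|s0 s IH x y a b /= [t t0 h] [u u0 k]].
  by rewrite /= !addr0.
exists (t + u); first exact: addr_ge0.
have := IH _ _ _ _ h k; congr hull_cone; last by ring.
by rewrite scalerDl; rewrite opprD addrACA.
Qed.

Lemma hull_coneZ s x a (c : R) : 0 <= c -> hull_cone s x a -> hull_cone s (c *: x) (c * a).
Proof.
move=> c0; elim: s x a => [x a [-> ->]|s0 s IH x a /= [t t0 /IH h]].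
  by rewrite /= scaler0 mulr0.
exists (c * t); first exact: mulr_ge0.
by move: h; rewrite scalerBr mulrBr scalerA.
Qed.

Lemma hull_cone_00 s : hull_cone s 0 0.
Proof. by elim: s => [//|s0 s IH] /=; exists 0 => //; rewrite scale0r !subr0. Qed.

Lemma hull_cone_mem s p : p \in s -> hull_cone s p 1.
Proof.
elim: s => [//|s0 s IH]; rewrite inE => /predU1P[->|/IH h] /=.
  by exists 1 => //; rewrite scale1r !subrr; exact: hull_cone_00.
by exists 0 => //; rewrite scale0r !subr0.
Qed.

Lemma hull_cone_sub s C x tau : (forall x y (t : R), 0 <= t -> t <= 1 -> C x -> C y -> C ((1 - t) *: x + t *: y)) ->
  (forall p, p \in s -> C p) -> hull_cone s x tau -> 0 < tau -> C (tau^-1 *: x).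
Proof.
move=> cC; elim: s x tau => [x tau _ [_ ->]|s0 s IH x tau hs /= [t t0 h] tau0]; first by rewrite ltxx.
have := hull_cone_ge0 h; rewrite le_eqVlt => /predU1P[/esym e|t'0].
  rewrite e in h; have := hull_cone0 h => /eqP; rewrite subr_eq0 => /eqP ->.
  move/eqP: e; rewrite subr_eq0 => /eqP <-.
  by rewrite scalerA mulVf ?gt_eqF // scale1r; apply: hs; exact: mem_head.
have Cs : C ((tau - t)^-1 *: (x - t *: s0)).
  by apply: IH => // p ps; apply: hs; rewrite inE ps orbT.
have := cC _ _ ((tau - t) / tau) _ _ (hs _ (mem_head _ _)) Cs.
have -> : (1 - (tau - t) / tau) *: s0 + ((tau - t) / tau) *: ((tau - t)^-1 *: (x - t *: s0)) = tau^-1 *: x.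
  apply/rowP => i; rewrite !mxE; field; apply/andP; split; lra.
apply; first by rewrite divr_ge0 // ltW.
by rewrite ler_pdivrMr // mul1r gerBl.
Qed.

Lemma convex_hull_cone s : convex_hull [set` s] = [set x | hull_cone s x 1].
Proof.
apply/seteqP; split.
  apply: smallest_sub => [|p /= ps]; last exact: hull_cone_mem.
  apply/convex_setP => x y t t0 t1 hx hy /=.
  rewrite -[X in hull_cone _ _ X](_ : (1 - t) * 1 + t * 1 = 1); last by ring.
  by apply: hull_coneD; apply: hull_coneZ => //; rewrite subr_ge0.
move=> x /= hx C [/convex_setP cC sC].
have := hull_cone_sub cC (fun p ps => sC p ps) hx ltr01; by rewrite invr1 scale1r.
Qed.

(** Homogeneous inequalities, because the cone over the hull grows by one generator at a time and
    eliminating its coefficient preserves this form; the hull is the section [tau = 1]. *)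
Definition cone_poly (L : seq ('rV[R]_n * R)) x tau := forall p, p \in L -> dot p.1 x + p.2 * tau <= 0.

(* Fourier-Motzkin elimination of [t] from [t >= 0] and [f_p <= t c_p] where
   [f_p = <p.1, x> + p.2 tau] and [c_p = <p.1, s0> + p.2]. *)
Lemma fourier_motzkin (L : seq ('rV[R]_n * R)) (s0 : 'rV[R]_n) :
  exists L', forall x tau, cone_poly L' x tau <-> exists2 t : R, 0 <= t & cone_poly L (x - t *: s0) (tau - t).
Proof.
pose c (p : 'rV[R]_n * R) := dot p.1 s0 + p.2.
pose comb (p q : 'rV[R]_n * R) : 'rV[R]_n * R := (- c q *: p.1 + c p *: q.1, - c q * p.2 + c p * q.2).
exists ([seq p <- L | c p <= 0] ++ [seq comb p q | p <- [seq p <- L | 0 < c p], q <- [seq q <- L | c q < 0]]).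
move=> x tau; pose f (p : 'rV[R]_n * R) := dot p.1 x + p.2 * tau.
have E p t : dot p.1 (x - t *: s0) + p.2 * (tau - t) = f p - t * c p.
  by rewrite dotBr dotZr /f /c; ring.
have Ec p q : dot (comb p q).1 x + (comb p q).2 * tau = - c q * f p + c p * f q.
  by rewrite /comb /= dotDl !dotZl /f; ring.
split; last first.
  move=> [t t0 h] p; rewrite mem_cat => /orP[|].
    rewrite mem_filter => /andP[cp pL]; have := h p pL; rewrite E -/(f p); nra.
  move=> /allpairsP[[p1 q1] /= []]; rewrite !mem_filter => /andP[cp pL] /andP[cq qL] ->.
  rewrite Ec; have := h _ pL; have := h _ qL; rewrite !E; set a := f p1; set b := f q1; nra.
move=> h.
have [t t0 [ht1 ht2]] : exists2 t : R, 0 <= t & (forall p, p \in L -> 0 < c p -> f p <= t * c p) /\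
   (forall q, q \in L -> c q < 0 -> f q <= t * c q).
  pose U := [seq f p / c p | p <- [seq p <- L | 0 < c p]].
  (* The largest of 0 and the lower bounds [f p / c p]; the combined inequalities say that it
     respects all the upper bounds. *)
  have [t tU ht] := @seq_min R R (fun t => - t) (0 :: U) 0 (mem_head _ _).
  have t0 : 0 <= t by have := ht 0 (mem_head _ _); rewrite lerN2.
  exists t => //; split => [p pL cp|q qL cq].
    rewrite -ler_pdivrMr // -lerN2; apply: ht; rewrite inE; apply/orP; right.
    by apply/mapP; exists p => //; rewrite mem_filter cp.
  move: tU; rewrite inE => /predU1P[->|/mapP[p]].
    rewrite mul0r; apply: (h q); rewrite mem_cat; apply/orP; left.
    by rewrite mem_filter qL (ltW cq).
  rewrite mem_filter => /andP[cp pL] ->.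
  have : - c q * f p + c p * f q <= 0.
    rewrite -Ec; apply: h; rewrite mem_cat; apply/orP; right.
    by apply/allpairsP; exists (p, q); rewrite !mem_filter cp cq.
  move=> k; rewrite mulrAC ler_pdivlMr //; lra.
exists t => // p pL; rewrite E subr_le0.
have [cp|cp|cp] := ltgtP (c p) 0; [exact: ht2|exact: ht1|].
rewrite cp mulr0; apply: (h p); rewrite mem_cat; apply/orP; left.
by rewrite mem_filter pL cp lexx.
Qed.

Lemma hull_cone_poly s : exists L, forall x tau, hull_cone s x tau <-> cone_poly L x tau.
Proof.
elim: s => [|s0 s [L hL]]; last first.
  have [L' hL'] := fourier_motzkin L s0; exists L' => x tau; split.
    by move=> /= [t t0 /hL h]; apply/hL'; exists t.
  by move=> /hL'[t t0 /hL h]; exists t.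
exists ([:: (0, 1); (0, -1)] ++ [seq (delta_mx ord0 i, 0) | i <- enum 'I_n] ++ [seq (- delta_mx ord0 i, 0) | i <- enum 'I_n]).
move=> x tau; split=> [[-> ->] p _|h]; first by rewrite dot0r mulr0 addr0.
have dd (i : 'I_n) : dot (delta_mx ord0 i) x = x ord0 i.
  rewrite /dot (bigD1 i) //= [delta_mx _ _ _ _]mxE !eqxx mul1r big1 ?addr0 // => j ji.
  by rewrite [delta_mx _ _ _ _]mxE eqxx (negbTE ji) mul0r.
split.
  apply/rowP => i; rewrite [RHS]mxE; apply: le_anti; apply/andP; split.
    have := h (delta_mx ord0 i, 0); rewrite /= dd mul0r addr0; apply.
    rewrite !inE mem_cat; apply/orP; right; apply/orP; right; apply/orP; left.
    by apply/mapP; exists i => //; rewrite mem_enum.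
  have := h (- delta_mx ord0 i, 0); rewrite /= dotNl dd mul0r addr0 oppr_le0; apply.
  rewrite !inE mem_cat; apply/orP; right; apply/orP; right; apply/orP; right.
  by apply/mapP; exists i => //; rewrite mem_enum.
apply: le_anti; apply/andP; split.
  by have := h (0, 1); rewrite dot0l mul1r add0r; apply; rewrite mem_head.
by have := h (0, -1); rewrite dot0l mulN1r add0r oppr_le0; apply; rewrite !inE eqxx orbT.
Qed.

Lemma convex_hull_hpoly (s : seq 'rV[R]_n) : exists L : seq ('rV[R]_n * R), convex_hull [set` s] = hpoly L.
Proof.
have [L hL] := hull_cone_poly s; exists [seq (p.1, - p.2) | p <- L].
rewrite convex_hull_cone; apply/seteqP; split => x.
  by move=> /hL h _ /mapP[p pL ->] /=; have := h p pL; rewrite mulr1; lra.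
move=> h; apply/hL => p pL; have := h (p.1, - p.2); rewrite /= mulr1.
by move=> /(_ (map_f (fun p : 'rV[R]_n * R => (p.1, - p.2)) pL)); lra.
Qed.

End hull.

(** * Symmetry of the polytope and of its facets *)

Section polytope_tools.
Context (R : realType).

Lemma row_subE n (x y : 'rV[R]_n) i : (x - y) ord0 i = x ord0 i - y ord0 i.
Proof. by rewrite 2!mxE. Qed.

Lemma dot_continuous n (v : 'rV[R]_n) : continuous (dot v).
Proof.
have H i : continuous (fun x : 'rV[R]_n => v ord0 i * x ord0 i).
  by move=> x; have := cvgMr (a := v ord0 i) (@coord_continuous R 1 n ord0 i x); apply.
rewrite (_ : dot v = fun x => \sum_(i <- index_enum 'I_n) v ord0 i * x ord0 i) //.
elim: (index_enum _) => [|i s IH].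
  rewrite (_ : (fun x => _) = fun=> 0); first exact: cst_continuous.
  by apply/funext => x; rewrite big_nil.
rewrite (_ : (fun x => _) = (fun x : 'rV[R]_n => v ord0 i * x ord0 i + \sum_(i <- s) v ord0 i * x ord0 i)).
  by move=> x; have := cvgD (H i x) (IH x); apply.
by apply/funext => x; rewrite big_cons.
Qed.

Lemma hpoly_closed n (L : seq ('rV[R]_n * R)) : closed (hpoly L).
Proof.
elim: L => [|p L IH]; first by rewrite (_ : hpoly [::] = setT); [exact: closedT|apply/seteqP; split].
rewrite (_ : hpoly (p :: L) = (dot p.1 @^-1` [set t | t <= p.2]) `&` hpoly L).
  by apply: closedI => //; apply: closed_comp => [x _|]; [exact: dot_continuous|exact: closed_le].
apply/seteqP; split => x.
  by move=> h; split; [apply: (h p); rewrite mem_head|move=> q qL; apply: h; rewrite inE qL orbT].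
by move=> [h1 h2] q; rewrite inE => /predU1P[->|/h2].
Qed.

Lemma hpoly_att n (L : seq ('rV[R]_n * R)) (v : 'rV[R]_n) : bset (hpoly L) -> hpoly L !=set0 ->
  exists2 x, hpoly L x & forall y, hpoly L y -> dot v y <= dot v x.
Proof.
move=> [_ [r hr]] L0.
have cL : compact (hpoly L).
  apply: (bounded_closed_compact _ (@hpoly_closed n L)).
  exists `|r|; split; first exact: num_real.
  move=> M rM x /= Lx; rewrite [leLHS]/Num.norm /= mx_normrE; apply/bigmax_leP; split.
    by apply: le_trans (ltW rM).
  move=> [i j] _ /=; rewrite (ord1 i); apply: (le_trans (hr _ Lx j)); apply: (le_trans (ler_norm _)); exact: ltW.
have [|c] := EVT_max_rV L0 cL (f := dot v).
  by apply: continuous_subspaceT; exact: dot_continuous.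
rewrite inE => Lc hc; exists c => // y Ly; apply: hc; exact: mem_set.
Qed.

Lemma strict_point_box n (L : seq ('rV[R]_n * R)) (p : 'rV[R]_n) : hpoly L p ->
  (forall q, q \in L -> q.1 != 0 -> dot q.1 p < q.2) ->
  exists2 h : R, 0 < h & forall x : 'rV[R]_n,
    (forall i, `|x ord0 i - p ord0 i| <= 2 * h) -> hpoly L x.
Proof.
move=> Lp hp.
have [d d0 hd] : exists2 d : R, 0 < d & forall q, q \in L -> q.1 = 0 \/ d * (1 + \sum_i `|q.1 ord0 i|) <= q.2 - dot q.1 p.
  elim: L hp {Lp} => [|q L IH] hp; first by exists 1.
  have [q' q'L|d d0 hd] := IH.
    by apply: hp; rewrite inE q'L orbT.
  have [q0|q0] := eqVneq q.1 0.
    by exists d => // q'; rewrite inE => /predU1P[->|/hd]; [left|].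
  have S0 : 0 < 1 + \sum_i `|q.1 ord0 i| by rewrite ltr_pwDl // sumr_ge0.
  have hq : 0 < q.2 - dot q.1 p by rewrite subr_gt0 hp // mem_head.
  exists (Num.min d ((q.2 - dot q.1 p) / (1 + \sum_i `|q.1 ord0 i|))).
    by rewrite lt_min d0 divr_gt0.
  move=> q'; rewrite inE => /predU1P[->|/hd[->|h]]; [right|by left|right].
    by rewrite -ler_pdivlMr // ge_min lexx orbT.
  apply: le_trans h; rewrite ler_pM2r ?ge_min ?lexx //.
  by rewrite ltr_pwDl // sumr_ge0.
exists (d / 2); first by rewrite divr_gt0.
move=> x hx q qL; have [q0|h] := hd q qL.
  by rewrite q0 dot0l; have := Lp q qL; rewrite q0 dot0l.
suff : dot q.1 (x - p) <= d * (1 + \sum_i `|q.1 ord0 i|) by rewrite dotBr; lra.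
rewrite mulrDr mulr1 /dot mulr_sumr; apply: (@le_trans _ _ (\sum_i d * `|q.1 ord0 i|)); last by rewrite lerDr ltW.
apply: ler_sum => i _; apply: (le_trans (ler_norm _)); rewrite normrM mulrC ler_wpM2r // !mxE.
by apply: (le_trans (hx i)); rewrite mulrCA mulfV ?mulr1 // pnatr_eq0.
Qed.

Lemma hpoly_interior n (L : seq ('rV[R]_n * R)) : bset (hpoly L) -> 0 < vol (hpoly L) ->
  exists x0 : 'rV[R]_n, exists2 h : R, 0 < h & forall x : 'rV[R]_n,
    (forall i, `|x ord0 i - x0 ord0 i| <= 2 * h) -> hpoly L x.
Proof.
move=> bP vP.
have [p hp Lp] : exists2 p, (forall q, q \in L -> q.1 != 0 -> dot q.1 p < q.2) & hpoly L p.
  apply: contrapT => H; move: vP.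
  rewrite (@vol_null_cover R _ [seq q : 'rV[R]_n * R <- L | q.1 != 0] (hpoly L) bP) ?ltxx //.
    by move=> q; rewrite mem_filter => /andP[].
  move=> x Px; apply: contrapT => H'; apply: H; exists x => // q qL q0.
  rewrite lt_neqAle (Px _ qL) andbT; apply/eqP => e; apply: H'; exists q => //.
  by rewrite mem_filter q0.
by exists p; exact: strict_point_box.
Qed.

Lemma vol_box_gt0 n (E : set 'rV[R]_n) (x0 : 'rV[R]_n) (h : R) : bset E -> 0 < h ->
  (forall x : 'rV[R]_n, (forall i, `|x ord0 i - x0 ord0 i| <= h) -> E x) -> 0 < vol E.
Proof.
move=> bE h0 hE; pose I i := `[x0 ord0 i - h, x0 ord0 i + h]%classic.
pose F := [set x : 'rV[R]_n | forall i, I i (x ord0 i)].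
have FE : F `<=` E.
  move=> x Fx; apply: hE => i; have := Fx i; rewrite /I /= in_itv /= ler_norml; lra.
have mF : measurable F by apply: (measurable_rV_prod (A := I)) => i; exact: measurable_itv.
have bF : bset F := bset_sub mF FE bE.
apply: (@lt_le_trans _ _ (vol F)); last exact: vol_le.
have vF : borel_lebesgue R n F = (\prod_(i < n) lebesgue_measure (I i))%E.
  by apply: borel_lebesgue_prod => i; exact: measurable_itv.
rewrite -lte_fin vol_fin // vF (eq_bigr (fun=> (2 * h)%:E)).
  by rewrite prodEFin lte_fin prodr_gt0 // => i _; rewrite mulr_gt0.
move=> i _; rewrite /I lebesgue_measure_itv /= lte_fin ifT; last by rewrite ltrD2l gtrN.
by rewrite -EFinB; congr EFin; ring.
Qed.

(** If no inequality with nonzero normal were an equality throughout, averaging points that satisfy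
    them strictly one by one would give a point strict in all of them, hence a box inside the
    polytope. *)
Lemma hpoly_flat n (L : seq ('rV[R]_n * R)) : bset (hpoly L) -> hpoly L !=set0 -> vol (hpoly L) = 0 ->
  exists2 v, v != 0 & exists c, forall y, hpoly L y -> dot v y = c.
Proof.
move=> bP [y0 Py0] v0; apply: contrapT => H.
have key (K : seq ('rV[R]_n * R)) : {subset K <= L} ->
    exists2 p, hpoly L p & forall q, q \in K -> q.1 != 0 -> dot q.1 p < q.2.
  elim: K => [|q K IH] KL; first by exists y0.
  have [q' q'K|p Pp hp] := IH; first by apply: KL; rewrite inE q'K orbT.
  have [q0|q0] := eqVneq q.1 0.
    exists p => // q'; rewrite inE => /predU1P[->|]; last exact: hp.
    by rewrite q0 eqxx.
  have [y Py hy] : exists2 y, hpoly L y & dot q.1 y < q.2.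
    apply: contrapT => H'; apply: H; exists q.1 => //; exists q.2 => y Py.
    apply: le_anti; rewrite (Py _ (KL _ (mem_head _ _))) /= leNgt; apply/negP => hy.
    by apply: H'; exists y.
  have t01 : 0 <= (2^-1 : R) <= 1 by apply/andP; split; lra.
  exists ((1 - 2^-1) *: p + 2^-1 *: y); first exact: hpoly_convex.
  move=> q'; rewrite inE dotDr !dotZr => /predU1P[->|q'K] q'0.
    by have := Pp _ (KL _ (mem_head _ _)); lra.
  have := hp _ q'K q'0; have := Py q' (KL _ _); rewrite inE q'K orbT => /(_ isT); lra.
have [p Pp hp] := key L (fun _ h => h).
have [h h0 hbox] := strict_point_box Pp hp.
by have := vol_box_gt0 bP (mulr_gt0 (ltr0n R 2) h0) hbox; rewrite v0 ltxx.
Qed.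

(* The points of [X] serve to prescribe the phases of the zero [xi]. *)
Definition zero_rich n (P : set 'rV[R]_n) := exists2 r : R, 0 < r &
  forall (X : seq 'rV[R]_n) (e : R) (c : nat -> 'rV[R]_n), 0 < e ->
    (forall j k, (j < k)%N -> exists i, r < `|c k ord0 i - c j ord0 i|) ->
    exists j k (xi : 'rV[R]_n), [/\ (j < k)%N, forall i, `|xi ord0 i - (c k ord0 i - c j ord0 i)| <= r,
      forall x, x \in X -> exists z : int, `|dot xi x - z%:~R| <= e & forall th, sJ P xi th = 0].

Lemma sJ_mulmx n (P : set 'rV[R]_n) (G : 'M[R]_n) (c : R) w th :
  (forall f, nice f -> In (fun x => f (x *m G)) = c * In f) -> bset P ->
  sJ [set x | P (x *m G)] (w *m G^T) th = c * sJ P w th.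
Proof.
move=> hG bP; rewrite /sJ -hG; last exact: nice_sJ.
by congr In; apply/funext => x; rewrite -dot_mulmx.
Qed.

(** Needed because slices are compared in coordinates adapted to each direction. Centres are pulled
    back by the transpose of [G], which distorts the radius by a bounded factor only. *)
Lemma zero_rich_mulmx n (P : set 'rV[R]_n) (G : 'M[R]_n) (c : R) : G \in unitmx ->
  (forall f, nice f -> In (fun x => f (x *m G)) = c * In f) -> bset P ->
  zero_rich P -> zero_rich [set x | P (x *m G)].
Proof.
move=> uG hG bP [r r0 hr]; have uGT : G^T \in unitmx by rewrite unitmx_tr.
have [r' hr'] := mulmx_bound G^T r.
exists (1 + `|r'|); first by rewrite ltr_pwDl.
move=> X e c' e0 sep.
pose cc j := c' j *m invmx G^T.
have ccE j k : (cc k - cc j) *m G^T = c' k - c' j by rewrite mulmxBl !mulmxKV.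
have [|j [k [xi [jk hxi hX z]]]] := hr [seq x *m G | x <- X] e cc e0.
  move=> j k jk; apply: contrapT => H; have [i] := sep j k jk; apply/negP; rewrite -leNgt.
  have h1 i' : `|(cc k - cc j) ord0 i'| <= r.
    rewrite leNgt; apply/negP => hi; apply: H; exists i'.
    by rewrite -row_subE.
  have := hr' _ h1 i; rewrite ccE row_subE => /le_trans; apply.
  by apply: (le_trans (ler_norm _)); rewrite lerDr.
exists j, k, (xi *m G^T); split => //.
- move=> i; have h1 i' : `|(xi - (cc k - cc j)) ord0 i'| <= r by rewrite !row_subE; exact: hxi.
  have := hr' _ h1 i; rewrite mulmxBl ccE !row_subE => /le_trans; apply.
  by apply: (le_trans (ler_norm _)); rewrite lerDr.
- move=> x xX; have [w hw] := hX (x *m G) (map_f _ xX); exists w.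
  by rewrite -dot_mulmx.
- by move=> th; rewrite (sJ_mulmx _ _ hG bP) z mulr0.
Qed.

(** On the bounded set [T] the integrand is then the cosine of a uniformly small angle. *)
Lemma sJ_near_vol n (T : set 'rV[R]_n) : bset T -> forall e : R, 0 < e -> exists2 d : R, 0 < d &
  forall (eta : 'rV[R]_n) (psi : R), (forall i, `|eta ord0 i| <= d) ->
    (exists z : int, `|psi - (pi / 2 + 2 * pi * z%:~R)| <= d) -> `|sJ T eta psi - vol T| <= e.
Proof.
move=> bT e e0; have [_ [r hr]] := bT; have v0 := vol_ge0 T.
have e1 : 0 < e / (vol T + 1) by rewrite divr_gt0 // ltr_wpDl.
have /cvgrPdist_le/(_ _ e1)[t /= t0 ht] := @continuous_cos R 0.
pose K := 2 * pi * (n%:R * `|r|) + 1.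
have p0 : 0 < pi :> R := pi_gt0 R.
have K0 : 0 < K by rewrite ltr_wpDl // !mulr_ge0 // ltW.
exists (t / 2 / (K + 1)); first by rewrite !divr_gt0 // ltr_pwDl // ltW.
set d := t / 2 / (K + 1) => eta psi heta [z hz].
have d0 : 0 <= d by apply: le_trans (normr_ge0 _) hz.
have dK : d * (K + 1) = t / 2 by rewrite /d divfK // gt_eqF // ltr_pwDl // ltW.
pose dd := psi - (pi / 2 + 2 * pi * z%:~R).
have -> : psi = (dd + pi / 2) + 2 * pi * z%:~R by rewrite /dd; ring.
rewrite sJ_shift2pi.
have nT := nice_indic bT; have nS := nice_sJ eta (dd + pi / 2) bT.
rewrite /vol /sJ -In_B //.
apply: (@le_trans _ _ (e / (vol T + 1) * vol T)); last first.
  by rewrite mulrAC ler_pdivrMr ?ltr_wpDl // ler_pM2l //; lra.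
rewrite /vol -In_Z //; apply: In_abs_le; [exact: niceB|exact: niceZ|].
move=> y; rewrite indicE; case: (boolP (y \in T)) => [|_]; last by rewrite !mul0r subrr normr0 mulr0.
rewrite inE => Ty; rewrite /= mul1r mulr1 addrA.
have -> : sin (2 * pi * dot eta y + dd + pi / 2) = cos (2 * pi * dot eta y + dd).
  by rewrite sinD sin_pihalf cos_pihalf mulr0 add0r mulr1.
rewrite distrC -[X in `|X - _|]cos0; apply: ht; rewrite /= sub0r normrN.
have ey : `|dot eta y| <= n%:R * (d * `|r|).
  apply: (le_trans (ler_norm_sum _ _ _)); rewrite -[n in n%:R]card_ord -sumr_const mulr_suml.
  apply: ler_sum => i _; rewrite mul1r normrM ler_pM //.
  by apply: (le_trans (hr _ Ty i)); exact: ler_norm.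
apply: (@le_lt_trans _ _ (d * (K + 1))); last by rewrite dK; lra.
apply: (le_trans (ler_normD _ _)); rewrite normrM (ger0_norm (_ : 0 <= 2 * pi)); last by rewrite mulr_ge0 // ltW.
have := ler_wpM2l (_ : 0 <= 2 * pi) ey; rewrite mulr_ge0 ?(ltW p0) // => /(_ isT) k1.
have k2 : `|dd| <= d := hz.
rewrite /K; nra.
Qed.

End polytope_tools.

Lemma coord_le_norm (R : realType) n (x : 'rV[R]_n) i : `|x ord0 i| <= `|x|.
Proof.
by rewrite [leRHS]/Num.norm /= mx_normrE; apply/bigmax_geP; right => /=; exists (ord0, i).
Qed.

Lemma bounded_set_coord (R : realType) n (B : set 'rV[R]_n) : bounded_set B ->
  exists r : R, forall x, B x -> forall i, `|x ord0 i| <= r.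
Proof.
move=> [M [_ hM]]; exists (M + 1) => x Bx i.
by apply: (le_trans (coord_le_norm _ _)); apply: (hM (M + 1)) => //; rewrite ltrDl.
Qed.

(** [B] is only Lebesgue measurable; a Borel subset [G] of full measure replaces it, and
    orthogonality and completeness pass to [prod_set A G], as the difference lies in the null set
    [prod_set A N]. *)
Lemma spectral_prod (R : realType) n m (A : set 'rV[R]_n) (B : set 'rV[R]_m) :
  bset A -> bounded_set B -> lebesgue_measurable B -> spectral (rV_setX A B) ->
  exists (G : set 'rV[R]_m) (Lam : set 'rV[R]_(n + m)), [/\ bset G, 0 < vol (prod_set A G),
    forall l l', Lam l -> Lam l' -> l != l' -> forall th, sJ (prod_set A G) (l - l') th = 0 &
    forall f, bounded_meas f -> forall e : R, 0 < e ->
      exists s, [/\ uniq s, {subset s <= Lam} &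
        exists c, ip (prod_set A G) (residual (@ee2 R (n + m)) (freqs s) c f)
                                    (residual (@ee2 R (n + m)) (freqs s) c f) < e]].
Proof.
move=> bA /bounded_set_coord[r hr] mB [_ mE E0 [Lam [_ orth compl]]].
have [G [N [bG bN GB BGN N0]]] := lebesgue_inner_borel mB hr.
have bD := bset_prod bA bG; have bAN := bset_prod bA bN.
have DE : prod_set A G `<=` rV_setX A B.
  by move=> z [Az Gz]; exists (lsubmx z) => //; exists (rsubmx z); [exact: GB|exact: hsubmxK].
have EDN : rV_setX A B `\` prod_set A G `<=` prod_set A N.
  move=> _ [[a Aa [b Bb <-]] nD]; split; first by rewrite row_mxKl.
  rewrite row_mxKr; apply: BGN; split => // Gb; apply: nD; split; first by rewrite row_mxKl.
  by rewrite row_mxKr.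
have AN0 : vol (prod_set A N) = 0 by rewrite vol_prod // N0 mulr0.
exists G, Lam; split => //.
- rewrite lt_neqAle vol_ge0 andbT; apply/eqP => V0; move: E0.
  have := @integral_approx R _ _ _ _ mE bD bAN DE EDN AN0 (fun=> 1) 1 (measurable_cst _) (fun=> _).
  rewrite normr1 lexx => /(_ (fun=> isT)).
  rewrite integral_cst // mul1e => ->.
  rewrite (_ : (fun x => _) = \1_(prod_set A G)); last by apply/funext => x; rewrite mulr1.
  by rewrite -/(vol _) -V0 ltxx.
- exact: (orthogonal_sJ mE bD bAN DE EDN AN0 orth).
- exact: (complete_residual mE bD bAN DE EDN AN0 compl).
Qed.

Lemma spectral_vol_gt0 (R : realType) n m (A : set 'rV[R]_n) (B : set 'rV[R]_m) :
  bset A -> bounded_set B -> lebesgue_measurable B -> spectral (rV_setX A B) -> 0 < vol A.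
Proof.
move=> bA bB mB sp; have [G [Lam [bG V0 _ _]]] := spectral_prod bA bB mB sp.
rewrite lt_neqAle vol_ge0 andbT; apply: contraTneq V0 => A0.
by rewrite vol_prod // -A0 mul0r ltxx.
Qed.

Lemma spectral_zeros (R : realType) n m (A : set 'rV[R]_n) (B : set 'rV[R]_m) (x0 : 'rV[R]_n) (h : R) :
  bset A -> 0 < h -> (forall x : 'rV[R]_n, (forall i, `|x ord0 i - x0 ord0 i| <= 2 * h) -> A x) ->
  bounded_set B -> lebesgue_measurable B -> spectral (rV_setX A B) -> zero_rich A.
Proof.
move=> bA h0 hA bB mB sp; have [G [Lam [bG V0 orth compl]]] := spectral_prod bA bB mB sp.
exists (2 * @capture_radius R n m A G x0 h).
  by rewrite mulr_gt0 //; exact: (capture_radius_gt0 bA bG V0 h0 hA).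
move=> X e c; exact: (zeros_of_transform bA bG V0 orth compl h0 hA).
Qed.

Section opposite_slices.
Context (R : realType).

Lemma small_int (z : int) : `|z%:~R : R| < 1 -> z = 0.
Proof.
rewrite -intr_norm -[1]/(1%:~R) ltr_int => h; apply/eqP.
by rewrite -normr_le0 -ltzD1.
Qed.

(** The way a prescribed phase makes a bounded coordinate small: [x * t] lies in []-1/2, 1/2[], so
    the integer it is close to can only be 0. *)
Lemma small_phase (r e t : R) : 0 < e -> e < 2^-1 -> 0 < t -> t * r < 2^-1 -> forall x : R, `|x| <= r ->
  (exists z : int, `|x * t - z%:~R| <= e) -> `|x| <= e / t.
Proof.
move=> e0 e1 t0 tr x xr [z hz].
have xt : `|x * t| < 2^-1.
  by rewrite normrM (gtr0_norm t0) mulrC; apply: le_lt_trans tr; rewrite ler_pM2l.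
have z0 : z = 0.
  apply: small_int; rewrite (_ : z%:~R = x * t - (x * t - z%:~R)); last by ring.
  by apply: (le_lt_trans (ler_normB _ _)); lra.
by rewrite ler_pdivlMr //; move: hz; rewrite z0 subr0 normrM (gtr0_norm t0).
Qed.

Lemma eq_of_close (a b : R) (C : R) : (forall e : R, 0 < e -> `|a - b| <= C * e) -> a = b.
Proof.
move=> h; apply/eqP; rewrite -subr_eq0 -normr_le0; apply/ler_addgt0Pr => e e0; rewrite add0r.
have [C0|C0] := leP C 0.
  by apply: (le_trans (h e e0)); nra.
by apply: (le_trans (h (e / C) (divr_gt0 e0 C0))); rewrite mulrCA mulfV ?mulr1 // gt_eqF.
Qed.

Lemma close3 (a b A B e : R) : `|a - A| <= e -> `|b - B| <= e -> `|a - b| <= e -> `|A - B| <= 3 * e.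
Proof. by rewrite !ler_norml => /andP[h1 h2] /andP[h3 h4] /andP[h5 h6]; apply/andP; split; lra. Qed.

Lemma dot_cons_l n (xi : 'rV[R]_n.+1) (t : R) : dot xi (cons_rV (t, 0)) = xi ord0 ord0 * t.
Proof. by rewrite dot_cons dot0r addr0. Qed.

Lemma dot_delta n (xi : 'rV[R]_n) (t : R) i : dot xi (t *: delta_mx ord0 i) = xi ord0 i * t.
Proof.
rewrite dotZr mulrC; congr (_ * _); rewrite /dot (bigD1 i) //= [delta_mx _ _ _ _]mxE !eqxx mulr1 big1 ?addr0 // => j ji.
by rewrite [delta_mx _ _ _ _]mxE eqxx (negbTE ji) mulr0.
Qed.

(* Zeros [(xi0, eta)] with [xi0] large, [eta] small and [xi0 * M], [xi0 * m]
   almost integers. *)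
Lemma opposite_slices n (L : seq ('rV[R]_n.+1 * R)) (M m : R) : bset (hpoly L) ->
  (exists2 x, hpoly L x & x ord0 ord0 = M) -> (forall x, hpoly L x -> x ord0 ord0 <= M) ->
  (exists2 x, hpoly L x & x ord0 ord0 = m) -> (forall x, hpoly L x -> m <= x ord0 ord0) ->
  zero_rich (hpoly L) -> vol (slice L M) = vol (slice L m).
Proof.
move=> bP aM hM am hm [r r0 Z]; apply: (@eq_of_close _ _ 3) => e e0.
have [d1 d10 near1] := sJ_near_vol (bset_slice M bP) e0.
have [d2 d20 near2] := sJ_near_vol (bset_slice m bP) e0.
have [X hX] := sJ_asymptotics bP aM hM am hm r e0.
pose d := Num.min d1 d2; have d0 : 0 < d by rewrite lt_min d10.
have [dd1 dd2] : d <= d1 /\ d <= d2 by rewrite !ge_min !lexx orbT.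
pose t := (2 * (r + 1))^-1; have t0 : 0 < t by rewrite invr_gt0; lra.
have tr : t * r < 2^-1 by rewrite /t mulrC ltr_pdivrMr; lra.
have p0 : 0 < pi :> R := pi_gt0 R.
pose ep := Num.min (4^-1) (Num.min (d * t) (d / (2 * pi))).
have ep0 : 0 < ep by rewrite !lt_min invr_gt0 ltr0n mulr_gt0 // divr_gt0 // mulr_gt0.
have [ep1 [ep2 ep3]] : ep <= 4^-1 /\ ep <= d * t /\ ep <= d / (2 * pi).
  by rewrite /ep !ge_min !lexx !orbT.
have ep4 : ep < 2^-1 by apply: (le_lt_trans ep1); lra.
(* The spacing exceeds [r], and a zero within [r] of a difference of centres has first coordinate
   beyond [X]. *)
pose Lam := `|X| + 2 * r + 1; have L0 : 0 < Lam by have := normr_ge0 X; rewrite /Lam; lra.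
pose c j : 'rV[R]_n.+1 := cons_rV (j%:R * Lam, 0).
have c0 j k : (j < k)%N -> Lam <= c k ord0 ord0 - c j ord0 ord0.
  move=> jk; rewrite !cons_rV0 /= -mulrBl -natrB ?(ltnW jk) // ler_peMl ?(ltW L0) //.
  by rewrite ler1n subn_gt0.
(* The first two points control the boundary phases, the others the size of the remaining
   coordinates through [small_phase]. *)
pose Y := [:: cons_rV (M, 0); cons_rV (m, 0)] ++ [seq t *: delta_mx ord0 (lift ord0 i) | i <- enum 'I_n].
have [|j [k [xi [jk hxi hY z]]]] := Z Y ep c ep0.
  move=> j k /c0 h; exists ord0; have := ler_norm (c k ord0 ord0 - c j ord0 ord0); have := normr_ge0 X.
  rewrite /Lam in h; lra.
have x0 : X <= xi ord0 ord0.
  have := hxi ord0; have := c0 _ _ jk; have := ler_norm X; rewrite /Lam ler_norml; lra.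
have eta_r i : `|tl xi ord0 i| <= r.
  rewrite mxE; have := hxi (lift ord0 i); rewrite !cons_rVS !mxE.
  by rewrite subrr subr0.
have eta_d i : `|tl xi ord0 i| <= d.
  apply: (@le_trans _ _ (ep / t)); last by rewrite ler_pdivrMr.
  apply: (small_phase ep0 ep4 t0 tr (eta_r i)); rewrite mxE -dot_delta; apply: hY.
  by rewrite mem_cat; apply/orP; right; apply/mapP; exists i; rewrite ?mem_enum.
have ph (a : R) : cons_rV (a, 0) \in Y -> exists w : int,
    `|(2 * pi * (xi ord0 ord0 * a) + (pi - pi / 2)) - (pi / 2 + 2 * pi * w%:~R)| <= d.
  move=> /hY[w]; rewrite dot_cons_l => hw; exists w.
  rewrite (_ : _ - _ = 2 * pi * (xi ord0 ord0 * a - w%:~R)); last by field.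
  rewrite normrM gtr0_norm ?mulr_gt0 // mulrC -ler_pdivlMr ?mulr_gt0 //.
  exact: le_trans ep3.
(* [th = pi] leaves the phase [pi / 2] at both slices, where the sine integral is near the area. *)
have := hX _ x0 (tl xi) eta_r pi; rewrite cons_tl z mulr0 sub0r normrN.
have := near1 (tl xi) _ (fun i => le_trans (eta_d i) dd1) (_ : exists w : int, `|(2 * pi * (xi ord0 ord0 * M) + (pi - pi / 2)) - (pi / 2 + 2 * pi * w%:~R)| <= d1).
have := near2 (tl xi) _ (fun i => le_trans (eta_d i) dd2) (_ : exists w : int, `|(2 * pi * (xi ord0 ord0 * m) + (pi - pi / 2)) - (pi / 2 + 2 * pi * w%:~R)| <= d2).
have mY : cons_rV (m, 0) \in Y by rewrite !inE eqxx orbT.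
have [w2 hw2] := ph m mY.
have [w1 hw1] := ph M (mem_head _ _).
move=> /(_ (ex_intro _ w2 (le_trans hw2 dd2))) n2 /(_ (ex_intro _ w1 (le_trans hw1 dd1))) n1.
exact: close3 n1 n2.
Qed.

Lemma In_mulmxN n (G : 'M[R]_n) (c : R) : G \in unitmx ->
  (forall f, nice f -> In (fun x => f (x *m G)) = c * In f) ->
  forall f, nice f -> In (fun x => f (x *m (- G))) = c * In f.
Proof.
move=> uG hG f nf; have N1 : (-1 : R) != 0 by rewrite oppr_eq0 oner_eq0.
rewrite -hG // (In_aff 0 N1 (nice_mulmx uG nf)) normrN1 expr1n mul1r.
by congr In; apply/funext => x; rewrite addr0 scaleN1r mulNmx mulmxN.
Qed.

(** [top_cap_area] in the coordinates [G] for [v] and [- G] for [- v]; the top slice in the second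
    system is the reflection of the bottom slice in the first. *)
Lemma caps_of_slices n (L : seq ('rV[R]_n.+1 * R)) (v : 'rV[R]_n.+1) (G : 'M[R]_n.+1) (c hv hn : R) :
  bset (hpoly L) -> 0 < vol (hpoly L) ->
  (forall x, hpoly L x -> dot v x <= hv) -> (forall x, hpoly L x -> dot (- v) x <= hn) ->
  G \in unitmx -> 0 < c -> (forall x, dot v (x *m G) = x ord0 ord0) ->
  (forall f, nice f -> In (fun x => f (x *m G)) = c * In f) ->
  (let L' := [seq (p.1 *m G^T, p.2) | p <- L] in vol (slice L' hv) = vol (slice L' (- hn))) ->
  forall e, 0 < e -> exists2 d : R, 0 < d & forall s, 0 < s -> s <= d ->
   `|vol (hpoly L `&` [set x | hv - s < dot v x]) - vol (hpoly L `&` [set x | hn - s < dot (- v) x])| <= e * s.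
Proof.
move=> bP vP h1 h2 uG c0 dG hG eqs e e0; set P := hpoly L in bP vP h1 h2 *.
have cap (w : 'rV[R]_n.+1) (H : 'M[R]_n.+1) (hw : R) : (forall x, P x -> dot w x <= hw) -> H \in unitmx ->
    (forall x, dot w (x *m H) = x ord0 ord0) -> (forall f, nice f -> In (fun x => f (x *m H)) = c * In f) ->
    exists2 d : R, 0 < d & forall s, 0 < s -> s <= d ->
      `|c * vol (P `&` [set x | hw - s < dot w x]) - s * vol (slice [seq (p.1 *m H^T, p.2) | p <- L] hw)| <= c * e / 2 * s.
  move=> hw' uH dH hH; have [bP' vP'] := vol_mulmx uH hH bP.
  have E := hpoly_mulmx L H; rewrite -/P in E.
  have [||||d d0 hd] := @top_cap_area R n [seq (p.1 *m H^T, p.2) | p <- L] hw _ _ _ (c * e / 2).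
  - by rewrite -E.
  - by rewrite -E vP' mulr_gt0.
  - by move=> x; rewrite -E => /hw'; rewrite dH.
  - by rewrite divr_gt0 // mulr_gt0.
  exists d => // s s0 sd; have := hd s s0 sd; rewrite -E.
  have bC : bset (P `&` [set x | hw - s < dot w x]) by apply: bsetI => //; exact: measurable_dot_gt.
  have [_ <-] := vol_mulmx uH hH bC.
  congr (`|vol _ - _| <= _); apply/seteqP; split => x /=; by rewrite dH.
have [d1 d10 hd1] := cap v G hv h1 uG dG hG.
have uN : - G \in unitmx by rewrite -scaleN1r unitmxZ // unitrN unitr1.
have dN x : dot (- v) (x *m (- G)) = x ord0 ord0 by rewrite mulmxN dotNl dotNr opprK.
have [d2 d20 hd2] := cap (- v) (- G) hn h2 uN dN (In_mulmxN uG hG).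
have sl : vol (slice [seq (p.1 *m (- G)^T, p.2) | p <- L] hn) = vol (slice [seq (p.1 *m G^T, p.2) | p <- L] (- hn)).
  have N1 : (-1 : R) != 0 by rewrite oppr_eq0 oner_eq0.
  have bS : bset (slice [seq (p.1 *m G^T, p.2) | p <- L] (- hn)).
    by apply: bset_slice; rewrite -hpoly_mulmx; have [] := vol_mulmx uG hG bP.
  have [_ ->] := vol_aff 0 N1 bS; rewrite normrN1 expr1n mul1r.
  congr vol; apply/seteqP; split => y; rewrite /slice /= -!hpoly_mulmx /= addr0 scaleN1r.
    rewrite mulmxN (_ : cons_rV (- hn, - y) = - cons_rV (hn, y)) ?mulNmx //.
    by rewrite -[RHS]scaleN1r cons_rVZ mulN1r scaleN1r.
  rewrite mulmxN (_ : cons_rV (- hn, - y) = - cons_rV (hn, y)) ?mulNmx //.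
  by rewrite -[RHS]scaleN1r cons_rVZ mulN1r scaleN1r.
exists (Num.min d1 d2); first by rewrite lt_min d10.
move=> s s0; rewrite le_min => /andP[sd1 sd2].
have := hd1 s s0 sd1; have := hd2 s s0 sd2; rewrite sl -eqs /=.
set a := vol (slice _ _); set x := vol (_ `&` _); set y := vol (_ `&` _) => k1 k2.
rewrite -(ler_pM2l c0) -[c in c * `|_|]gtr0_norm // -normrM.
have -> : c * (y - x) = (c * y - s * a) - (c * x - s * a) by ring.
by apply: (le_trans (ler_normB _ _)); lra.
Qed.

End opposite_slices.

Section facet_slices.
Context (R : realType) (k : nat).

(** Reflection exchanges the roles of [p] and [q] on the bottom facet, so the four contributions
    reinforce each other: [(p - q) - (q - p) = 2 (p - q)], with seven errors. *)
Lemma close7 (tt tb bt bb p q a b e : R) : `|a - b| <= e -> `|a - (tt - tb)| <= e -> `|b - (bt - bb)| <= e ->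
  `|tt - p| <= e -> `|tb - q| <= e -> `|bt - q| <= e -> `|bb - p| <= e -> `|p - q| <= 4 * e.
Proof.
rewrite !ler_norml => /andP[h1 h2] /andP[h3 h4] /andP[h5 h6] /andP[h7 h8] /andP[h9 h10] /andP[h11 h12] /andP[h13 h14].
apply/andP; split; lra.
Qed.

(** Each of the two applications of the asymptotics subtracts [pi / 2]; starting from [3 pi / 2]
    ends at [pi / 2]. *)
Lemma phase_close (w x d ep : R) (a b th : R) : 0 < d -> ep <= d / (2 * pi) -> x = a + b -> th = 3 * pi / 2 ->
  `|x - w| <= ep -> `|(2 * pi * b + (2 * pi * a + (th - pi / 2) - pi / 2)) - (pi / 2 + 2 * pi * w)| <= d.
Proof.
move=> d0 hep -> -> h; have p0 : 0 < 2 * pi :> R by rewrite mulr_gt0 // pi_gt0.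
rewrite (_ : _ - _ = 2 * pi * (a + b - w)); last by field.
rewrite normrM gtr0_norm // mulrC -ler_pdivlMr //; exact: le_trans hep.
Qed.

Variables (L : seq ('rV[R]_k.+2 * R)) (z : 'rV[R]_k.+2) (M MT mT : R).
Hypotheses (bP : bset (hpoly L)) (sym : forall x, hpoly L x -> hpoly L (z - x)).
Hypotheses (aM : exists2 x, hpoly L x & x ord0 ord0 = M) (hM : forall x, hpoly L x -> x ord0 ord0 <= M).
Let m := z ord0 ord0 - M.
Let LT := slice_list L M.
Let LB := slice_list L m.
Hypotheses (aMT : exists2 y, hpoly LT y & y ord0 ord0 = MT) (hMT : forall y, hpoly LT y -> y ord0 ord0 <= MT)
  (amT : exists2 y, hpoly LT y & y ord0 ord0 = mT) (hmT : forall y, hpoly LT y -> mT <= y ord0 ord0).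
Let MB := tl z ord0 ord0 - mT.
Let mB := tl z ord0 ord0 - MT.

Let TB y : hpoly LB y <-> hpoly LT (tl z - y).
Proof.
rewrite /LB /LT -!sliceE /slice /=.
have E u : z - cons_rV (u, y) = cons_rV (z ord0 ord0 - u, tl z - y).
  by rewrite -{1}(cons_tl z) -[- cons_rV _]scaleN1r cons_rVZ cons_rVD mulN1r scaleN1r.
split=> h.
  by have := sym h; rewrite E /m opprB addrCA subrr addr0.
have := sym h.
have -> : z - cons_rV (M, tl z - y) = cons_rV (m, y); last by [].
rewrite -{1}(cons_tl z) -[- cons_rV _]scaleN1r cons_rVZ cons_rVD mulN1r scaleN1r /m.
by rewrite opprB addrCA subrr addr0.
Qed.

Let TBr y : hpoly LT y -> hpoly LB (tl z - y).
Proof. by move=> h; apply/TB; rewrite opprB addrCA subrr addr0. Qed.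

Let am : exists2 x, hpoly L x & x ord0 ord0 = m.
Proof. by have [x Px xM] := aM; exists (z - x); [exact: sym|rewrite row_subE xM]. Qed.

Let hm x : hpoly L x -> m <= x ord0 ord0.
Proof. by move=> /sym/hM; rewrite row_subE /m; lra. Qed.

Let aMB : exists2 y, hpoly LB y & y ord0 ord0 = MB.
Proof. by have [y Ty yE] := amT; exists (tl z - y); [exact: TBr|rewrite row_subE yE]. Qed.

Let hMB y : hpoly LB y -> y ord0 ord0 <= MB.
Proof. by move=> /TB/hmT; rewrite row_subE /MB; lra. Qed.

Let amB : exists2 y, hpoly LB y & y ord0 ord0 = mB.
Proof. by have [y Ty yE] := aMT; exists (tl z - y); [exact: TBr|rewrite row_subE yE]. Qed.

Let hmB y : hpoly LB y -> mB <= y ord0 ord0.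
Proof. by move=> /TB/hMT; rewrite row_subE /mB; lra. Qed.

Let bT : bset (hpoly LT). Proof. by rewrite -sliceE; exact: bset_slice. Qed.
Let bB : bset (hpoly LB). Proof. by rewrite -sliceE; exact: bset_slice. Qed.

Let vol_opposite (u : R) : vol (slice LB (tl z ord0 ord0 - u)) = vol (slice LT u).
Proof.
have N1 : (-1 : R) != 0 by rewrite oppr_eq0 oner_eq0.
have [_ ->] := vol_aff (tl (tl z)) N1 (bset_slice u bT); rewrite normrN1 expr1n mul1r.
have E y : tl z - cons_rV (tl z ord0 ord0 - u, y) = cons_rV (u, -1 *: y + tl (tl z)).
  rewrite -{1}(cons_tl (tl z)) -[- cons_rV _]scaleN1r cons_rVZ cons_rVD mulN1r opprB addrCA subrr addr0.
  by rewrite addrC.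
congr vol; apply/seteqP; split => y; rewrite /slice /=.
  by move=> /TB; rewrite E.
by rewrite -E => /TB.
Qed.

(* Zeros [(x0, x1, zeta)] with [x0 >> x1 >> 1] and [zeta] small; the asymptotics
   is uniform in [x1] only up to a bound depending on [j], so the first
   coordinates [rr j] of the centres must grow fast with [j]. *)
Lemma facet_slices : zero_rich (hpoly L) -> vol (slice LT MT) = vol (slice LT mT).
Proof.
move=> [r r0 Z]; apply: (@eq_of_close R _ _ 4) => e e0.
have [d1 d10 near1] := sJ_near_vol (bset_slice MT bT) e0.
have [d2 d20 near2] := sJ_near_vol (bset_slice mT bT) e0.
have [d3 d30 near3] := sJ_near_vol (bset_slice MB bB) e0.
have [d4 d40 near4] := sJ_near_vol (bset_slice mB bB) e0.
have [X1 hX1] := sJ_asymptotics bT aMT hMT amT hmT r e0.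
have [X2 hX2] := sJ_asymptotics bB aMB hMB amB hmB r e0.
have p0 : 0 < pi :> R := pi_gt0 R.
have pp0 : 0 < 2 * pi :> R by rewrite mulr_gt0.
pose d := Num.min (Num.min d1 d2) (Num.min d3 d4).
have d0 : 0 < d by rewrite !lt_min d10 d20 d30.
have [dd1 [dd2 [dd3 dd4]]] : d <= d1 /\ d <= d2 /\ d <= d3 /\ d <= d4.
  by rewrite /d !ge_min !lexx !orbT.
pose t := (2 * (r + 1))^-1; have t0 : 0 < t by rewrite invr_gt0; lra.
have tr : t * r < 2^-1 by rewrite /t mulrC ltr_pdivrMr; lra.
pose ep := Num.min (4^-1) (Num.min (d * t) (d / (2 * pi))).
have ep0 : 0 < ep by rewrite !lt_min invr_gt0 ltr0n mulr_gt0 // divr_gt0.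
have [ep1 [ep2 ep3]] : ep <= 4^-1 /\ ep <= d * t /\ ep <= d / (2 * pi).
  by rewrite /ep !ge_min !lexx !orbT.
have ep4 : ep < 2^-1 by apply: (le_lt_trans ep1); lra.
have [Lam [L0 [LX1 LX2]] rLam] : exists2 Lam : R, 0 < Lam /\ (X1 <= Lam - r /\ X2 <= Lam - r) & r < Lam.
  exists (`|X1| + `|X2| + 2 * r + 1); have := normr_ge0 X1; have := normr_ge0 X2; have := ler_norm X1; have := ler_norm X2.
    by move=> *; do !split; lra.
  by move=> *; lra.
(* Bounds all coordinates but the first of a zero attached to a pair of centres whose larger index
   is [j]. *)
pose tau j : R := j%:R * Lam + Lam.
have tau0 j : 0 < tau j by rewrite /tau ltr_wpDl // mulr_ge0 // ltW.
(* The first asymptotics is later multiplied by [2 pi x1], at most [2 pi tau j]; this tolerance then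
   leaves an error [e]. *)
have eps0 j : 0 < e / (2 * pi * tau j) by rewrite divr_gt0 // mulr_gt0.
have [Xf hXf] := choice (fun j => sJ_asymptotics bP aM hM am hm (tau j) (eps0 j)).
(* Any earlier centre is at least [|Xf j| + r] behind the centre [j], so the first coordinate of the
   zero exceeds the threshold [Xf j] belonging to the larger index. *)
pose rr j := \sum_(i < j.+1) (`|Xf i| + r).
have rr_lt i j : (i < j)%N -> rr i + (`|Xf j| + r) <= rr j.
  elim: j => // j IH; rewrite ltnS leq_eqVlt => /predU1P[->|/IH h]; first by rewrite [in leRHS]/rr big_ord_recr.
  rewrite [in leRHS]/rr big_ord_recr /= lerD2r; apply: le_trans h.
  by rewrite lerDl addr_ge0 // ltW.
pose c j : 'rV[R]_k.+2 := cons_rV (rr j, cons_rV (j%:R * Lam, 0)).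
pose pt (a b : R) : 'rV[R]_k.+2 := cons_rV (a, cons_rV (b, 0)).
pose Y := [:: pt M MT; pt M mT; pt m MB; pt m mB] ++ [seq t *: delta_mx ord0 (lift ord0 (lift ord0 i)) | i <- enum 'I_k].
have l1 j : c j ord0 (lift ord0 ord0) = j%:R * Lam by rewrite cons_rVS cons_rV0.
have diff j j' : (j < j')%N -> Lam <= c j' ord0 (lift ord0 ord0) - c j ord0 (lift ord0 ord0) <= j'%:R * Lam.
  move=> jj; rewrite !l1 lerBlDr lerDl mulr_ge0 ?(ltW L0) // andbT.
  by rewrite -mulrBl -natrB ?(ltnW jj) // ler_peMl ?(ltW L0) // ler1n subn_gt0.
have [|j [j' [xi [jj hxi hY z0]]]] := Z Y ep c ep0.
  move=> j j' /diff/andP[h _]; exists (lift ord0 ord0); apply: (lt_le_trans rLam); apply: (le_trans h); exact: ler_norm.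
pose x0 := xi ord0 ord0; pose x1 := tl xi ord0 ord0; pose ze := tl (tl xi).
have hx0 : Xf j' <= x0.
  have := hxi ord0; rewrite !cons_rV0 /= -/x0 ler_norml => /andP[h _].
  have := rr_lt _ _ jj; have := ler_norm (Xf j'); move: h; lra.
have x1E : x1 = xi ord0 (lift ord0 ord0) by rewrite /x1 mxE.
have [hx1 hx1'] : Lam - r <= x1 /\ x1 <= tau j'.
  have := hxi (lift ord0 ord0); rewrite -x1E ler_norml => /andP[h h'].
  have /andP[k1 k2] := diff _ _ jj; rewrite /tau; move: h h' k1 k2 rLam; split; lra.
have x10 : 0 < x1 by move: hx1 rLam; lra.
have ze_r i : `|ze ord0 i| <= r.
  rewrite mxE mxE; have := hxi (lift ord0 (lift ord0 i)); rewrite !cons_rVS !mxE.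
  by rewrite subrr subr0.
have eta_tau i : `|tl xi ord0 i| <= tau j'.
  case: (unliftP ord0 i) => [i' ->|->].
    have -> : tl xi ord0 (lift ord0 i') = ze ord0 i' by rewrite [RHS]mxE.
    apply: (le_trans (ze_r i')); apply: (le_trans (ltW rLam)).
    by rewrite lerDr; apply: mulr_ge0 => //; exact: ltW.
  by rewrite -/x1 gtr0_norm.
have ze_d i : `|ze ord0 i| <= d.
  apply: (@le_trans _ _ (ep / t)); last by rewrite ler_pdivrMr.
  apply: (small_phase ep0 ep4 t0 tr (ze_r i)); rewrite mxE mxE -dot_delta; apply: hY.
  by rewrite mem_cat; apply/orP; right; apply/mapP; exists i; rewrite ?mem_enum.
have dot_pt (a b : R) : dot xi (pt a b) = x0 * a + x1 * b.
  by rewrite dot_cons dot_cons_l.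
have ph (a b : R) : pt a b \in Y -> exists w : int,
    `|(2 * pi * (x1 * b) + (2 * pi * (x0 * a) + (3 * pi / 2 - pi / 2) - pi / 2)) - (pi / 2 + 2 * pi * w%:~R)| <= d.
  by move=> /hY[w hw]; exists w; apply: phase_close hw; rewrite ?dot_pt.
have inY i : (i < 4)%N -> nth 0 [:: pt M MT; pt M mT; pt m MB; pt m mB] i \in Y.
  by move=> i4; rewrite mem_cat mem_nth.
have [w1 hw1] := ph _ _ (inY 0%N isT); have [w2 hw2] := ph _ _ (inY 1%N isT).
have [w3 hw3] := ph _ _ (inY 2%N isT); have [w4 hw4] := ph _ _ (inY 3%N isT).
have n1 := near1 ze _ (fun i => le_trans (ze_d i) dd1) (ex_intro _ w1 (le_trans hw1 dd1)).
have n2 := near2 ze _ (fun i => le_trans (ze_d i) dd2) (ex_intro _ w2 (le_trans hw2 dd2)).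
have n3 := near3 ze _ (fun i => le_trans (ze_d i) dd3) (ex_intro _ w3 (le_trans hw3 dd3)).
have n4 := near4 ze _ (fun i => le_trans (ze_d i) dd4) (ex_intro _ w4 (le_trans hw4 dd4)).
rewrite (vol_opposite mT) in n3; rewrite (vol_opposite MT) in n4.
have a1 := hX1 _ (le_trans LX1 hx1) ze ze_r (2 * pi * (x0 * M) + (3 * pi / 2 - pi / 2)).
have a2 := hX2 _ (le_trans LX2 hx1) ze ze_r (2 * pi * (x0 * m) + (3 * pi / 2 - pi / 2)).
have a0 := hXf j' _ hx0 (tl xi) eta_tau (3 * pi / 2).
rewrite cons_tl in a0; rewrite z0 mulr0 sub0r normrN !sliceE -/LT -/LB in a0.
have tlE : cons_rV (x1, ze) = tl xi by rewrite cons_tl.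
rewrite tlE in a1 a2.
apply: (close7 _ a1 a2 n1 n2 n3 n4).
rewrite -mulrBr normrM gtr0_norm; last by rewrite mulr_gt0.
apply: (le_trans (ler_pM _ _ (_ : _ <= 2 * pi * tau j') a0)) => //.
- by rewrite ltW // mulr_gt0.
- by rewrite ler_pM2l.
- by rewrite mulrC divfK // gt_eqF // mulr_gt0.
Qed.

End facet_slices.

Section symmetry.
Context (R : realType).

Lemma support_points n (L : seq ('rV[R]_n * R)) : bset (hpoly L) -> hpoly L !=set0 ->
  exists xm : 'rV[R]_n -> 'rV[R]_n, forall v, hpoly L (xm v) /\ forall y, hpoly L y -> dot v y <= dot v (xm v).
Proof.
move=> bP P0.
have [xm h] := choice (fun v => let: ex_intro2 x h1 h2 := hpoly_att v bP P0 in ex_intro (fun x => hpoly L x /\ forall y, hpoly L y -> dot v y <= dot v x) x (conj h1 h2)).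
by exists xm.
Qed.

Lemma hpoly_nonempty n (L : seq ('rV[R]_n.+1 * R)) : 0 < vol (hpoly L) -> hpoly L !=set0.
Proof. by move/vol_gt0_point => [x Px]; exists x. Qed.

(** Shared by the polytope and its facets, which differ only in how extreme slices are proved equal.
    Equality is asked in many coordinate systems, as every direction is made the first coordinate by
    its own matrix. *)
Lemma symmetric_of_slices n (L : seq ('rV[R]_n.+1 * R)) : bset (hpoly L) -> 0 < vol (hpoly L) ->
  (forall (G : 'M[R]_n.+1) (c M m : R), G \in unitmx -> 0 < c ->
    (forall f, nice f -> In (fun x => f (x *m G)) = c * In f) ->
    let L' := [seq (p.1 *m G^T, p.2) | p <- L] in
    (exists2 x, hpoly L' x & x ord0 ord0 = M) -> (forall x, hpoly L' x -> x ord0 ord0 <= M) ->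
    (exists2 x, hpoly L' x & x ord0 ord0 = m) -> (forall x, hpoly L' x -> m <= x ord0 ord0) ->
    vol (slice L' M) = vol (slice L' m)) ->
  exists z, forall x, hpoly L x -> hpoly L (z - x).
Proof.
move=> bP vP slices; have [xm hxm] := support_points bP (hpoly_nonempty vP).
pose h v := dot v (xm v).
apply: (@caps_symmetric R n L h bP vP).
- by move=> v x; have [_] := hxm v; apply.
- by move=> v; have [Px _] := hxm v; exists (xm v).
move=> v v0; have [G uG [c c0 [dG hG]]] := dir_coord v0.
have [Px hx] := hxm v; have [Py hy] := hxm (- v).
apply: (caps_of_slices bP vP hx hy uG c0 dG hG).
have PG x : hpoly [seq (p.1 *m G^T, p.2) | p <- L] x = hpoly L (x *m G) by rewrite -hpoly_mulmx.
apply: (slices G c) => //.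
- by exists (xm v *m invmx G); rewrite ?PG ?mulmxKV // -dG mulmxKV.
- by move=> x; rewrite PG => /hx; rewrite dG.
- exists (xm (- v) *m invmx G); rewrite ?PG ?mulmxKV // -dG mulmxKV //.
  by rewrite dotNl opprK.
- by move=> x; rewrite PG => /hy; rewrite dotNl dG lerNl.
Qed.

Lemma zero_rich_symmetric n (L : seq ('rV[R]_n.+1 * R)) : bset (hpoly L) -> 0 < vol (hpoly L) ->
  zero_rich (hpoly L) -> exists z, forall x, hpoly L x -> hpoly L (z - x).
Proof.
move=> bP vP Z; apply: (symmetric_of_slices bP vP) => G c M m uG c0 hG L' aM hM am hm.
have E := hpoly_mulmx L G.
have bP' : bset (hpoly L') by rewrite -E; have [] := vol_mulmx uG hG bP.
apply: opposite_slices => //.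
by rewrite -E; exact: zero_rich_mulmx uG hG bP Z.
Qed.

(** A change of coordinates inside the hyperplane of a facet has to be lifted to the whole space,
    where the zeros of the transform live. *)
Lemma In_block n (G : 'M[R]_n) (c : R) : G \in unitmx ->
  (forall f, nice f -> In (fun y => f (y *m G)) = c * In f) ->
  exists G2 : 'M[R]_n.+1, [/\ G2 \in unitmx, forall t y, cons_rV (t, y) *m G2 = cons_rV (t, y *m G) &
     forall f, nice f -> In (fun x => f (x *m G2)) = c * In f].
Proof.
move=> uG hG; pose G2 : 'M[R]_n.+1 := block_mx (1%:M : 'M[R]_1) 0 0 G; exists G2.
have uG2 : G2 \in unitmx.
  by rewrite unitmxE (det_ublock (1%:M : 'M[R]_1) 0 G) det1 mul1r -unitmxE.
have cG2 t y : cons_rV (t, y) *m G2 = cons_rV (t, y *m G).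
  rewrite /cons_rV /=; have := mul_row_block (t%:M : 'rV[R]_1) y (1%:M : 'M[R]_1) 0 0 G.
  by rewrite !mulmx0 mulmx1 addr0 add0r.
split => // f nf; rewrite (nice_consC (nice_mulmx uG2 nf)) (nice_consC nf).
have := nice_consI1 nf => n1.
have I1Z (a : R) (g : R -> R) : nice1 g -> I1 (fun t => a * g t) = a * I1 g.
  move=> ng; have [n1' e1] := nice1_rV1 ng; rewrite -e1 -In_Z //.
  have nag : nice1 (fun t => a * g t).
    have [mg [r [k hk]]] := ng; split; first exact: measurable_funM.
    exists r, (`|a| * k) => t; have [h1 h2] := hk t; split; first by rewrite normrM ler_wpM2l.
    by move=> h; apply: h2; apply: contra_neq h => ->; rewrite mulr0.
  by have [_ <-] := nice1_rV1 nag.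
rewrite -I1Z //; congr I1; apply/funext => t; rewrite -hG; last exact: nice_cons2.
by congr In; apply/funext => y; rewrite cG2.
Qed.

Lemma zero_rich_facet k (L : seq ('rV[R]_k.+2 * R)) (z : 'rV[R]_k.+2) (M : R) : bset (hpoly L) ->
  zero_rich (hpoly L) -> (forall x, hpoly L x -> hpoly L (z - x)) ->
  (exists2 x, hpoly L x & x ord0 ord0 = M) -> (forall x, hpoly L x -> x ord0 ord0 <= M) ->
  0 < vol (slice L M) -> exists w, forall y, slice L M y -> slice L M (w - y).
Proof.
move=> bP Z sym aM hM vT; have bT := bset_slice M bP; rewrite sliceE in bT vT *.
apply: (symmetric_of_slices bT vT) => Gv c MT mT uGv c0 hGv L' aMT hMT amT hmT.
have [G [uG cG hG]] := In_block uGv hGv.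
pose L2 : seq ('rV[R]_k.+2 * R) := [seq (p.1 *m G^T, p.2) | p <- L].
have E2 (x : 'rV[R]_k.+2) : hpoly L2 x = hpoly L (x *m G) by rewrite -hpoly_mulmx.
have bP2 : bset (hpoly L2) by rewrite -hpoly_mulmx; have [] := vol_mulmx uG hG bP.
have ELT y : hpoly (slice_list L2 M) y = hpoly L' y.
  by rewrite -[hpoly (slice_list L2 M)]sliceE -hpoly_mulmx /= -sliceE /slice /= E2 cG.
have E0 (x : 'rV[R]_k.+2) : (x *m G) ord0 ord0 = x ord0 ord0 by rewrite -{1}(cons_tl x) cG cons_rV0.
have slE u : slice L' u = slice (slice_list L2 M) u.
  by apply/seteqP; split => y; rewrite /slice /= ELT.
rewrite !slE; apply: (@facet_slices R k L2 (z *m invmx G) M MT mT bP2).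
- by move=> x; rewrite !E2 mulmxBl mulmxKV // => /sym.
- have [x Px xM] := aM; exists (x *m invmx G); first by rewrite E2 mulmxKV.
  by rewrite -E0 mulmxKV.
- by move=> x; rewrite E2 => /hM; rewrite E0.
- by have [y Ty yE] := aMT; exists y; rewrite ?ELT.
- by move=> y; rewrite ELT; exact: hMT.
- by have [y Ty yE] := amT; exists y; rewrite ?ELT.
- by move=> y; rewrite ELT; exact: hmT.
- by rewrite /L2 -hpoly_mulmx; exact: zero_rich_mulmx uG hG bP Z.
Qed.

Lemma centrally_symmetric_of n (P : set 'rV[R]_n) z : (forall x, P x -> P (z - x)) -> centrally_symmetric P.
Proof.
move=> h; exists (- z); apply/seteqP; split => _ [x Px <-].
  by exists (z - x); [exact: h|rewrite addrA addNr add0r].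
by exists (z - x); [exact: h|rewrite opprB addrC].
Qed.

Lemma dot_self_gt0 n (v : 'rV[R]_n) : v != 0 -> 0 < dot v v.
Proof.
move=> v0; rewrite lt_neqAle sumr_ge0 ?andbT; last by move=> i _; rewrite -expr2 sqr_ge0.
apply: contra v0 => /eqP e; apply/eqP/rowP => i; rewrite [RHS]mxE; apply/eqP; rewrite -sqrf_eq0 expr2; apply/eqP.
have h j : true -> 0 <= v ord0 j * v ord0 j by rewrite -expr2 sqr_ge0.
exact: (psumr_eq0P h (esym e)).
Qed.

(* The direction space of a facet is not contained in two independent
   hyperplanes [ker u] and [ker u']. *)
Lemma affine_dim_two_hyperplanes n (F : set 'rV[R]_n) (u u' a b : 'rV[R]_n) (d : nat) : affine_dim F d -> d.+1 = n ->
  (forall x y, F x -> F y -> dot u x = dot u y) -> (forall x y, F x -> F y -> dot u' x = dot u' y) ->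
  dot u a != 0 -> dot u b = 0 -> dot u' b != 0 -> False.
Proof.
move=> [_ [V [_ minV dimV]]] dn hu hu' ua ub u'b.
have VW w : (forall x y, F x -> F y -> dot w x = dot w y) -> forall x, x \in V -> dot w x = 0.
  move=> hw x; have := minV (lker (linfun (mulmxr w^T))) _.
  have mem y : (y \in lker (linfun (mulmxr w^T))) = (dot w y == 0).
    rewrite memv_ker lfunE /= dotC dotE; apply/eqP/eqP => [->|h]; first by rewrite mxE.
    by apply/matrixP => i j; rewrite (ord1 i) (ord1 j) h mxE.
  move=> H xV; apply/eqP; rewrite -mem; move: x xV; apply/subvP; apply: H => y y' Fy Fy'.
  by rewrite mem dotBr (hw _ _ Fy Fy') subrr.
(* Two further independent vectors would make the dimension at least [d + 2], which exceeds [n]. *)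
have fr : free (b :: a :: vbasis V).
  rewrite free_cons free_cons (basis_free (vbasisP V)) andbT; apply/andP; split.
    rewrite span_cons (span_basis (vbasisP V)); apply/negP => /memv_addP[_ /vlineP[k ->] [y yV be]].
    have k0 : k = 0.
      have := ub; rewrite be dotDr dotZr (VW u hu _ yV) addr0 => /eqP.
      by rewrite mulf_eq0 (negbTE ua) orbF => /eqP.
    by move/negP: u'b; apply; rewrite be k0 scale0r add0r (VW u' hu' _ yV).
  rewrite (span_basis (vbasisP V)); apply/negP => aV.
  by move/negP: ua; apply; rewrite (VW u hu _ aV).
have := dimvS (subvf <<b :: a :: vbasis V>>%VS).
move: fr; rewrite /free => /eqP ->; rewrite /= size_tuple dimV dimvf.
by rewrite /dim /= mul1n -dn ltnn.
Qed.

End symmetry.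

(** Differences of points of the box span the space. This excludes the improper face as a facet. *)
Lemma full_dim (R : realType) n (P : set 'rV[R]_n) (x0 : 'rV[R]_n) (h : R) d : 0 < h ->
  (forall x : 'rV[R]_n, (forall i, `|x ord0 i - x0 ord0 i| <= 2 * h) -> P x) ->
  affine_dim P d -> d = n.
Proof.
move=> h0 hP [_ [V [VP _ <-]]].
suff -> : V = fullv by rewrite dimvf /dim /= mul1n.
apply/vspaceP => x; rewrite memvf (row_sum_delta x); apply: memv_suml => i _; apply: memvZ.
have x0P : P x0 by apply: hP => i'; rewrite subrr normr0 mulr_ge0 // ltW.
rewrite -(scale1r (delta_mx _ _)) -(mulVf (lt0r_neq0 h0)) -scalerA; apply: memvZ.
have -> : h *: delta_mx 0 i = (x0 + h *: delta_mx 0 i) - x0 :> 'rV[R]_n by rewrite addrC addKr.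
apply: VP => //; apply: hP => j; rewrite !mxE (addrC (x0 _ _)) addrK eqxx /=.
by case: (j == i); rewrite ?mulr1 ?mulr0 ?normr0 ?(gtr0_norm h0); lra.
Qed.

Lemma symmetric_facet (R : realType) k (L : seq ('rV[R]_k.+2 * R)) (x0 : 'rV[R]_k.+2) (h : R) z F :
  bset (hpoly L) -> 0 < h -> (forall x : 'rV[R]_k.+2, (forall i, `|x ord0 i - x0 ord0 i| <= 2 * h) -> hpoly L x) ->
  zero_rich (hpoly L) -> (forall x, hpoly L x -> hpoly L (z - x)) ->
  facet (hpoly L) F -> centrally_symmetric F.
Proof.
move=> bP h0 hx0 Z sym [[u [c [hu FE]]] [d adim dn]].
have u0 : u != 0.
  apply/eqP => ue; suff dE : d = k.+2 by move/eqP: dn; rewrite dE -addn1 -[eqbRHS]addn0 eqn_add2l.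
  apply: (@full_dim _ _ F x0 h d h0) => // x /hx0 Lx.
  have [y Fy] : F !=set0 by case: adim.
  move: Fy; rewrite FE => -[_ /=]; rewrite ue dot0l => c0.
  by split => //=; rewrite dot0l.
have [G uG [g g0 [dG hG]]] := dir_coord u0.
pose L' : seq ('rV[R]_k.+2 * R) := [seq (p.1 *m G^T, p.2) | p <- L].
have E' (x : 'rV[R]_k.+2) : hpoly L' x = hpoly L (x *m G) by rewrite -hpoly_mulmx.
have bP' : bset (hpoly L') by rewrite -hpoly_mulmx; have [] := vol_mulmx uG hG bP.
have FT (y : 'rV[R]_k.+1) : F (cons_rV (c, y) *m G) <-> slice L' c y.
  rewrite /slice /= E' FE /= dG cons_rV0 /=; split; first by case.
  by move=> ?; split.
have TF x : F x -> exists2 y, slice L' c y & x = cons_rV (c, y) *m G.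
  move=> Fx; have : dot u x = c by move: Fx; rewrite FE => -[].
  rewrite -(mulmxKV uG x) dG => e; have e2 := cons_tl (x *m invmx G); rewrite e in e2.
  exists (tl (x *m invmx G)); last by rewrite e2.
  by apply/FT; rewrite e2 mulmxKV.
have [y0 Fy0] : F !=set0 by case: adim.
have [y1 Ty1 y1E] := TF _ Fy0.
(* A null slice would lie in a second hyperplane by [hpoly_flat], and [F] would have codimension at
   least 2. *)
have vT : 0 < vol (slice L' c).
  rewrite lt_neqAle vol_ge0 andbT; apply/eqP => /esym vT.
  have bT := bset_slice c bP'; rewrite sliceE in bT vT.
  have [|v v0 [c' hv]] := hpoly_flat bT _ vT; first by exists y1; rewrite -sliceE.
  have hv' y : slice L' c y -> dot v y = c' by rewrite sliceE; exact: hv.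
  pose u' := (cons_rV (0, v) : 'rV[R]_k.+2) *m (invmx G)^T.
  have u'E (x : 'rV[R]_k.+2) : dot u' (x *m G) = dot (cons_rV (0, v)) x.
    by rewrite /u' -dot_mulmx mulmxK.
  apply: (@affine_dim_two_hyperplanes _ _ F u u' (cons_rV (1, 0) *m G) (cons_rV (0, v) *m G) d adim dn).
  - by move=> x y; rewrite FE => -[_ /= ->] [_ /= ->].
  - move=> _ _ /TF[x Tx ->] /TF[y Ty ->].
    by rewrite !u'E !dot_cons cons_rV0 !mul0r !add0r tl_cons (hv' _ Tx) (hv' _ Ty).
  - by rewrite dG cons_rV0 oner_eq0.
  - by rewrite dG cons_rV0.
  - by rewrite u'E dot_cons cons_rV0 mul0r add0r tl_cons gt_eqF // dot_self_gt0.
have [w hw] : exists w, forall y, slice L' c y -> slice L' c (w - y).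
  apply: (@zero_rich_facet _ _ L' (z *m invmx G) c bP') => //.
  - by rewrite /L' -hpoly_mulmx; exact: zero_rich_mulmx uG hG bP Z.
  - by move=> x; rewrite !E' mulmxBl mulmxKV // => /sym.
  - by exists (cons_rV (c, y1)); rewrite ?cons_rV0.
  - by move=> x; rewrite E' => /hu; rewrite dG.
apply: (@centrally_symmetric_of _ _ _ (cons_rV (2 * c, w) *m G)) => _ /TF[y Ty ->].
rewrite -mulmxBl (_ : cons_rV _ - cons_rV _ = cons_rV (c, w - y)); first exact/FT/hw.
apply/rowP => i; rewrite row_subE; case: (unliftP ord0 i) => [j ->|->].
  by rewrite !cons_rVS /= row_subE.
by rewrite !cons_rV0 /=; lra.
Qed.

Lemma symmetric_point (R : realType) n (F : set 'rV[R]_n) : affine_dim F 0 -> centrally_symmetric F.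
Proof.
move=> [[x Fx] [V [VF _ /eqP]]]; rewrite dimv_eq0 => /eqP V0.
apply: (@centrally_symmetric_of _ _ _ (x + x)) => y Fy.
have := VF _ _ Fy Fx; rewrite V0 memv0 subr_eq0 => /eqP ->.
by rewrite addrK.
Qed.

Theorem theorem2p1 (R : realType) (n m : nat) (n_ge1 : (1 <= n)%N)
    (m_ge1 : (1 <= m)%N) (A : set 'rV[R]_n) (B : set 'rV[R]_m) :
  convex_polytope A -> bounded_set B -> lebesgue_measurable B ->
  spectral (rV_setX A B) ->
  centrally_symmetric A /\ (forall F, facet A F -> centrally_symmetric F).
Proof.
case: n n_ge1 A => // n _ A [cA [s AE]] bB mB sp.
have [L AL] := convex_hull_hpoly s; rewrite {}AL in AE; subst A.
have [r hr] := bounded_set_coord (compact_bounded cA).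
have bA := bset_hpoly hr; have vA := spectral_vol_gt0 bA bB mB sp.
have [x0 [h h0 hx0]] := hpoly_interior bA vA.
have Z := spectral_zeros bA h0 hx0 bB mB sp.
have [z hz] := zero_rich_symmetric bA vA Z.
split=> [|F FF]; first exact: centrally_symmetric_of hz.
(* On a line the facets are points; from dimension 2 on, a facet has slices of its own. *)
case: n L x0 z s B cA sp r hr bA vA hx0 Z hz F FF {bB mB} => [|k] L x0 z s B cA sp r hr bA vA hx0 Z hz F FF.
  by have [_ [d dF [d0]]] := FF; rewrite d0 in dF; exact: symmetric_point dF.
exact: symmetric_facet bA h0 hx0 Z hz FF.
Qed.
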